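(* A $UW(n,4)$ exists for every $n\in\mathbb{N}$ with $n\ge 4$. Moreover, the number of inequivalent $UW(n,4)$ is bounded above by the number of decompositions of $n$ into sums of non-negative multiples of $5,6,7,8$ and $2m$ (with $2\le m\le n/2$), where the summands $5,6,7,8$ stand for the blocks $W_5,W_6,W_7,W_8$ and the summands $2m$ stand for the blocks $E_{2m}(x)$.
   Context: $\mathbb{T}$ is the set of complex numbers of absolute value one (unimodular numbers). A unit weighing matrix $UW(n,p)$ is an $n\times n$ matrix $W$ with entries in $\mathbb{T}\cup\{0\}$ such that $WW^*=pI_n$, where $^*$ is the Hermitian transpose. Two unit weighing matrices are equivalent if one can be obtained from the other by a finite sequence of the operations: permuting rows, permuting columns, multiplying a row by an element of $\mathbb{T}$, multiplying a column by an element of $\mathbb{T}$. In matrices, $-$ denotes $-1$. Put $a=e^{2\pi i/3}$ and let $$W_5=\begin{pmatrix}1&1&1&1&0\\1&a&\overline a&0&1\\1&\overline a&0&a&\overline a\\1&0&a&\overline a&a\\0&1&\overline a&a&a\end{pmatrix},\quad W_6=\begin{pmatrix}1&1&1&1&0&0\\1&a&\overline a&0&1&0\\1&\overline a&a&0&0&1\\1&0&0&-&-&-\\0&1&0&-&-\overline a&-a\\0&0&1&-&-a&-\overline a\end{pmatrix},$$ $$W_7=\begin{pmatrix}1&1&1&1&0&0&0\\1&-&0&0&1&1&0\\1&0&-&0&-&0&1\\1&0&0&-&0&-&-\\0&1&-&0&0&1&-\\0&1&0&-&1&0&1\\0&0&1&-&-&1&0\end{pmatrix},\quad W_8=\begin{pmatrix}1&1&1&1&0&0&0&0\\1&-&0&0&1&1&0&0\\1&0&-&0&-&0&1&0\\1&0&0&-&0&-&-&0\\0&1&-&0&1&0&0&1\\0&1&0&-&0&1&0&-\\0&0&1&-&0&0&1&1\\0&0&0&0&1&-&1&-\end{pmatrix}.$$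 For $m\ge 2$ and $x\in\mathbb{T}$, $E_{2m}(x)$ is the $2m\times 2m$ matrix which, partitioned into an $m\times m$ array of $2\times2$ blocks $B_{i,j}$, has $$B_{1,1}=\begin{pmatrix}1&1\\1&1\end{pmatrix},\quad B_{i,i+1}=\begin{pmatrix}1&1\\-&-\end{pmatrix}\ (1\le i\le m-1),\quad B_{i+1,i}=\begin{pmatrix}1&-\\1&-\end{pmatrix}\ (1\le i\le m-1),\quad B_{m,m}=\begin{pmatrix}x&-x\\-x&x\end{pmatrix},$$ and all other blocks equal to zero. In counting decompositions of $n$, the order of summands is irrelevant, the summand $6$ coming from $W_6$ is distinguished from the summand $6=2\cdot 3$ coming from $E_6(x)$, and the summand $8$ coming from $W_8$ is distinguished from the summand $8=2\cdot 4$ coming from $E_8(x)$; the value of $x$ is not recorded. For example, $n=6$ has $2$ decompositions and $n=8$ has $3$.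
   Formalization: Inequivalent UW(n,4) are counted with the values of x in the blocks E_{2m}(x) forgotten, since under plain equivalence the bound fails (the E_4(x) form infinitely many classes for n=4); that every UW(n,4) is plainly equivalent to a direct sum of the blocks is stated as well. *)

(* Defs.v *)
From HB Require Import structures.
From Stdlib Require Export Relation_Operators.
From mathcomp Require Export all_boot all_order all_algebra.
From mathcomp Require Export perm.
From mathcomp Require Export spectral complex.
From mathcomp Require Export boolp classical_sets functions cardinality.
From mathcomp Require Export reals trigo.
Set Implicit Arguments.
Unset Strict Implicit.
Unset Printing Implicit Defensive.
Import Order.TTheory GRing.Theory Num.Theory.
Local Open Scope ring_scope.
Local Open Scope sesquilinear_scope.

Section UnitWeighing.
Variable R : realType.
Local Notation C := R[i].

Definition is_UW (n p : nat) (W : 'M[C]_n) : Prop :=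
  (forall i j, `|W i j| = 1 \/ W i j = 0) /\ W *m W^t* = (p%:R)%:M.

Inductive uw_step n (A : 'M[C]_n) : 'M[C]_n -> Prop :=
| RowPerm (s : 'S_n) : uw_step A (row_perm s A)
| ColPerm (s : 'S_n) : uw_step A (col_perm s A)
| RowScale (k : 'I_n) (c : C) of `|c| = 1 :
    uw_step A (\matrix_(i, j) (if i == k then c * A i j else A i j))
| ColScale (k : 'I_n) (c : C) of `|c| = 1 :
    uw_step A (\matrix_(i, j) (if j == k then c * A i j else A i j)).

(* The operations are invertible, so this relation is symmetric. *)
Definition uw_equiv n : 'M[C]_n -> 'M[C]_n -> Prop :=
  clos_refl_trans _ (@uw_step n).

(* The primitive cube root of unity e^(2 pi i / 3). *)
Definition omega : C := Complex (cos (2 * pi / 3)) (sin (2 * pi / 3)).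

Definition mx_of_rows n (rows : seq (seq C)) : 'M[C]_n :=
  \matrix_(i, j) nth 0 (nth [::] rows i) j.

Local Notation a := omega.
Local Notation b := (omega^*)%R.

Definition W5_rows : seq (seq C) :=
  [:: [:: 1; 1; 1; 1; 0];
      [:: 1; a; b; 0; 1];
      [:: 1; b; 0; a; b];
      [:: 1; 0; a; b; a];
      [:: 0; 1; b; a; a]].

Definition W6_rows : seq (seq C) :=
  [:: [:: 1; 1; 1;  1;  0;  0];
      [:: 1; a; b;  0;  1;  0];
      [:: 1; b; a;  0;  0;  1];
      [:: 1; 0; 0; -1; -1; -1];
      [:: 0; 1; 0; -1; -b; -a];
      [:: 0; 0; 1; -1; -a; -b]].

Definition W7_rows : seq (seq C) :=
  [:: [:: 1;  1;  1;  1;  0;  0;  0];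
      [:: 1; -1;  0;  0;  1;  1;  0];
      [:: 1;  0; -1;  0; -1;  0;  1];
      [:: 1;  0;  0; -1;  0; -1; -1];
      [:: 0;  1; -1;  0;  0;  1; -1];
      [:: 0;  1;  0; -1;  1;  0;  1];
      [:: 0;  0;  1; -1; -1;  1;  0]].

Definition W8_rows : seq (seq C) :=
  [:: [:: 1;  1;  1;  1;  0;  0;  0;  0];
      [:: 1; -1;  0;  0;  1;  1;  0;  0];
      [:: 1;  0; -1;  0; -1;  0;  1;  0];
      [:: 1;  0;  0; -1;  0; -1; -1;  0];
      [:: 0;  1; -1;  0;  1;  0;  0;  1];
      [:: 0;  1;  0; -1;  0;  1;  0; -1];
      [:: 0;  0;  1; -1;  0;  0;  1;  1];
      [:: 0;  0;  0;  0;  1; -1;  1; -1]].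

(* The rows of the 2 x 2 block in position (i, j), with i, j counted from 0. *)
Definition E_block (m : nat) (x : C) (i j : nat) : seq (seq C) :=
  if (i == 0%N) && (j == 0%N) then [:: [:: 1; 1]; [:: 1; 1]]
  else if (i.+1 == m) && (j.+1 == m) then [:: [:: x; -x]; [:: -x; x]]
  else if j == i.+1 then [:: [:: 1; 1]; [:: -1; -1]]
  else if i == j.+1 then [:: [:: 1; -1]; [:: 1; -1]]
  else [::].

Definition E_mx (m : nat) (x : C) : 'M[C]_(2 * m) :=
  \matrix_(i, j) nth 0 (nth [::] (E_block m x (i %/ 2) (j %/ 2)) (i %% 2))
                     (j %% 2).

End UnitWeighing.

(* The kinds of summand available for n: inl i is the summand 5 + i, standing
   for W_(5+i); inr m is the summand 2m with 2 <= m <= n/2, standing for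
   E_(2m). *)
Definition summand (n : nat) : finType :=
  ('I_4 + {m : 'I_(n./2).+1 | (1 < m)%N})%type.

Definition summand_size n (s : summand n) : nat :=
  match s with inl i => (5 + i)%N | inr m => (2 * val m)%N end.

(* d s is the multiplicity of s.  Every summand is positive, so multiplicities
   in a decomposition of n are at most n, and the bound n.+1 loses nothing. *)
Definition is_decomposition n (d : {ffun summand n -> 'I_n.+1}) : bool :=
  (\sum_(s : summand n) d s * summand_size s == n)%N.

Definition num_decompositions (n : nat) : nat :=
  #|[set d : {ffun summand n -> 'I_n.+1} | is_decomposition d]|.

Section Classification.
Variable R : realType.
Local Notation C := R[i].

(* The parameter x is used only by the summands 2m. *)
Definition block n (s : summand n) (x : C) : 'M[C]_(summand_size s) :=
  match s with
  | inl i => mx_of_rows _ (nth [::] [:: W5_rows R; W6_rows R; W7_rows R;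
                                        W8_rows R] i)
  | inr m => E_mx (val m) x
  end.

(* V is a direct sum, in some order and for some values in T of the
   parameters, of blocks in which each summand s occurs d s times. *)
Definition is_block_sum n (d : {ffun summand n -> 'I_n.+1})
    (V : 'M[C]_n) : Prop :=
  exists (k : nat) (s : 'I_k -> summand n) (x : 'I_k -> C)
         (e : (\sum_(i < k) summand_size (s i))%N = n),
    [/\ forall i, `|x i| = 1,
        forall t, #|[set i | s i == t]| = d t
      & V = castmx (e, e) (\mxdiag_(i < k) block (s i) (x i))].

(* Equivalence with the values of the parameters x forgotten: the equivalence
   relation generated by the four operations and by changing the values of the
   parameters in a direct sum of blocks.  It is needed to count:  already for
   n = 4 the matrices E_4(x) form infinitely many classes under uw_equiv. *)
Definition uw_equiv_mod_param n : 'M[C]_n -> 'M[C]_n -> Prop :=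
  clos_refl_sym_trans _ (fun A B => uw_step A B \/
    exists d, [/\ is_decomposition d, is_block_sum d A & is_block_sum d B]).

Definition UW_classes_mod_param (n p : nat) : set (set 'M[C]_n) :=
  [set K | exists2 W, is_UW p W &
     K = [set V | is_UW p V /\ uw_equiv_mod_param W V]]%classic.

End Classification.

Arguments UW_classes_mod_param R n p : clear implicits.

(* Main.v *)
From mathcomp Require Import all_boot all_order all_algebra.
From mathcomp Require Import ring lra zify.
Set Implicit Arguments.
Unset Strict Implicit.
Unset Printing Implicit Defensive.
Import Order.TTheory GRing.Theory Num.Theory.
Local Open Scope ring_scope.

(* Entries are zero or unimodular, so conjugation inverts them, and orthogonality of rows r, r'
   says that the quotients W r c / W r' c add up to 0; two, three or four unimodular numbers add
   up to 0 only as opposite pairs or as a rotated triple of cube roots of unity.  Hence distinct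
   rows meet in 0, 2, 3 or 4 columns.
   If two rows meet in exactly 3 columns, normalise them to (1,1,1,1,0) and (1,a,b,0,1): every
   other row is then determined on these five columns by the ones it meets, and counting the
   rows through each column leaves only W_5 and W_6.  The same holds for columns, W_5 and W_6
   being symmetric.
   Otherwise all meets are even.  If no two columns have the same support, two rows or columns
   that meet do so in exactly two places; the six rows that share two columns with a given row
   then generate W_7 or W_8, whose entries are forced by two-term relations.
   If two columns have the same support, rows and columns come in pairs of equal support, and
   following these pairs from one to the next traces out an E_2m(x).
   Removing the block found in this way leaves a smaller weighing matrix. *)

(** * Weighing matrices on finite types *)

(** In the case analyses unimodularity enters only through reciprocals: each orthogonality relation
    is used together with its conjugate, in which every quotient is inverted. That a few numbers and
    their reciprocals both add up to 0 is a statement about elementary symmetric functions, so the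
    geometry of the unit circle becomes a handful of polynomial factorisations. Matrices are
    functions on two arbitrary finite types because removing a block leaves rows and columns indexed
    by subtypes, and because transposition is then a swap of arguments. A block counts as found once
    its rows are confined to its columns; the converse confinement comes from counting, so each
    construction only has to determine supports of rows. The parameter of [E_2m(x)] appears when a
    chain of pairs closes up: all earlier entries can be normalised by scaling a fresh row or
    column, but in the last corner both are already scaled. Its absolute value is all that is known,
    which is why classes are counted only after forgetting parameters. *)

Section Core.
Variable C : numClosedFieldType.

(* The quotients are inner products: for an entry z, z^-1 is the conjugate of z, even if z = 0. *)
Definition weighing (S T : finType) (W : S -> T -> C) : Prop :=
  [/\ forall r c, W r c = 0 \/ `|W r c| = 1,
      forall r r', \sum_c W r c / W r' c = (r == r')%:R * 4
    & forall c c', \sum_r W r c / W r c' = (c == c')%:R * 4].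

Definition supp (T : finType) (v : T -> C) (s : seq T) : Prop :=
  uniq s /\ forall c, (v c != 0) = (c \in s).

Lemma weighing_tr (S T : finType) (W : S -> T -> C) :
  weighing W -> weighing (fun c r => W r c).
Proof. by case=> h1 h2 h3; split. Qed.

Lemma weighing_scale (S T : finType) (W : S -> T -> C) al be :
  (forall r, `|al r| = 1) -> (forall c, `|be c| = 1) ->
  weighing W -> weighing (fun r c => al r * be c * W r c).
Proof.
move=> ha hb [h1 h2 h3].
have na r : al r != 0 by rewrite -normr_eq0 ha oner_eq0.
have nb c : be c != 0 by rewrite -normr_eq0 hb oner_eq0.
split=> [r c|r r'|c c'].
- by case: (h1 r c) => e; [left; rewrite e mulr0 | right; rewrite !normrM ha hb e !mulr1].
- transitivity (al r / al r' * \sum_c W r c / W r' c).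
    rewrite mulr_sumr; apply: eq_bigr => c _; rewrite !invfM.
    rewrite -[RHS](mulr1) -(divff (nb c)); ring.
  by rewrite h2; case: eqP => [->|_]; rewrite ?divff // ?mul1r // !mul0r mulr0.
- transitivity (be c / be c' * \sum_r W r c / W r c').
    rewrite mulr_sumr; apply: eq_bigr => r _; rewrite !invfM.
    rewrite -[RHS](mulr1) -(divff (na r)); ring.
  by rewrite h3; case: eqP => [->|_]; rewrite ?divff // ?mul1r // !mul0r mulr0.
Qed.

(** For [r = r'] each nonzero entry contributes 1 to the inner product, so a row has exactly four
    nonzero entries and any known ones extend to a list of four. The lemmas [supp0] to [supp4] are
    the instances used for naming columns. *)
Lemma supp_ext (S T : finType) (W : S -> T -> C) r s0 : weighing W ->
  uniq s0 -> all (fun c => W r c != 0) s0 ->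
  exists s1, (size s0 + size s1 = 4)%N /\ supp (W r) (s0 ++ s1).
Proof.
case=> h1 h2 _ us0 h0.
have hc : (#|[set c | W r c != 0%R]| = 4)%N.
  have := h2 r r; rewrite eqxx mul1r.
  have -> : \sum_c W r c / W r c = (#|[set c | W r c != 0%R]|)%:R.
    rewrite (bigID (fun c => W r c != 0)) /= addrC big1 ?add0r; last first.
      by move=> c /negPn/eqP ->; rewrite mul0r.
    rewrite (eq_bigr (fun _ => 1)) => [|c hc]; last by rewrite divff.
    rewrite -sum1_card natr_sum; apply: eq_bigl => c; by rewrite inE.
  by move/eqP; rewrite (eqr_nat C _ 4) => /eqP.
exists [seq c <- enum [set c | W r c != 0] | c \notin s0].
have sp : supp (W r) (s0 ++ [seq c <- enum [set c | W r c != 0] | c \notin s0]).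
  split.
    rewrite cat_uniq us0 filter_uniq ?enum_uniq // andbT.
    by apply/hasPn => c; rewrite mem_filter => /andP[].
  move=> c; rewrite mem_cat mem_filter mem_enum inE.
  by have [/(allP h0)|] := boolP (c \in s0).
split=> //; case: sp => u hm; rewrite -size_cat -(card_uniqP u) -hc.
by apply: eq_card => c; rewrite inE -hm.
Qed.

Lemma supp_perm (T : finType) (v : T -> C) s s' : perm_eq s s' -> supp v s -> supp v s'.
Proof.
move=> p [u h]; split; first by rewrite -(perm_uniq p).
by move=> c; rewrite h (perm_mem p).
Qed.

Lemma supp_neq0 (T : finType) (v : T -> C) s c : supp v s -> c \in s -> v c != 0.
Proof. by case=> _ ->. Qed.

Lemma supp_eq0 (T : finType) (v : T -> C) s c : supp v s -> c \notin s -> v c = 0.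
Proof. by case=> _ h; rewrite -h negbK => /eqP. Qed.

Section Rows.
Variables (S T : finType) (W : S -> T -> C).
Hypothesis hW : weighing W.

Lemma weighing_norm r c : W r c != 0 -> `|W r c| = 1.
Proof. by case: hW => h _ _; case: (h r c) => [->|//]; rewrite eqxx. Qed.

Lemma supp0 r : exists c1 c2 c3 c4, supp (W r) [:: c1; c2; c3; c4].
Proof.
have [|//|[|c1 [|c2 [|c3 [|c4 [|? ?]]]]] [//= _ h]] := @supp_ext _ _ W r [::] hW.
  by [].
by exists c1, c2, c3, c4.
Qed.

Lemma supp1 r c1 : W r c1 != 0 -> exists c2 c3 c4, supp (W r) [:: c1; c2; c3; c4].
Proof.
move=> h1.
have [||[|c2 [|c3 [|c4 [|? ?]]]] [//= _ h]] := @supp_ext _ _ W r [:: c1] hW => //=.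
  by rewrite h1.
by exists c2, c3, c4.
Qed.

Lemma supp2 r c1 c2 : c1 != c2 -> W r c1 != 0 -> W r c2 != 0 ->
  exists c3 c4, supp (W r) [:: c1; c2; c3; c4].
Proof.
move=> n12 h1 h2.
have [||[|c3 [|c4 [|? ?]]] [//= _ h]] := @supp_ext _ _ W r [:: c1; c2] hW => //=.
- by rewrite inE n12.
- by rewrite h1 h2.
by exists c3, c4.
Qed.

Lemma supp3 r c1 c2 c3 : uniq [:: c1; c2; c3] -> W r c1 != 0 -> W r c2 != 0 ->
  W r c3 != 0 -> exists c4, supp (W r) [:: c1; c2; c3; c4].
Proof.
move=> n h1 h2 h3.
have [||[|c4 [|? ?]] [//= _ h]] := @supp_ext _ _ W r [:: c1; c2; c3] hW => //=.
  by rewrite h1 h2 h3.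
by exists c4.
Qed.

Lemma supp4 r c1 c2 c3 c4 : uniq [:: c1; c2; c3; c4] -> W r c1 != 0 -> W r c2 != 0 ->
  W r c3 != 0 -> W r c4 != 0 -> supp (W r) [:: c1; c2; c3; c4].
Proof.
move=> n h1 h2 h3 h4.
have [||[|? ?] [//= _ h]] := @supp_ext _ _ W r [:: c1; c2; c3; c4] hW => //=.
by rewrite h1 h2 h3 h4.
Qed.

Lemma row_eq r r' c1 c2 c3 c4 : supp (W r) [:: c1; c2; c3; c4] -> r != r' ->
  W r' c1 / W r c1 + W r' c2 / W r c2 + W r' c3 / W r c3 + W r' c4 / W r c4 = 0.
Proof.
move=> [u h] n; case: hW => _ /(_ r' r) + _.
rewrite eq_sym (negPf n) mul0r (bigID (fun c => c \in [:: c1; c2; c3; c4])) /=.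
rewrite [X in _ + X]big1 ?addr0; last first.
  by move=> c; rewrite -h => /negPn/eqP ->; rewrite invr0 mulr0.
by rewrite -big_uniq // !big_cons big_nil /= addr0 !addrA.
Qed.

(** The conjugate of [row_eq]. An entry of [r'] that vanishes drops out of both relations, since the
    inverse of 0 is 0. *)
Lemma row_eqV r r' c1 c2 c3 c4 : supp (W r) [:: c1; c2; c3; c4] -> r != r' ->
  W r c1 / W r' c1 + W r c2 / W r' c2 + W r c3 / W r' c3 + W r c4 / W r' c4 = 0.
Proof.
move=> [u h] n; case: hW => _ /(_ r r') + _.
rewrite (negPf n) mul0r (bigID (fun c => c \in [:: c1; c2; c3; c4])) /=.
rewrite [X in _ + X]big1 ?addr0; last first.
  by move=> c; rewrite -h => /negPn/eqP ->; rewrite mul0r.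
by rewrite -big_uniq // !big_cons big_nil /= addr0 !addrA.
Qed.

Lemma row_meet r r' c1 c2 c3 c4 : supp (W r) [:: c1; c2; c3; c4] -> r != r' ->
  W r' c1 != 0 -> [|| W r' c2 != 0, W r' c3 != 0 | W r' c4 != 0].
Proof.
move=> hs n h1; have := row_eq hs n.
apply: contra_eqT; rewrite !negb_or !negbK => /and3P[/eqP-> /eqP-> /eqP->].
rewrite !mul0r !addr0 mulf_neq0 // invr_eq0.
by apply: (supp_neq0 hs); rewrite inE eqxx.
Qed.

Lemma two_term r r' c c' : r != r' -> c != c' ->
  W r c != 0 -> W r' c != 0 -> W r c' != 0 -> W r' c' != 0 ->
  (forall x, W r x != 0 -> W r' x != 0 -> x = c \/ x = c') ->
  W r' c' = - (W r' c * W r c' / W r c).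
Proof.
move=> n nc h1 h2 h3 h4 hx; have [x [y s]] := supp2 nc h1 h3.
move: (s.1); rewrite /= !inE !negb_or => /and4P[/and3P[_ nx ny] /andP[nx' ny'] _ _].
have z t : t \in [:: x; y] -> W r' t = 0.
  move=> ht; apply/eqP; apply: contraT => hr'.
  have hr : W r t != 0 by apply: (supp_neq0 s); move: ht; rewrite !inE => ->; rewrite !orbT.
  move: ht nx ny nx' ny'; rewrite !inE => /orP[]/eqP e; rewrite e in hr hr' *;
    by case: (hx _ hr hr') => ->; rewrite ?eqxx.
have := row_eq s n; rewrite (z x) ?(z y) ?inE ?eqxx ?orbT // !mul0r !addr0 addrC => /eqP.
by rewrite addr_eq0 => /eqP e; rewrite -[LHS](divfK h3) e; ring.
Qed.

End Rows.

(** Positions and block entries are indexed by [nat], so no size such as [2 * m] enters a type. Only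
    the rows are required to stay inside the block; [embeds_cols] supplies the columns. *)
Definition embeds (S T : finType) (W : S -> T -> C) (k : nat) (B : nat -> nat -> C) : Prop :=
  exists (f : nat -> S) (g : nat -> T) (al be : nat -> C),
  [/\ {in gtn k &, injective f}, {in gtn k &, injective g},
      forall i, (i < k)%N -> `|al i| = 1 /\ `|be i| = 1,
      forall i j, (i < k)%N -> (j < k)%N -> W (f i) (g j) = al i * be j * B i j
    & forall i c, (i < k)%N -> W (f i) c != 0 -> exists2 j, (j < k)%N & c = g j].

Lemma embeds_scale (S T : finType) (W : S -> T -> C) al be k B :
  (forall r, `|al r| = 1) -> (forall c, `|be c| = 1) ->
  embeds (fun r c => al r * be c * W r c) k B -> embeds W k B.
Proof.
move=> ha hb [f [g [al' [be' [fI gI hn hv hs]]]]].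
have na r : al r != 0 by rewrite -normr_eq0 ha oner_eq0.
have nb c : be c != 0 by rewrite -normr_eq0 hb oner_eq0.
exists f, g, (fun i => al' i / al (f i)), (fun i => be' i / be (g i)); split=> //.
- by move=> i /hn[e1 e2]; rewrite !normrM !normfV e1 e2 ha hb invr1 !mulr1.
- move=> i j hi hj; have := hv i j hi hj => e.
  have -> : B i j = B i j * (al (f i) / al (f i)) * (be (g j) / be (g j)).
    by rewrite !divff // !mulr1.
  have -> : W (f i) (g j) = W (f i) (g j) * (al (f i) / al (f i)) * (be (g j) / be (g j)).
    by rewrite !divff // !mulr1.
  have -> : W (f i) (g j) * (al (f i) / al (f i)) * (be (g j) / be (g j)) =
    (al (f i) * be (g j) * W (f i) (g j)) / al (f i) / be (g j) by ring.
  by rewrite e !divff // !mulr1; ring.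
- by move=> i c hi h; apply: (hs i) => //; rewrite !mulf_neq0.
Qed.

(* Double counting: k rows and k columns contain 4 k nonzero entries each. *)
Lemma embeds_cols (S T : finType) (W : S -> T -> C) f g k :
  weighing W -> {in gtn k &, injective f} -> {in gtn k &, injective g} ->
  (forall i c, (i < k)%N -> W (f i) c != 0 -> exists2 j, (j < k)%N & c = g j) ->
  forall j r, (j < k)%N -> W r (g j) != 0 -> exists2 i, (i < k)%N & r = f i.
Proof.
move=> [h1 h2 h3] fI gI hf.
have uf : uniq [seq f i | i <- iota 0 k].
  rewrite map_inj_in_uniq ?iota_uniq // => i j; rewrite !mem_iota /= !add0n; exact: fI.
have ug : uniq [seq g i | i <- iota 0 k].
  rewrite map_inj_in_uniq ?iota_uniq // => i j; rewrite !mem_iota /= !add0n; exact: gI.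
pose F := [seq f i | i <- iota 0 k]; pose G := [seq g i | i <- iota 0 k].
pose nz r c : nat := W r c != 0.
have nzE r c : W r c / W r c = (nz r c)%:R.
  by rewrite /nz; have [->|h] := eqVneq (W r c) 0; rewrite ?mul0r // divff.
have row4 r : (\sum_c nz r c = 4)%N.
  have := h2 r r; rewrite eqxx mul1r (eq_bigr _ (fun c _ => nzE r c)) -natr_sum.
  by move/eqP; rewrite (eqr_nat C _ 4) => /eqP.
have col4 c : (\sum_r nz r c = 4)%N.
  have := h3 c c; rewrite eqxx mul1r (eq_bigr _ (fun r _ => nzE r c)) -natr_sum.
  by move/eqP; rewrite (eqr_nat C _ 4) => /eqP.
have t1 : (\sum_(r in F) \sum_(c in G) nz r c = 4 * k)%N.
  transitivity (\sum_(r in F) 4)%N.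
    apply: eq_bigr => r /mapP[i]; rewrite mem_iota add0n => /= hi ->.
    rewrite -(row4 (f i)) [RHS](bigID (fun c => c \in G)) /= [X in (_ + X)%N]big1 ?addn0 // => c hc.
    rewrite /nz; case: eqP => // /eqP /(hf _ _ hi)[j hj e].
    by case/negP: hc; rewrite e; apply: map_f; rewrite mem_iota.
  by rewrite sum_nat_const (card_uniqP uf) size_map size_iota mulnC.
have t2 : (\sum_r \sum_(c in G) nz r c = 4 * k)%N.
  rewrite exchange_big /= (eq_bigr (fun _ => 4)%N) ?sum_nat_const //.
  by rewrite (card_uniqP ug) size_map size_iota mulnC.
have t3 : (\sum_(r | r \notin F) \sum_(c in G) nz r c = 0)%N.
  by move: t2; rewrite (bigID (fun r => r \in F)) /= t1 => /eqP; rewrite -{2}(addn0 (4 * k)%N) eqn_add2l => /eqP.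
move=> j r hj hr.
have [/mapP[i]|hF] := boolP (r \in F); first by rewrite mem_iota add0n => /= hi ->; exists i.
move/eqP: t3; rewrite sum_nat_eq0 => /forallP/(_ r)/implyP/(_ hF).
have gG : g j \in G by apply: map_f; rewrite mem_iota.
by rewrite sum_nat_eq0 => /forallP/(_ (g j))/implyP/(_ gG); rewrite /nz hr.
Qed.

(** A block found in the transpose confines columns of [W]; [embeds_cols], applied to the transpose,
    turns this into confinement of rows, and symmetry of [B] restores the block itself. *)
Lemma embeds_tr (S T : finType) (W : S -> T -> C) k B : weighing W ->
  (forall i j, (i < k)%N -> (j < k)%N -> B i j = B j i) ->
  embeds (fun c r => W r c) k B -> embeds W k B.
Proof.
move=> hW hB [f [g [al [be [fI gI hn hv hs]]]]].
exists g, f, be, al; split=> //.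
- by move=> i /hn[].
- by move=> i j hi hj; rewrite hv // hB // (mulrC (be i)).
- exact: (embeds_cols (weighing_tr hW) fI gI hs).
Qed.

Lemma embeds_seq (S T : finType) (W : S -> T -> C) r0 c0 fs gs als bes k B :
  uniq fs -> uniq gs -> [&& size fs == k, size gs == k, size als == k & size bes == k] ->
  all (fun x : C => `|x| == 1) als -> all (fun x : C => `|x| == 1) bes ->
  (forall r c, r \in fs -> W r c != 0 -> c \in gs) ->
  (forall i j, (i < k)%N -> (j < k)%N ->
     W (nth r0 fs i) (nth c0 gs j) = nth 1 als i * nth 1 bes j * B i j) ->
  embeds W k B.
Proof.
move=> uf ug /and4P[/eqP sf /eqP sg /eqP sa /eqP sb] na nb hs hv.
exists (nth r0 fs), (nth c0 gs), (nth 1 als), (nth 1 bes); split=> //.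
- by move=> i j; rewrite !inE -sf => hi hj /eqP; rewrite nth_uniq // => /eqP.
- by move=> i j; rewrite !inE -sg => hi hj /eqP; rewrite nth_uniq // => /eqP.
- move=> i hi; split; apply/eqP.
    by apply: (all_nthP 1 na); rewrite sa.
  by apply: (all_nthP 1 nb); rewrite sb.
- move=> i c hi h; have := hs _ c (mem_nth r0 (_ : i < size fs)%N); rewrite sf => /(_ hi h) hc.
  by exists (index c gs); rewrite ?nth_index // -sg index_mem.
Qed.

(* ps lists, row by row, the positions of the nonzero entries of B. *)
Lemma embeds_supp (S T : finType) (W : S -> T -> C) r0 c0 fs gs als bes k B (ps : seq (seq nat)) :
  uniq fs -> uniq gs -> [&& size fs == k, size gs == k, size als == k & size bes == k] ->
  all (fun x : C => `|x| == 1) als -> all (fun x : C => `|x| == 1) bes ->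
  all (all (gtn k)) ps -> size ps = k ->
  (forall i j, (i < k)%N -> (j < k)%N -> j \notin nth [::] ps i -> B i j = 0) ->
  (forall i, (i < k)%N -> supp (W (nth r0 fs i)) [seq nth c0 gs j | j <- nth [::] ps i]) ->
  (forall i, (i < k)%N -> {in nth [::] ps i, forall j,
     W (nth r0 fs i) (nth c0 gs j) = nth 1 als i * nth 1 bes j * B i j}) ->
  embeds W k B.
Proof.
move=> uf ug hk na nb hps sps hB hs hv; apply: (@embeds_seq _ _ _ r0 c0 fs gs als bes) => //.
  move=> r c hr hc; case/and4P: hk => /eqP sf /eqP sg _ _.
  have hi : (index r fs < k)%N by rewrite -sf index_mem.
  case: (hs _ hi) => _ h; move: hc; rewrite -(nth_index r0 hr) h => /mapP[j hj ->].
  apply: mem_nth; rewrite sg; apply: (allP (allP hps (nth [::] ps (index r fs)) _)) => //.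
  by rewrite mem_nth // sps.
move=> i j hi hj; case/and4P: hk => /eqP sf /eqP sg _ _.
have [|hn] := boolP (j \in nth [::] ps i); first exact: hv.
rewrite hB // mulr0; apply: (supp_eq0 (hs _ hi)); apply/negP => /mapP[j' hj' /eqP].
rewrite nth_uniq ?sg // => [/eqP e|]; first by rewrite e hj' in hn.
by apply: (allP (allP hps (nth [::] ps i) _)) => //; rewrite mem_nth // sps.
Qed.

End Core.

(** * Two rows meeting in exactly three columns *)

Section CubeRoots.
Variables (C : numClosedFieldType) (a b : C).
Hypotheses (ab : a * b = 1) (sab : 1 + a + b = 0).

Definition entry (rows : seq (seq C)) (i j : nat) : C := nth 0 (nth [::] rows i) j.

(** All that is known of [a] and [b] is that they are the two roots of t^2 + t + 1; [omega] is
    substituted only when passing to matrices. *)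
Definition W5_of : seq (seq C) :=
  [:: [:: 1; 1; 1; 1; 0];
      [:: 1; a; b; 0; 1];
      [:: 1; b; 0; a; b];
      [:: 1; 0; a; b; a];
      [:: 0; 1; b; a; a]].

Definition W6_of : seq (seq C) :=
  [:: [:: 1; 1; 1;  1;  0;  0];
      [:: 1; a; b;  0;  1;  0];
      [:: 1; b; a;  0;  0;  1];
      [:: 1; 0; 0; -1; -1; -1];
      [:: 0; 1; 0; -1; -b; -a];
      [:: 0; 0; 1; -1; -a; -b]].

Lemma bE : b = - 1 - a.
Proof. by apply/eqP; rewrite -subr_eq0 -sab; apply/eqP; ring. Qed.

Lemma aa : a * a = b.
Proof.
have : a * (1 + a + b) = 0 by rewrite sab mulr0.
rewrite !mulrDr ab mulr1 => e; apply/eqP; rewrite -subr_eq0.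
by apply/eqP; rewrite -e -[RHS]subr0 -sab; ring.
Qed.

Lemma a_neq0 : a != 0.
Proof. by apply: contra_eq_neq ab => ->; rewrite mul0r eq_sym oner_eq0. Qed.

Lemma b_neq0 : b != 0.
Proof. by apply: contra_eq_neq ab => ->; rewrite mulr0 eq_sym oner_eq0. Qed.

Lemma aV : a^-1 = b.
Proof. by rewrite -[LHS]mulr1 -ab mulKf ?a_neq0. Qed.

Lemma bV : b^-1 = a.
Proof. by rewrite -[LHS]mulr1 -ab mulrC mulfK ?b_neq0. Qed.

(** The first two elementary symmetric functions of [x], [y], [z] vanish, so these are the three
    cube roots of [x * y * z]. *)
Lemma sum3_roots x y z : x != 0 -> y != 0 -> z != 0 ->
  x + y + z = 0 -> x^-1 + y^-1 + z^-1 = 0 -> y = a * x \/ y = b * x.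
Proof.
move=> x0 y0 z0 e1 e2.
have : (y - a * x) * (y - b * x) = 0.
  have -> : (y - a * x) * (y - b * x) = (x + y + z) * (x + y) - (x * y * z) * (x^-1 + y^-1 + z^-1)
     + (a * b - 1) * x ^+ 2 - (1 + a + b) * x * y by field; rewrite x0 y0 z0.
  by rewrite e1 e2 ab sab; ring.
by move/eqP; rewrite mulf_eq0 !subr_eq0 => /orP[]/eqP; [left|right].
Qed.

(** Solving both relations for [w] and its inverse and multiplying gives k^2 = 1; this is the
    algebraic form of comparing the absolute values k and 1. *)
Lemma multiple_absurd (x w : C) (k : nat) : (1 < k)%N -> x != 0 ->
  k%:R * x + w = 0 -> k%:R * x^-1 + w^-1 = 0 -> False.
Proof.
move=> hk x0 e1 e2.
have ew : w = - (k%:R * x) by apply/eqP; rewrite -addr_eq0 addrC e1.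
have ew' : w^-1 = - (k%:R * x^-1) by apply/eqP; rewrite -addr_eq0 addrC e2.
have w0 : w != 0.
  by rewrite ew oppr_eq0 mulf_neq0 // pnatr_eq0; case: k hk {e1 e2 ew ew'}.
have : (k * k)%:R = 1 :> C.
  by rewrite -[RHS](divff w0) ew' ew natrM mulrNN mulrACA divff // mulr1.
by move/eqP; rewrite (eqr_nat C _ 1); case: k hk {e1 e2 ew ew'} => [|[|k]].
Qed.

(** Here [x], [y] are the entries of a third row in two of the three shared columns and [z], [w] its
    entries in the two columns that are not shared. The first relation leaves the ratios [t] and
    [t'], and the ratio [t'] would turn the second into 2x + w = 0. *)
Lemma pair_root t t' x y z w : t * t' = 1 -> 1 + t + t' = 0 ->
  (t = a /\ t' = b) \/ (t = b /\ t' = a) -> x != 0 -> y != 0 ->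
  x + y + z = 0 -> x^-1 + y^-1 + z^-1 = 0 ->
  x + t * y + w = 0 -> x^-1 + t' * y^-1 + w^-1 = 0 -> y = t * x.
Proof.
move=> tt st ht x0 y0 e1 e1' e2 e2'.
have bad : y = t' * x -> y = t * x.
  move=> e; exfalso; apply: (@multiple_absurd x w 2) => //.
    by rewrite -[RHS]e2 e mulrA tt; ring.
  rewrite -[RHS]e2' e invfM mulrA divff; first by ring.
  by apply: contra_eq_neq tt => ->; rewrite mulr0 eq_sym oner_eq0.
have [z0|z0] := eqVneq z 0; last first.
  have [e|e] := sum3_roots x0 y0 z0 e1 e1'; case: ht => -[ht ht'].
  - by rewrite ht.
  - by apply: bad; rewrite ht'.
  - by apply: bad; rewrite ht'.
  - by rewrite ht.
(* If z = 0 then y = -x, and w times its inverse would be (t - 1)(t' - 1) = 3. *)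
exfalso; move: e1; rewrite z0 addr0 => /eqP; rewrite addrC addr_eq0 => /eqP ye.
have ew : w = (t - 1) * x by apply/eqP; rewrite -subr_eq0 -[X in _ == X]e2 ye; apply/eqP; ring.
have ew' : w^-1 = (t' - 1) * x^-1.
  by apply/eqP; rewrite -subr_eq0 -[X in _ == X]e2' ye invrN; apply/eqP; ring.
have e3 : w * w^-1 = 3.
  rewrite ew' ew mulrACA divff // mulr1.
  have -> : (t - 1) * (t' - 1) = t * t' + 2 - (1 + t + t') by ring.
  by rewrite tt st; ring.
move: e3; have [->|w0] := eqVneq w 0.
  by rewrite mul0r => /eqP; rewrite eq_sym pnatr_eq0.
by rewrite divff // => /eqP; rewrite eq_sym (eqr_nat C 3 1).
Qed.

(** Whichever of [u], [w] is 0, the relation containing it is a sum of three cube roots. One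
    orientation makes the other relation three times a single number plus one entry, which is
    absurd; the other orientation satisfies it with the last entry 0. *)
Lemma triple_root x y z u w : x != 0 -> y != 0 -> z != 0 ->
  x + y + z + u = 0 -> x^-1 + y^-1 + z^-1 + u^-1 = 0 ->
  x + b * y + a * z + w = 0 -> x^-1 + a * y^-1 + b * z^-1 + w^-1 = 0 ->
  u = 0 \/ w = 0 -> [/\ y = b * x, z = a * x, u = 0 & w = 0].
Proof.
move=> x0 y0 z0 e1 e1' e2 e2'.
have b2 : b * b = a by rewrite -{1}aa -mulrA ab mulr1.
case=> [u0|w0].
  rewrite u0 ?invr0 !addr0 in e1 e1' *.
  have zE : z = - (x + y) by apply/eqP; rewrite -addr_eq0 addrC e1.
  have [e|e] := sum3_roots x0 y0 z0 e1 e1'.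
    have ze : z = b * x by rewrite zE e bE; ring.
    exfalso; apply: (@multiple_absurd x w 3) => //.
      rewrite -[RHS]e2 e ze !mulrA ab [b * a]mulrC ab; ring.
    rewrite -[RHS]e2' e ze !invfM !mulrA divff ?a_neq0 // divff ?b_neq0 //; ring.
  have ze : z = a * x by rewrite zE e bE; ring.
  split=> //; move: e2; rewrite e ze !mulrA b2 aa => e2.
  have -> : w = (x + a * x + b * x + w) - (1 + a + b) * x by ring.
  by rewrite e2 sab; ring.
rewrite w0 ?invr0 !addr0 in e2 e2' *.
have by0 : b * y != 0 by rewrite mulf_neq0 // b_neq0.
have az0 : a * z != 0 by rewrite mulf_neq0 // a_neq0.
have e2'' : x^-1 + (b * y)^-1 + (a * z)^-1 = 0 by rewrite !invfM aV bV.
have zE : a * z = - (x + b * y) by apply/eqP; rewrite -addr_eq0 addrC e2.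
have [e|e] := sum3_roots x0 by0 az0 e2 e2''.
  have ye : y = b * x by rewrite -[LHS]mul1r -ab -mulrA e mulrA aa.
  have ze : z = a * x.
    rewrite -[LHS]mul1r -ab [a * b]mulrC -mulrA zE e.
    by have -> : - (x + a * x) = b * x by [rewrite bE; ring]; rewrite mulrA b2.
  split=> //; move: e1; rewrite ye ze => e1.
  have -> : u = (x + b * x + a * x + u) - (1 + a + b) * x by ring.
  by rewrite e1 sab; ring.
have ye : y = x by apply: (mulfI b_neq0).
have ze : z = x.
  by apply: (mulfI a_neq0); rewrite zE ye bE; ring.
exfalso; apply: (@multiple_absurd x u 3) => //.
  by rewrite -[RHS]e1 ye ze; ring.
by rewrite -[RHS]e1' ye ze; ring.
Qed.

Lemma two_of_three (X : eqType) (q1 q2 q3 t t' : X) :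
  uniq [:: q1; q2; q3] -> t != t' -> t \in [:: q1; q2; q3] -> t' \in [:: q1; q2; q3] ->
  ((q1 \in [:: t; t']) + (q2 \in [:: t; t']) + (q3 \in [:: t; t']) = 2)%N.
Proof.
rewrite /= !inE !negb_or => /and3P[/andP[n12 n13] n23 _].
move=> nt /or3P[]/eqP et /or3P[]/eqP et'; move: nt; rewrite et et' ?eqxx //= ?(negPf n12) ?(negPf n13) ?(negPf n23)
  ?(eq_sym q2 q1) ?(eq_sym q3 q1) ?(eq_sym q3 q2) ?(negPf n12) ?(negPf n13) ?(negPf n23) //.
Qed.

(** * Rows meeting two normalised rows *)

Section OverlapThree.
Variables (S T : finType) (W : S -> T -> C).
Hypothesis hW : weighing W.
Let hWt := weighing_tr hW.
Variables (r1 r2 : S) (c1 c2 c3 c4 c5 : T).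
Hypotheses (n12 : r1 != r2) (s1 : supp (W r1) [:: c1; c2; c3; c4])
  (s2 : supp (W r2) [:: c1; c2; c3; c5]).
Hypotheses (v11 : W r1 c1 = 1) (v12 : W r1 c2 = 1) (v13 : W r1 c3 = 1) (v14 : W r1 c4 = 1).
Hypotheses (v21 : W r2 c1 = 1) (v22 : W r2 c2 = a) (v23 : W r2 c3 = b) (v24 : W r2 c4 = 0)
  (v25 : W r2 c5 = 1).

Let u5 : uniq [:: c1; c2; c3; c4; c5].
Proof.
case: s1 s2 => u1 h1 [u2 _]; move: u1 u2; rewrite /= !inE !negb_or.
move=> /and4P[/and3P[-> -> ->] /andP[-> ->] -> _] /and4P[/and3P[_ _ ->] /andP[_ ->] -> _] /=.
rewrite andbT; apply/eqP => e; move: v25; rewrite -e v24 => /eqP.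
by rewrite eq_sym oner_eq0.
Qed.

Let v15 : W r1 c5 = 0.
Proof.
apply: (supp_eq0 s1); move: u5; rewrite /= !inE !negb_or !(eq_sym c5).
by move=> /and5P[/and4P[_ _ _ ->] /and3P[_ _ ->] /andP[_ ->] -> _].
Qed.

(* On c1, ..., c5 a row p other than r1, r2 is determined, up to a factor, by the set of those of
   c1, c2, c3 that it meets; the names other1, ..., other123 list this set. *)
Let other p : p != r1 -> p != r2 ->
  [/\ W p c1 + W p c2 + W p c3 + W p c4 = 0,
      (W p c1)^-1 + (W p c2)^-1 + (W p c3)^-1 + (W p c4)^-1 = 0,
      W p c1 + b * W p c2 + a * W p c3 + W p c5 = 0,
      (W p c1)^-1 + a * (W p c2)^-1 + b * (W p c3)^-1 + (W p c5)^-1 = 0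
    & [|| W p c1 == 0, W p c2 == 0, W p c3 == 0, W p c4 == 0 | W p c5 == 0]].
Proof.
move=> n1 n2; rewrite eq_sym in n1; rewrite eq_sym in n2.
have := row_eq hW s1 n1; have := row_eqV hW s1 n1.
have := row_eq hW s2 n2; have := row_eqV hW s2 n2.
rewrite v11 v12 v13 v14 v21 v22 v23 v25 !divr1 !mul1r aV bV ![_ * b]mulrC ![_ * a]mulrC.
move=> -> -> -> ->; split=> //.
(* Five nonzero entries would exceed the weight four of a row. *)
apply: contraT; rewrite !negb_or => /and5P[h1 h2 h3 h4 h5].
have u4 : uniq [:: c1; c2; c3; c4] by case: s1.
case/eqP: h5; apply: (supp_eq0 (supp4 hW u4 h1 h2 h3 h4)).
move: u5; rewrite /= !inE !negb_or !(eq_sym c5).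
by move=> /and5P[/and4P[_ _ _ ->] /and3P[_ _ ->] /andP[_ ->] -> _].
Qed.

Lemma other1 p : p != r1 -> p != r2 -> W p c2 = 0 -> W p c3 = 0 ->
  W p c4 = - W p c1 /\ W p c5 = - W p c1.
Proof.
move=> n1 n2 e2 e3; case: (other n1 n2) => + _ + _ _.
rewrite e2 e3 !mulr0 !addr0 => h1 h2.
by split; apply/eqP; rewrite -addr_eq0 addrC ?h1 ?h2.
Qed.

Lemma other2 p : p != r1 -> p != r2 -> W p c1 = 0 -> W p c3 = 0 ->
  W p c4 = - W p c2 /\ W p c5 = - (b * W p c2).
Proof.
move=> n1 n2 e2 e3; case: (other n1 n2) => + _ + _ _.
rewrite e2 e3 !mulr0 ?add0r !addr0 => h1 h2.
by split; apply/eqP; rewrite -addr_eq0 addrC ?h1 ?h2.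
Qed.

Lemma other3 p : p != r1 -> p != r2 -> W p c1 = 0 -> W p c2 = 0 ->
  W p c4 = - W p c3 /\ W p c5 = - (a * W p c3).
Proof.
move=> n1 n2 e2 e3; case: (other n1 n2) => + _ + _ _.
rewrite e2 e3 !mulr0 ?add0r => h1 h2.
by split; apply/eqP; rewrite -addr_eq0 addrC ?h1 ?h2.
Qed.

Let sba : 1 + b + a = 0. Proof. by rewrite -[RHS]sab; ring. Qed.
Let bb : b * b = a. Proof. by rewrite -{1}aa -mulrA ab mulr1. Qed.
Let ba : b * a = 1. Proof. by rewrite mulrC. Qed.

Lemma other12 p : p != r1 -> p != r2 -> W p c1 != 0 -> W p c2 != 0 -> W p c3 = 0 ->
  [/\ W p c2 = b * W p c1, W p c4 = a * W p c1 & W p c5 = b * W p c1].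
Proof.
move=> n1 n2 h1 h2 e3; case: (other n1 n2); rewrite e3 invr0 !mulr0 !addr0 => e1 e1' e2 e2' _.
have e : W p c2 = b * W p c1 by apply: pair_root e1 e1' e2 e2' => //; right.
split=> //.
  have -> : W p c4 = (W p c1 + W p c2 + W p c4) - (1 + b) * W p c1 by rewrite e; ring.
  by rewrite e1 bE; ring.
have -> : W p c5 = (W p c1 + b * W p c2 + W p c5) - (1 + b * b) * W p c1 by rewrite e; ring.
by rewrite e2 bb bE; ring.
Qed.

Lemma other13 p : p != r1 -> p != r2 -> W p c1 != 0 -> W p c3 != 0 -> W p c2 = 0 ->
  [/\ W p c3 = a * W p c1, W p c4 = b * W p c1 & W p c5 = a * W p c1].
Proof.
move=> n1 n2 h1 h2 e3; case: (other n1 n2); rewrite e3 invr0 !mulr0 !addr0 => e1 e1' e2 e2' _.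
have e : W p c3 = a * W p c1 by apply: pair_root e1 e1' e2 e2' => //; left.
split=> //.
  have -> : W p c4 = (W p c1 + W p c3 + W p c4) - (1 + a) * W p c1 by rewrite e; ring.
  by rewrite e1 bE; ring.
have -> : W p c5 = (W p c1 + a * W p c3 + W p c5) - (1 + a * a) * W p c1 by rewrite e; ring.
by rewrite e2 aa bE; ring.
Qed.

Lemma other23 p : p != r1 -> p != r2 -> W p c2 != 0 -> W p c3 != 0 -> W p c1 = 0 ->
  [/\ W p c3 = b * W p c2, W p c4 = a * W p c2 & W p c5 = a * W p c2].
Proof.
move=> n1 n2 h1 h2 e3; case: (other n1 n2); rewrite e3 invr0 !add0r => e1 e1' e2 e2' _.
(* Multiplying by [a] makes the coefficient of [W p c2] equal to 1, the shape required by
   [pair_root]; the reciprocal relation is multiplied by [b] accordingly. *)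
have e2a : W p c2 + b * W p c3 + a * W p c5 = 0.
  by rewrite -[RHS](mulr0 a) -e2 !mulrDr !mulrA ab mul1r aa.
have e2a' : (W p c2)^-1 + a * (W p c3)^-1 + (a * W p c5)^-1 = 0.
  by rewrite invfM aV -[RHS](mulr0 b) -e2' !mulrDr !mulrA ba mul1r bb.
have e : W p c3 = b * W p c2 by apply: pair_root e1 e1' e2a e2a' => //; right.
split=> //.
  have -> : W p c4 = (W p c2 + W p c3 + W p c4) - (1 + b) * W p c2 by rewrite e; ring.
  by rewrite e1 bE; ring.
have -> : W p c5 = (b * W p c2 + a * W p c3 + W p c5) - (b + a * b) * W p c2 by rewrite e; ring.
by rewrite e2 ab bE; ring.
Qed.

Lemma other123 p : p != r1 -> p != r2 -> W p c1 != 0 -> W p c2 != 0 -> W p c3 != 0 ->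
  [/\ W p c2 = b * W p c1, W p c3 = a * W p c1, W p c4 = 0 & W p c5 = 0].
Proof.
move=> n1 n2 h1 h2 h3; case: (other n1 n2) => e1 e1' e2 e2'.
rewrite (negPf h1) (negPf h2) (negPf h3) /= => h.
by apply: triple_root e1 e1' e2 e2' _ => //; case/orP: h => /eqP; [left|right].
Qed.

Let touch p := [|| W p c1 != 0, W p c2 != 0 | W p c3 != 0] &&
  ~~ [&& W p c1 != 0, W p c2 != 0 & W p c3 != 0].

(** Read off from the eight cases above. Column [c4] contains [r1] but not [r2], so its three
    further rows are exactly the rows besides [r1], [r2] that meet some but not all of [c1], [c2],
    [c3]; the counting arguments below rest on this. *)
Lemma touch4 p : p != r1 -> p != r2 -> (W p c4 != 0) = touch p /\ (W p c5 != 0) = touch p.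
Proof.
move=> n1 n2; rewrite /touch.
have [e1|h1] := eqVneq (W p c1) 0; have [e2|h2] := eqVneq (W p c2) 0;
  have [e3|h3] := eqVneq (W p c3) 0 => /=.
- have [-> ->] := other1 n1 n2 e2 e3; by rewrite e1 oppr0 eqxx.
- have [-> ->] := other3 n1 n2 e1 e2; by rewrite !oppr_eq0 mulf_eq0 (negPf a_neq0) h3.
- have [-> ->] := other2 n1 n2 e1 e3; by rewrite !oppr_eq0 mulf_eq0 (negPf b_neq0) h2.
- have [_ -> ->] := other23 n1 n2 h2 h3 e1; by rewrite !mulf_eq0 (negPf a_neq0) h2.
- have [-> ->] := other1 n1 n2 e2 e3; by rewrite !oppr_eq0 h1.
- have [_ -> ->] := other13 n1 n2 h1 h3 e2; by rewrite !mulf_eq0 (negPf a_neq0) (negPf b_neq0) h1.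
- have [_ -> ->] := other12 n1 n2 h1 h2 e3; by rewrite !mulf_eq0 (negPf a_neq0) (negPf b_neq0) h1.
- have [_ _ -> ->] := other123 n1 n2 h1 h2 h3; by rewrite eqxx.
Qed.

(** With [r1], [r2], [p] in each of [c1], [c2], [c3], these columns have one free place each, and
    the three further rows through [c4] have to fill them. *)
Lemma embeds_W6 p : p != r1 -> p != r2 -> W p c1 != 0 -> W p c2 != 0 -> W p c3 != 0 ->
  embeds W 6 (entry W6_of).
Proof.
move=> np1 np2 p1 p2 p3.
have [e2 e3 e4 e5] := other123 np1 np2 p1 p2 p3.
have z1 : W r1 c1 != 0 by rewrite v11 oner_eq0.
have z2 : W r1 c2 != 0 by rewrite v12 oner_eq0.
have z3 : W r1 c3 != 0 by rewrite v13 oner_eq0.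
have y1 : W r2 c1 != 0 by rewrite v21 oner_eq0.
have y2 : W r2 c2 != 0 by rewrite v22 a_neq0.
have y3 : W r2 c3 != 0 by rewrite v23 b_neq0.
have u3 : uniq [:: r1; r2; p] by rewrite /= !inE !negb_or n12 !(eq_sym _ p) np1 np2.
have [t1 k1] := supp3 hWt u3 z1 y1 p1.
have [t2 k2] := supp3 hWt u3 z2 y2 p2.
have [t3 k3] := supp3 hWt u3 z3 y3 p3.
have z4 : W r1 c4 != 0 by rewrite v14 oner_eq0.
have [q1 [q2 [q3 k4]]] := supp1 hWt z4.
have inq q : q \in [:: q1; q2; q3] -> [/\ W q c4 != 0, q != r1, q != r2 & q != p].
  move=> hq; have : W q c4 != 0 by case: k4 => _ /= ->; rewrite inE hq orbT.
  move=> h; split=> //.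
  - case: k4 => /= /andP[+ _] _; apply: contra => /eqP <-; exact: hq.
  - by apply: contra_neq h => ->.
  - by apply: contra_neq h => ->.
(* A further row through [c4] meets one of [c1], [c2], [c3] and is therefore the fourth row of that
   column. *)
have sub : {subset [:: q1; q2; q3] <= [:: t1; t2; t3]}.
  move=> q /inq[h n1 n2 n3]; have [+ _] := touch4 n1 n2; rewrite h /touch => /esym/andP[+ _].
  case: k1 k2 k3 => _ /= -> [_ /= ->] [_ /= ->]; rewrite !inE (negPf n1) (negPf n2) (negPf n3) /=.
  by case/or3P=> ->; rewrite ?orbT.
have uq : uniq [:: q1; q2; q3] by case: k4 => /= /andP[].
(* Three distinct rows inside a list of three: the lists agree, so [t1], [t2], [t3] are distinct and
   each meets just one of the shared columns. *)
have [ut emq] := uniq_min_size uq sub (leqnn 3).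
have utt : uniq [:: t1; t2; t3] by rewrite (leq_size_uniq uq sub (leqnn 3)).
have [t14 nt1 mt1 lt1] : [/\ W t1 c4 != 0, t1 != r1, t1 != r2 & t1 != p] by apply: inq; rewrite emq !inE eqxx.
have [t24 nt2 mt2 lt2] : [/\ W t2 c4 != 0, t2 != r1, t2 != r2 & t2 != p] by apply: inq; rewrite emq !inE eqxx ?orbT.
have [t34 nt3 mt3 lt3] : [/\ W t3 c4 != 0, t3 != r1, t3 != r2 & t3 != p] by apply: inq; rewrite emq !inE eqxx ?orbT.
move: (utt); rewrite /= !inE !negb_or => /and3P[/andP[t12 t13] t23 _].
have x11 : W t1 c1 != 0 by apply: (supp_neq0 k1); rewrite !inE eqxx ?orbT.
have x22 : W t2 c2 != 0 by apply: (supp_neq0 k2); rewrite !inE eqxx ?orbT.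
have x33 : W t3 c3 != 0 by apply: (supp_neq0 k3); rewrite !inE eqxx ?orbT.
have x12 : W t1 c2 = 0 by apply: (supp_eq0 k2); rewrite !inE !negb_or nt1 mt1 lt1.
have x13 : W t1 c3 = 0 by apply: (supp_eq0 k3); rewrite !inE !negb_or nt1 mt1 lt1.
have x21 : W t2 c1 = 0 by apply: (supp_eq0 k1); rewrite !inE !negb_or nt2 mt2 lt2 eq_sym.
have x23 : W t2 c3 = 0 by apply: (supp_eq0 k3); rewrite !inE !negb_or nt2 mt2 lt2.
have x31 : W t3 c1 = 0 by apply: (supp_eq0 k1); rewrite !inE !negb_or nt3 mt3 lt3 eq_sym.
have x32 : W t3 c2 = 0 by apply: (supp_eq0 k2); rewrite !inE !negb_or nt3 mt3 lt3 eq_sym.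
have [x14 x15] := other1 nt1 mt1 x12 x13.
have [x24 x25] := other2 nt2 mt2 x21 x23.
have [x34 x35] := other3 nt3 mt3 x31 x32.
(* The sixth column is the fourth column of [p]; the entries of [t1], [t2], [t3] there follow from
   orthogonality with [p]. *)
have uc : uniq [:: c1; c2; c3] by case: s1 => /=; rewrite !inE !negb_or => /and4P[/and3P[-> ->] _ /andP[->]].
have [c6 sp] := supp3 hW uc p1 p2 p3.
have p6 : W p c6 != 0 by apply: (supp_neq0 sp); rewrite !inE eqxx ?orbT.
have n61 : c6 \notin [:: c1; c2; c3].
  by case: sp; rewrite (cat_uniq [:: c1; c2; c3] [:: c6]) /= orbF => /and3P[_ ->].
have n64 : c6 != c4 by apply: contra_neq p6 => ->.
have n65 : c6 != c5 by apply: contra_neq p6 => ->.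
have u6 : uniq [:: c1; c2; c3; c4; c5; c6].
  rewrite -[[:: _; _; _; _; _; _]]/([:: c1; c2; c3; c4; c5] ++ [:: c6]) cat_uniq u5 /= orbF andbT.
  by move: n61; rewrite !inE !negb_or n64 n65 => /and3P[-> -> ->].
have w16 : W r1 c6 = 0.
  by apply: (supp_eq0 s1); move: n61; rewrite !inE !negb_or n64 => /and3P[-> -> ->].
have w26 : W r2 c6 = 0.
  by apply: (supp_eq0 s2); move: n61; rewrite !inE !negb_or n65 => /and3P[-> -> ->].
have q6 t x y : W t c1 / W p c1 + W t c2 / W p c2 + W t c3 / W p c3 + W t c6 / W p c6 = 0 ->
  W t c1 / W p c1 + W t c2 / W p c2 + W t c3 / W p c3 = x / y -> W t c6 = - x * (W p c6 / y).
  move=> e e'; rewrite e' in e; move/eqP: e; rewrite addrC addr_eq0 => /eqP e.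
  by rewrite -[LHS](divfK p6) e; ring.
have x16 : W t1 c6 = - W t1 c1 * (W p c6 / W p c1).
  apply: q6; first by apply: row_eq => //; rewrite eq_sym.
  by rewrite x12 x13 !mul0r !addr0.
have x26 : W t2 c6 = - (a * W t2 c2) * (W p c6 / W p c1).
  apply: q6; first by apply: row_eq => //; rewrite eq_sym.
  by rewrite x21 x23 !mul0r add0r addr0 e2 invfM bV; ring.
have x36 : W t3 c6 = - (b * W t3 c3) * (W p c6 / W p c1).
  apply: q6; first by apply: row_eq => //; rewrite eq_sym.
  by rewrite x31 x32 !mul0r !add0r e3 invfM aV; ring.
have p6E : W p c6 = W p c1 * (W p c6 / W p c1) by rewrite mulrC divfK.
have g6 : W t1 c6 != 0 by rewrite x16 mulf_neq0 ?oppr_eq0 // mulf_neq0 ?invr_eq0.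
have g26 : W t2 c6 != 0.
  by rewrite x26 mulf_neq0 ?oppr_eq0 ?mulf_eq0 ?(negPf a_neq0) // invr_eq0 negb_or p6.
have g36 : W t3 c6 != 0.
  by rewrite x36 mulf_neq0 ?oppr_eq0 ?mulf_eq0 ?(negPf b_neq0) // invr_eq0 negb_or p6.
have g15 : W t1 c5 != 0 by rewrite x15 oppr_eq0.
have g25 : W t2 c5 != 0 by rewrite x25 oppr_eq0 mulf_neq0 ?b_neq0.
have g35 : W t3 c5 != 0 by rewrite x35 oppr_eq0 mulf_neq0 ?a_neq0.
have sub4 i : i \in [:: c1; c2; c3] -> uniq [:: i; c4; c5; c6].
  move: u6; rewrite /= !inE !negb_or.
  case/and5P=> /and5P[_ _ h1 h2 h3] /and4P[_ h4 h5 h6] /and3P[h7 h8 h9] -> /andP[-> _].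
  by case/or3P=> /eqP->; rewrite ?h1 ?h2 ?h3 ?h4 ?h5 ?h6 ?h7 ?h8 ?h9.
have st1 : supp (W t1) [:: c1; c4; c5; c6] by apply: supp4 => //; apply: sub4; rewrite !inE eqxx.
have st2 : supp (W t2) [:: c2; c4; c5; c6] by apply: supp4 => //; apply: sub4; rewrite !inE eqxx ?orbT.
have st3 : supp (W t3) [:: c3; c4; c5; c6] by apply: supp4 => //; apply: sub4; rewrite !inE eqxx ?orbT.
apply: (@embeds_seq _ _ _ _ r1 c1 [:: r1; r2; p; t1; t2; t3] [:: c1; c2; c3; c4; c5; c6]
  [:: 1; 1; W p c1; W t1 c1; W t2 c2; W t3 c3] [:: 1; 1; 1; 1; 1; W p c6 / W p c1]) => //=.
- by rewrite !inE !negb_or n12 ?t12 ?t13 ?t23 !(eq_sym r1) !(eq_sym r2) np1 np2 nt1 mt1 nt2 nt3 mt2 mt3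
    !(eq_sym p) lt1 lt2 lt3.
- by rewrite !normr1 eqxx !(weighing_norm hW) ?eqxx.
- by rewrite !normr1 eqxx normrM normfV !(weighing_norm hW) ?divr1 ?eqxx.
- move=> r c; rewrite !inE => /or4P[||/eqP->|/or3P[]] => [/eqP->|/eqP->||/eqP->|/eqP->|/eqP->].
  + by case: s1 => _ ->; rewrite !inE => /or4P[]->; rewrite ?orbT.
  + by case: s2 => _ ->; rewrite !inE => /or4P[]->; rewrite ?orbT.
  + by case: sp => _ ->; rewrite !inE => /or4P[]->; rewrite ?orbT.
  + by case: st1 => _ ->; rewrite !inE => /or4P[]->; rewrite ?orbT.
  + by case: st2 => _ ->; rewrite !inE => /or4P[]->; rewrite ?orbT.
  + by case: st3 => _ ->; rewrite !inE => /or4P[]->; rewrite ?orbT.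
- have vs := (v11, v12, v13, v14, v15, w16, (v21, v22, v23, v24, v25, w26), (e2, e3, e4, e5),
    (x12, x13, x14, x15, x16), (x21, x23, x24, x25, x26), (x31, x32, x34, x35, x36)).
  case=> [|[|[|[|[|[|//]]]]]] [|[|[|[|[|[|//]]]]]] _ _;
    rewrite /entry /= ?vs ?mulr0 ?mulr1 ?mul1r //; try ring.
Qed.

(** Each of the three rows misses a different shared column, so [other12], [other13] and [other23]
    give all entries; five columns already exhaust the supports. *)
Lemma embeds_W5_rows q1 q2 q3 : uniq [:: r1; r2; q1; q2; q3] ->
  W q1 c3 = 0 -> W q2 c2 = 0 -> W q3 c1 = 0 ->
  W q1 c1 != 0 -> W q1 c2 != 0 -> W q2 c1 != 0 -> W q2 c3 != 0 ->
  W q3 c2 != 0 -> W q3 c3 != 0 -> embeds W 5 (entry W5_of).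
Proof.
move=> uq x13 x22 x31 x11 x12 x21 x23 x32 x33.
have nm : [/\ q1 != r1, q2 != r1 & q3 != r1] /\ [/\ q1 != r2, q2 != r2 & q3 != r2].
  move: uq; rewrite /= !inE !negb_or !(eq_sym r1) !(eq_sym r2).
  by move=> /and5P[/and4P[_ -> -> ->] /and3P[-> -> ->] _ _ _].
case: nm => -[n1 n2 n3] [m1 m2 m3].
have [y12 y14 y15] := other12 n1 m1 x11 x12 x13.
have [y23 y24 y25] := other13 n2 m2 x21 x23 x22.
have [y33 y34 y35] := other23 n3 m3 x32 x33 x31.
have a0 := a_neq0; have b0 := b_neq0.
have st1 : supp (W q1) [:: c1; c2; c4; c5].
  apply: supp4; rewrite ?y14 ?y15 ?mulf_neq0 //; move: u5; rewrite /= !inE !negb_or.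
  by move=> /and5P[/and4P[-> _ -> ->] /and3P[_ -> ->] _ -> _].
have st2 : supp (W q2) [:: c1; c3; c4; c5].
  apply: supp4; rewrite ?y24 ?y25 ?mulf_neq0 //; move: u5; rewrite /= !inE !negb_or.
  by move=> /and5P[/and4P[_ -> -> ->] _ /andP[-> ->] -> _].
have st3 : supp (W q3) [:: c2; c3; c4; c5].
  apply: supp4; rewrite ?y34 ?y35 ?mulf_neq0 //; move: u5; rewrite /= !inE !negb_or.
  by move=> /and5P[_ /and3P[-> -> ->] /andP[-> ->] -> _].
apply: (@embeds_seq _ _ _ _ r1 c1 [:: r1; r2; q1; q2; q3] [:: c1; c2; c3; c4; c5]
  [:: 1; 1; W q1 c1; W q2 c1; W q3 c2] [:: 1; 1; 1; 1; 1]) => //=.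
- by rewrite !normr1 eqxx !(weighing_norm hW) ?eqxx.
- by rewrite !normr1 eqxx.
- move=> r c; rewrite !inE => /or4P[/eqP->|/eqP->|/eqP->|/orP[]/eqP->].
  + by case: s1 => _ ->; rewrite !inE => /or4P[]->; rewrite ?orbT.
  + by case: s2 => _ ->; rewrite !inE => /or4P[]->; rewrite ?orbT.
  + by case: st1 => _ ->; rewrite !inE => /or4P[]->; rewrite ?orbT.
  + by case: st2 => _ ->; rewrite !inE => /or4P[]->; rewrite ?orbT.
  + by case: st3 => _ ->; rewrite !inE => /or4P[]->; rewrite ?orbT.
- have vs := (v11, v12, v13, v14, v15, (v21, v22, v23, v24, v25), (y12, y14, y15, x13),
    (x22, y23, y24, y25), (x31, y33, y34, y35)).
  by case=> [|[|[|[|[|//]]]]] [|[|[|[|[|//]]]]] _ _;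
    rewrite /entry /= ?vs ?mulr0 ?mulr1 ?mul1r //; ring.
Qed.

Lemma overlap3_normalized : embeds W 5 (entry W5_of) \/ embeds W 6 (entry W6_of).
Proof.
have [/existsP[p /and5P[p1 p2 p3 p4 p5]]|/existsPn h] := boolP [exists p,
  [&& p != r1, p != r2, W p c1 != 0, W p c2 != 0 & W p c3 != 0]].
  by right; apply: (embeds_W6 p1 p2 p3 p4 p5).
left.
have z4 : W r1 c4 != 0 by rewrite v14 oner_eq0.
have [q1 [q2 [q3 k4]]] := supp1 hWt z4.
have inq q : q \in [:: q1; q2; q3] -> [/\ W q c4 != 0, q != r1 & q != r2].
  move=> hq; have : W q c4 != 0 by case: k4 => _ /= ->; rewrite inE hq orbT.
  move=> h4; split=> //.
  - case: k4 => /= /andP[+ _] _; apply: contra => /eqP <-; exact: hq.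
  - by apply: contra_neq h4 => ->.
have toq p : p != r1 -> p != r2 -> [|| W p c1 != 0, W p c2 != 0 | W p c3 != 0] ->
    p \in [:: q1; q2; q3].
  move=> n1 n2 hp; have [+ _] := touch4 n1 n2; rewrite /touch hp.
  have := h p; rewrite n1 n2 /= => -> /=.
  by case: k4 => _ /= ->; rewrite inE (negPf n1).
have uq : uniq [:: q1; q2; q3] by case: k4 => /= /andP[].
(* Besides [r1] and [r2] a shared column holds two more rows. As no row covers all three shared
   columns, [touch4] puts both of them on [c4], hence among [q1], [q2], [q3]. *)
have col c : W r1 c != 0 -> W r2 c != 0 -> c \in [:: c1; c2; c3] ->
  ((W q1 c != 0%R) + (W q2 c != 0%R) + (W q3 c != 0%R) = 2)%N.
  move=> h1 h2 hc; have [t [t' k]] := supp2 hWt n12 h1 h2.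
  have ht x : x \in [:: t; t'] -> x \in [:: q1; q2; q3].
    move=> hx; have [n1 n2] : x != r1 /\ x != r2.
      case: (k) => /= /and3P[+ + _] _; rewrite inE negb_or => /andP[_ g1] g2.
      by split; [apply: contraNneq g1 => <- | apply: contraNneq g2 => <-].
    apply: toq => //; move: hc; have : W x c != 0 by case: k => _ /= ->; rewrite !inE in hx *; rewrite hx !orbT.
    by move=> hxc; rewrite !inE => /or3P[]/eqP <-; rewrite hxc ?orbT.
  have tt : t != t' by case: (k) => /=; rewrite !inE => /and4P[].
  have e x : x \in [:: q1; q2; q3] -> (W x c != 0) = (x \in [:: t; t']).
    by move/inq => [_ g1 g2]; case: k => _ /= ->; rewrite !inE (negPf g1) (negPf g2).
  have e1 := e q1 (mem_head _ _).
  have e2 : (W q2 c != 0) = (q2 \in [:: t; t']) by apply: e; rewrite !inE eqxx orbT.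
  have e3 : (W q3 c != 0) = (q3 \in [:: t; t']) by apply: e; rewrite !inE eqxx !orbT.
  rewrite e1 e2 e3; apply: (two_of_three uq tt); apply: ht; by rewrite !inE eqxx ?orbT.
have z1 : W r1 c1 != 0 by rewrite v11 oner_eq0.
have z2 : W r1 c2 != 0 by rewrite v12 oner_eq0.
have z3 : W r1 c3 != 0 by rewrite v13 oner_eq0.
have y1 : W r2 c1 != 0 by rewrite v21 oner_eq0.
have y2 : W r2 c2 != 0 by rewrite v22 a_neq0.
have y3 : W r2 c3 != 0 by rewrite v23 b_neq0.
have C1 := col c1 z1 y1 (mem_head _ _).
have C2 : _ := col c2 z2 y2 _; rewrite !inE eqxx ?orbT in C2; have {}C2 := C2 isT.
have C3 : _ := col c3 z3 y3 _; rewrite !inE eqxx ?orbT in C3; have {}C3 := C3 isT.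
have [_ n1 m1] : [/\ W q1 c4 != 0, q1 != r1 & q1 != r2] by apply: inq; rewrite !inE eqxx.
have [_ n2 m2] : [/\ W q2 c4 != 0, q2 != r1 & q2 != r2] by apply: inq; rewrite !inE eqxx ?orbT.
have [_ n3 m3] : [/\ W q3 c4 != 0, q3 != r1 & q3 != r2] by apply: inq; rewrite !inE eqxx ?orbT.
have H1 := h q1; have H2 := h q2; have H3 := h q3.
rewrite n1 m1 /= in H1; rewrite n2 m2 /= in H2; rewrite n3 m3 /= in H3.
have U : forall s, perm_eq s [:: q1; q2; q3] -> uniq [:: r1, r2 & s].
  move=> s ps; rewrite /= (perm_uniq ps) uq !inE !(perm_mem ps) !inE !negb_or n12 !(eq_sym r1) !(eq_sym r2).
  by rewrite n1 n2 n3 m1 m2 m3.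
have P : forall x y z, perm_eq [:: x; y; z] [:: q1; q2; q3] ->
   W x c3 = 0 -> W y c2 = 0 -> W z c1 = 0 ->
  W x c1 != 0 -> W x c2 != 0 -> W y c1 != 0 -> W y c3 != 0 ->
  W z c2 != 0 -> W z c3 != 0 -> embeds W 5 (entry W5_of).
  by move=> x y z /U; exact: embeds_W5_rows.
(* The 3 x 3 array of [q1], [q2], [q3] against [c1], [c2], [c3] has one zero in each column and at
   least one in each row, so its zeros form a permutation; the six cases differ only in the naming
   of the rows. *)
case: (eqVneq (W q1 c1) 0) C1 H1 => [e11|g11];
case: (eqVneq (W q2 c1) 0) H2 => [e21|g21] //=;
case: (eqVneq (W q3 c1) 0) H3 => [e31|g31] //=;
case: (eqVneq (W q1 c2) 0) C2 => [e12|g12] //=;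
case: (eqVneq (W q2 c2) 0) => [e22|g22] //=;
case: (eqVneq (W q3 c2) 0) => [e32|g32] //=;
case: (eqVneq (W q1 c3) 0) C3 => [e13|g13] //=;
case: (eqVneq (W q2 c3) 0) => [e23|g23] //=;
case: (eqVneq (W q3 c3) 0) => [e33|g33] //= *.
all: solve [ apply: (P q1 q2 q3) => //; apply/permP => f /=; ring
  | apply: (P q1 q3 q2) => //; apply/permP => f /=; ring
  | apply: (P q2 q1 q3) => //; apply/permP => f /=; ring
  | apply: (P q2 q3 q1) => //; apply/permP => f /=; ring
  | apply: (P q3 q1 q2) => //; apply/permP => f /=; ring
  | apply: (P q3 q2 q1) => //; apply/permP => f /=; ring ].
Qed.

End OverlapThree.

Lemma overlap3_rows (S T : finType) (W : S -> T -> C) r1 r2 c1 c2 c3 c4 :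
  weighing W -> r1 != r2 -> supp (W r1) [:: c1; c2; c3; c4] ->
  W r2 c1 != 0 -> W r2 c2 != 0 -> W r2 c3 != 0 -> W r2 c4 = 0 ->
  embeds W 5 (entry W5_of) \/ embeds W 6 (entry W6_of).
Proof.
move=> hW n12 s1 h1 h2 h3 h4.
have uc : uniq [:: c1; c2; c3].
  by case: s1 => /=; rewrite !inE !negb_or => /and4P[/and3P[-> -> _] /andP[-> _] _ _].
have [c5 s2] := supp3 hW uc h1 h2 h3.
have h5 : W r2 c5 != 0 by apply: (supp_neq0 s2); rewrite !inE eqxx !orbT.
have g c : c \in [:: c1; c2; c3; c4] -> W r1 c != 0 by apply: supp_neq0.
have [g1 g2 g3 g4] : [/\ W r1 c1 != 0, W r1 c2 != 0, W r1 c3 != 0 & W r1 c4 != 0].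
  by split; apply: g; rewrite !inE eqxx ?orbT.
(* The columns of [r1] are scaled to turn [r1] into ones, [al2] then makes the entry of [r2] at [c1]
   equal to 1, and [c5], not being a column of [r1], is still free to normalise the last entry of
   [r2]. *)
pose al2 := W r1 c1 / W r2 c1.
have n2 : `|al2| = 1 by rewrite normrM normfV !(weighing_norm hW) ?divr1.
have al20 : al2 != 0 by rewrite -normr_eq0 n2 oner_eq0.
pose al r := if r == r2 then al2 else 1.
pose be c := if c \in [:: c1; c2; c3; c4] then (W r1 c)^-1
             else if c == c5 then (al2 * W r2 c5)^-1 else 1.
have ha r : `|al r| = 1 by rewrite /al; case: ifP; rewrite ?normr1.
have hb c : `|be c| = 1.
  rewrite /be; case: ifP => [/g h|_]; first by rewrite normfV (weighing_norm hW) ?invr1.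
  by case: ifP; rewrite ?normr1 // normfV normrM n2 (weighing_norm hW) // mulr1 invr1.
have na r : al r != 0 by rewrite -normr_eq0 ha oner_eq0.
have nb c : be c != 0 by rewrite -normr_eq0 hb oner_eq0.
have hW1 := weighing_scale ha hb hW.
suff : embeds (fun r c => al r * be c * W r c) 5 (entry W5_of) \/
       embeds (fun r c => al r * be c * W r c) 6 (entry W6_of).
  by case=> /(embeds_scale ha hb); [left|right].
move: hW1; set W1 := (fun r c => _) => hW1.
have z r c : (W1 r c != 0) = (W r c != 0) by rewrite /W1 !mulf_eq0 (negPf (na r)) (negPf (nb c)).
have s1' : supp (W1 r1) [:: c1; c2; c3; c4] by case: s1 => u h; split=> // c; rewrite z.
have s2' : supp (W1 r2) [:: c1; c2; c3; c5] by case: s2 => u h; split=> // c; rewrite z.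
have v1 c : c \in [:: c1; c2; c3; c4] -> W1 r1 c = 1.
  by move=> hc; rewrite /W1 /al (negPf n12) mul1r /be hc mulVf ?g.
have [v11 v12 v13 v14] : [/\ W1 r1 c1 = 1, W1 r1 c2 = 1, W1 r1 c3 = 1 & W1 r1 c4 = 1].
  by split; apply: v1; rewrite !inE eqxx ?orbT.
have v21 : W1 r2 c1 = 1.
  by rewrite /W1 /al /be eqxx !inE eqxx /= /al2; field; rewrite g1 h1.
have v24 : W1 r2 c4 = 0 by rewrite /W1 h4 mulr0.
have c54 : c5 != c4 by apply: contra_neq h5 => ->.
have v25 : W1 r2 c5 = 1.
  have c5n : c5 \notin [:: c1; c2; c3; c4].
    case: s2; rewrite -[[:: c1; c2; c3; c5]]/([:: c1; c2; c3] ++ [:: c5]) cat_uniq /= orbF.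
    by rewrite !inE !negb_or c54 => /and3P[_ /and3P[-> -> ->]].
  by rewrite /W1 /al /be eqxx (negPf c5n) eqxx; field; rewrite h5 al20.
have e := row_eq hW1 s1' n12; have e' := row_eqV hW1 s1' n12.
rewrite v11 v12 v13 v14 v21 v24 !divr1 !addr0 in e.
rewrite v11 v12 v13 v14 v21 v24 invr0 mulr0 addr0 !mul1r in e'.
have i1 : 1 != 0 :> C by rewrite oner_eq0.
have i2 : W1 r2 c2 != 0 by rewrite z.
have i3 : W1 r2 c3 != 0 by rewrite z.
have e3 : W1 r2 c3 = - (1 + W1 r2 c2) by apply/eqP; rewrite -addr_eq0 addrC e.
(* If the second entry of [r2] is [b] rather than [a], exchanging [c2] and [c3] restores the normal
   form. *)
case: (sum3_roots i1 i2 i3 e e'); rewrite mulr1 => v22.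
  by apply: (overlap3_normalized hW1 n12 s1' s2' v11 v12 v13 v14 v21 v22 _ v24 v25); rewrite e3 v22 bE; ring.
have s1'' : supp (W1 r1) [:: c1; c3; c2; c4].
  by apply: supp_perm s1'; rewrite perm_cons (perm_catCA [:: c2] [:: c3] [:: c4]).
have s2'' : supp (W1 r2) [:: c1; c3; c2; c5].
  by apply: supp_perm s2'; rewrite perm_cons (perm_catCA [:: c2] [:: c3] [:: c5]).
by apply: (overlap3_normalized hW1 n12 s1'' s2'' v11 v13 v12 v14 v21 _ v22 v24 v25); rewrite e3 v22 bE; ring.
Qed.

End CubeRoots.

(** * Even meets without twin columns *)

Section Even.
Variable C : numClosedFieldType.

Definition even_meet (S T : finType) (W : S -> T -> C) : Prop :=
  forall r r' c1 c2 c3 c4, r != r' -> supp (W r) [:: c1; c2; c3; c4] ->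
  (W r' c1 != 0) (+) (W r' c2 != 0) (+) (W r' c3 != 0) (+) (W r' c4 != 0) = false.

(** A meet in one column is excluded because a single nonzero quotient cannot add up to 0, so a meet
    of odd size has size three. *)
Lemma overlap3_or_even (a b : C) (S T : finType) (W : S -> T -> C) :
  a * b = 1 -> 1 + a + b = 0 -> weighing W ->
  (embeds W 5 (entry (W5_of a b)) \/ embeds W 6 (entry (W6_of a b))) \/ even_meet W.
Proof.
move=> ab sab hW.
have [/existsP[r1 /existsP[r2 /existsP[c1 /existsP[c2 /existsP[c3 /existsP[c4]]]]]]|h] := boolP
  [exists r1, exists r2, exists c1, exists c2, exists c3, exists c4,
   [&& r1 != r2, uniq [:: c1; c2; c3; c4], W r1 c1 != 0, W r1 c2 != 0 & W r1 c3 != 0] &&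
   [&& W r1 c4 != 0, W r2 c1 != 0, W r2 c2 != 0, W r2 c3 != 0 & W r2 c4 == 0]].
  move=> /andP[/and5P[n u h1 h2 h3] /and5P[h4 g1 g2 g3 /eqP g4]]; left.
  exact: (overlap3_rows ab sab hW n (supp4 hW u h1 h2 h3 h4)).
right; have no3 r r' c1 c2 c3 c4 : r != r' -> supp (W r) [:: c1; c2; c3; c4] ->
    W r' c1 != 0 -> W r' c2 != 0 -> W r' c3 != 0 -> W r' c4 = 0 -> False.
  move=> n s g1 g2 g3 g4; move: h => /existsPn/(_ r)/existsPn/(_ r')/existsPn/(_ c1)
    /existsPn/(_ c2)/existsPn/(_ c3)/existsPn/(_ c4)/negP; apply.
  by case: s => u hs; rewrite n u !hs g1 g2 g3 g4 !inE !eqxx ?orbT.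
move=> r r' c1 c2 c3 c4 n s.
(* The four rotations of the support bring any of its columns to the distinguished first or last
   place. *)
have rot c c' c'' d : supp (W r) [:: c; c'; c''; d] -> supp (W r) [:: c'; c''; d; c].
  by apply: supp_perm; rewrite perm_sym -[[:: c'; c''; d; c]]/(rcons [:: c'; c''; d] c) perm_rcons.
have s' := rot _ _ _ _ s; have s'' := rot _ _ _ _ s'; have s3 := rot _ _ _ _ s''.
have := row_meet hW s n; have := row_meet hW s' n; have := row_meet hW s'' n; have := row_meet hW s3 n.
have := no3 _ _ _ _ _ _ n s; have := no3 _ _ _ _ _ _ n s'; have := no3 _ _ _ _ _ _ n s''.
have := no3 _ _ _ _ _ _ n s3.
case: (eqVneq (W r' c1) 0) => h1; case: (eqVneq (W r' c2) 0) => h2;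
case: (eqVneq (W r' c3) 0) => h3; case: (eqVneq (W r' c4) 0) => h4 //= t1 t2 t3 t4 g1 g2 g3 g4;
  by exfalso; by [apply: t1 | apply: t2 | apply: t3 | apply: t4 | have := g1 isT | have := g2 isT
    | have := g3 isT | have := g4 isT].
Qed.

Definition meet2 (S T : finType) (W : S -> T -> C) : Prop :=
  forall r r' c, r != r' -> W r c != 0 -> W r' c != 0 ->
  exists c', [/\ c' != c, W r c' != 0, W r' c' != 0 &
    forall x, W r x != 0 -> W r' x != 0 -> x = c \/ x = c'].

Lemma even_meet_dec (S T : finType) (W : S -> T -> C) r r' c :
  weighing W -> even_meet W -> r != r' -> W r c != 0 -> W r' c != 0 ->
  (exists c', [/\ c' != c, W r c' != 0, W r' c' != 0 &
    forall x, W r x != 0 -> W r' x != 0 -> x = c \/ x = c']) \/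
  (forall x, W r x != 0 -> W r' x != 0).
Proof.
move=> hW hE n h1 h2; have [c2 [c3 [c4 s]]] := supp1 hW h1.
have := hE _ _ _ _ _ _ n s; rewrite h2 /=.
case: (s) => u hs; have hin x : x \in [:: c; c2; c3; c4] -> W r x != 0 by rewrite -hs.
move: (u); rewrite /= !inE !negb_or => /and4P[/and3P[n12 n13 n14] _ _ _].
have := row_meet hW s n h2.
have [e2|g2] := eqVneq (W r' c2) 0; have [e3|g3] := eqVneq (W r' c3) 0;
  have [e4|g4] := eqVneq (W r' c4) 0 => //= _ _.
- left; exists c4; rewrite eq_sym n14 hin ?inE ?eqxx ?orbT //; split=> // x.
  rewrite hs !inE => /or4P[]/eqP->; rewrite ?e2 ?e3 ?eqxx //; by [left|right].
- left; exists c3; rewrite eq_sym n13 hin ?inE ?eqxx ?orbT //; split=> // x.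
  rewrite hs !inE => /or4P[]/eqP->; rewrite ?e2 ?e4 ?eqxx //; by [left|right].
- left; exists c2; rewrite eq_sym n12 hin ?inE ?eqxx ?orbT //; split=> // x.
  rewrite hs !inE => /or4P[]/eqP->; rewrite ?e3 ?e4 ?eqxx //; by [left|right].
- by right=> x; rewrite hs !inE => /or4P[]/eqP->.
Qed.

(** For columns a full meet would be a pair of twins. If rows [r], [r'] had equal support, a third
    row [q] through [c] would share a second column with [r], and these two columns would have the
    three rows [r], [r'], [q] in common. *)
Lemma no_twins_meet2 (S T : finType) (W : S -> T -> C) :
  weighing W -> even_meet W -> even_meet (fun c r => W r c) ->
  (forall c c', c != c' -> ~ (forall r, W r c != 0 -> W r c' != 0)) ->
  meet2 W /\ meet2 (fun c r => W r c).
Proof.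
move=> hW hE hEt nt; have hWt := weighing_tr hW.
have mt : meet2 (fun c r => W r c).
  move=> c c' r n h h'; have [//|] := even_meet_dec hWt hEt n h h'.
  by move/(nt _ _ n).
split=> // r r' c n h h'; have [//|tw] := even_meet_dec hW hE n h h'; exfalso.
have [q [q' s]] := supp2 hWt n h h'.
have hq : W q c != 0 by apply: (supp_neq0 s); rewrite !inE eqxx ?orbT.
have [nq nq'] : q != r /\ q != r'.
  by case: s => /=; rewrite !inE !negb_or !(eq_sym _ q) => /and4P[/and3P[_ -> _] /andP[-> _] _ _].
have [c2 [n2 hr2 hq2]] : exists c2, [/\ c2 != c, W r c2 != 0 & W q c2 != 0].
  rewrite eq_sym in nq; have [[c2 [? ? ? _]]|hh] := even_meet_dec hW hE nq h hq; first by exists c2.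
  have [c2 [c3 [c4 s']]] := supp1 hW h.
  have hc2 : W r c2 != 0 by apply: (supp_neq0 s'); rewrite !inE eqxx orbT.
  exists c2; rewrite ?hh //; case: s' => /=.
  by rewrite !inE !negb_or (eq_sym c2 c) => /and4P[/and3P[-> _ _] _ _ _].
rewrite eq_sym in n2; have [x [_ _ _ hx]] := mt _ _ _ n2 h hr2.
have [e|e] := hx r' h' (tw _ hr2); first by rewrite e eqxx in n.
have [e'|e'] := hx q hq hq2; first by rewrite e' eqxx in nq.
by rewrite e' e eqxx in nq'.
Qed.

Lemma meet2_only (S T : finType) (W : S -> T -> C) r r' c c' x : meet2 W -> r != r' -> c != c' ->
  W r c != 0 -> W r' c != 0 -> W r c' != 0 -> W r' c' != 0 ->
  W r x != 0 -> x != c -> x != c' -> W r' x = 0.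
Proof.
move=> hM n nc h1 h2 h3 h4 hx n1 n2; apply/eqP; apply: contraT => hx'.
have [y [_ _ _ hy]] := hM _ _ _ n h1 h2.
have [e|e] := hy _ h3 h4; first by rewrite e eqxx in nc.
have [e'|e'] := hy _ hx hx'; first by rewrite e' eqxx in n1.
by rewrite e' e eqxx in n2.
Qed.

(** * The blocks of orders seven and eight *)

Section NoTwins.
Variables (S T : finType) (W : S -> T -> C).
Hypotheses (hW : weighing W) (R2 : meet2 W) (C2 : meet2 (fun c r => W r c)).
Let hWt := weighing_tr hW.

Let ncol r x y : W r x != 0 -> W r y = 0 -> x != y.
Proof. by move=> h e; apply: contra_neq h => ->. Qed.

Let nrow c r r' : W r c != 0 -> W r' c = 0 -> r != r'.
Proof. by move=> h e; apply: contra_neq h => ->. Qed.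

Let row0 r r' c c' x := @meet2_only S T W r r' c c' x R2.
Let col0 c c' r r' x := @meet2_only T S _ c c' r r' x C2.

Lemma two_common r r' c c' : r != r' -> c != c' ->
  W r c != 0 -> W r' c != 0 -> W r c' != 0 -> W r' c' != 0 ->
  W r' c' = - (W r' c * W r c' / W r c).
Proof.
move=> n nc h1 h2 h3 h4; apply: two_term => // x hx hx'.
have [y [_ _ _ hy]] := R2 n h1 h2.
have [e|->] := hy _ h3 h4; first by rewrite e eqxx in nc.
exact: hy.
Qed.

(** The second column of a meet is located by elimination: it lies in the known support of [r], and
    the calls below rule out all entries of [s] but one. *)
Lemma third r r' s c : r != r' -> supp (W r) s -> W r c != 0 -> W r' c != 0 ->
  has (fun x => (x != c) && (W r' x != 0)) s.
Proof.
move=> n hs h h'; have [x [nx hx hx' _]] := R2 n h h'.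
by apply/hasP; exists x; [case: hs => _ <-|rewrite nx hx'].
Qed.

Lemma third_col c c' s r : c != c' -> supp (W^~ c) s -> W r c != 0 -> W r c' != 0 ->
  has (fun x => (x != r) && (W x c' != 0)) s.
Proof.
move=> n hs h h'; have [x [nx hx hx' _]] := C2 n h h'.
by apply/hasP; exists x; [case: hs => _ <-|rewrite nx hx'].
Qed.

Definition W7_of : seq (seq C) :=
  [:: [:: 1;  1;  1;  1;  0;  0;  0];
      [:: 1; -1;  0;  0;  1;  1;  0];
      [:: 1;  0; -1;  0; -1;  0;  1];
      [:: 1;  0;  0; -1;  0; -1; -1];
      [:: 0;  1; -1;  0;  0;  1; -1];
      [:: 0;  1;  0; -1;  1;  0;  1];
      [:: 0;  0;  1; -1; -1;  1;  0]].

Definition W8_of : seq (seq C) :=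
  [:: [:: 1;  1;  1;  1;  0;  0;  0;  0];
      [:: 1; -1;  0;  0;  1;  1;  0;  0];
      [:: 1;  0; -1;  0; -1;  0;  1;  0];
      [:: 1;  0;  0; -1;  0; -1; -1;  0];
      [:: 0;  1; -1;  0;  1;  0;  0;  1];
      [:: 0;  1;  0; -1;  0;  1;  0; -1];
      [:: 0;  0;  1; -1;  0;  0;  1;  1];
      [:: 0;  0;  0;  0;  1; -1;  1; -1]].

(** The supports are determined up to one binary choice. One outcome is the complement of the Fano
    plane, giving W_7; in the other an eighth row, disjoint from [r1], is needed to complete W_8. *)
Lemma meet2_embeds (r1 : S) : embeds W 7 (entry W7_of) \/ embeds W 8 (entry W8_of).
Proof.
have [c1 [c2 [c3 [c4 s1]]]] := supp0 hW r1.
have g c : c \in [:: c1; c2; c3; c4] -> W r1 c != 0 by apply: supp_neq0 s1.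
have [p1 p2 p3 p4] : [/\ W r1 c1 != 0, W r1 c2 != 0, W r1 c3 != 0 & W r1 c4 != 0].
  by split; apply: g; rewrite !inE eqxx ?orbT.
move: (s1.1); rewrite /= !inE !negb_or => /and4P[/and3P[n12 n13 n14] /andP[n23 n24] n34 _].
have sy (X : eqType) (x y : X) : x != y -> y != x by rewrite eq_sym.
have m12 := sy _ _ _ n12; have m13 := sy _ _ _ n13; have m14 := sy _ _ _ n14.
have m23 := sy _ _ _ n23; have m24 := sy _ _ _ n24; have m34 := sy _ _ _ n34.
(* [rij] is the one row besides [r1] through both [ci] and [cj]. It shares only these two columns
   with [r1], so it vanishes in the other two, which also shows that the six rows are distinct. *)
have [r12 [q12 h12_1 h12_2 _]] := C2 n12 p1 p2.
have [r13 [q13 h13_1 h13_3 _]] := C2 n13 p1 p3.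
have [r14 [q14 h14_1 h14_4 _]] := C2 n14 p1 p4.
have [r23 [q23 h23_2 h23_3 _]] := C2 n23 p2 p3.
have [r24 [q24 h24_2 h24_4 _]] := C2 n24 p2 p4.
have [r34 [q34 h34_3 h34_4 _]] := C2 n34 p3 p4.
have o12 := sy _ _ _ q12; have o13 := sy _ _ _ q13; have o14 := sy _ _ _ q14.
have o23 := sy _ _ _ q23; have o24 := sy _ _ _ q24; have o34 := sy _ _ _ q34.
have z12_3 := row0 o12 n12 p1 h12_1 p2 h12_2 p3 m13 m23.
have z12_4 := row0 o12 n12 p1 h12_1 p2 h12_2 p4 m14 m24.
have z13_2 := row0 o13 n13 p1 h13_1 p3 h13_3 p2 m12 n23.
have z13_4 := row0 o13 n13 p1 h13_1 p3 h13_3 p4 m14 m34.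
have z14_2 := row0 o14 n14 p1 h14_1 p4 h14_4 p2 m12 n24.
have z14_3 := row0 o14 n14 p1 h14_1 p4 h14_4 p3 m13 n34.
have z23_1 := row0 o23 n23 p2 h23_2 p3 h23_3 p1 n12 n13.
have z23_4 := row0 o23 n23 p2 h23_2 p3 h23_3 p4 m24 m34.
have z24_1 := row0 o24 n24 p2 h24_2 p4 h24_4 p1 n12 n14.
have z24_3 := row0 o24 n24 p2 h24_2 p4 h24_4 p3 m23 n34.
have z34_1 := row0 o34 n34 p3 h34_3 p4 h34_4 p1 n13 n14.
have z34_2 := row0 o34 n34 p3 h34_3 p4 h34_4 p2 n23 n24.
have i1 : r12 != r13 := nrow h12_2 z13_2.
have i2 : r12 != r14 := nrow h12_2 z14_2.
have i3 : r12 != r23 := nrow h12_1 z23_1.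
have i4 : r12 != r24 := nrow h12_1 z24_1.
have i5 : r12 != r34 := nrow h12_1 z34_1.
have i6 : r13 != r14 := nrow h13_3 z14_3.
have i7 : r13 != r23 := nrow h13_1 z23_1.
have i8 : r13 != r24 := nrow h13_1 z24_1.
have i9 : r13 != r34 := nrow h13_1 z34_1.
have i10 : r14 != r23 := nrow h14_1 z23_1.
have i11 : r14 != r24 := nrow h14_1 z24_1.
have i12 : r14 != r34 := nrow h14_1 z34_1.
have i13 : r23 != r24 := nrow h23_3 z24_3.
have i14 : r23 != r34 := nrow h23_2 z34_2.
have i15 : r24 != r34 := nrow h24_2 z34_2.
(* The rows [r12], [r13], [r14] share [c1], so any two share one further column; the third row
   avoids that column, because two columns share only two rows. *)
have [d [d1 h12_d h13_d _]] := R2 i1 h12_1 h13_1.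
have [e [e1 h12_e h14_e _]] := R2 i2 h12_1 h14_1.
have [f [f1 h13_f h14_f _]] := R2 i6 h13_1 h14_1.
have d2 := ncol h13_d z13_2; have d3 := ncol h12_d z12_3; have d4 := ncol h12_d z12_4.
have e2 := ncol h14_e z14_2; have e3 := ncol h12_e z12_3; have e4 := ncol h12_e z12_4.
have f2 := ncol h13_f z13_2; have f3 := ncol h14_f z14_3; have f4 := ncol h13_f z13_4.
have z14_d := col0 (sy _ _ _ d1) i1 h12_1 h12_d h13_1 h13_d h14_1 (sy _ _ _ i2) (sy _ _ _ i6).
have z13_e := col0 (sy _ _ _ e1) i2 h12_1 h12_e h14_1 h14_e h13_1 (sy _ _ _ i1) i6.
have z12_f := col0 (sy _ _ _ f1) i6 h13_1 h13_f h14_1 h14_f h12_1 i1 i2.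
have de := ncol h13_d z13_e; have df := ncol h12_d z12_f; have ef := ncol h12_e z12_f.
have s12 : supp (W r12) [:: c1; c2; d; e].
  by apply: supp4; rewrite //= !inE !negb_or n12 !(eq_sym c1) !(eq_sym c2) d1 e1 d2 e2 de.
have s13 : supp (W r13) [:: c1; c3; d; f].
  by apply: supp4; rewrite //= !inE !negb_or n13 !(eq_sym c1) !(eq_sym c3) d1 f1 d3 f3 df.
have s14 : supp (W r14) [:: c1; c4; e; f].
  by apply: supp4; rewrite //= !inE !negb_or n14 !(eq_sym c1) !(eq_sym c4) e1 f1 e4 f4 ef.
(* The binary choice: besides [c2], row [r23] meets [r12] in [d], leading to W_8, or in [e], leading
   to W_7. *)
have [x [x2 h12_x h23_x _]] := R2 i3 h12_2 h23_2.
have : x \in [:: d; e].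
  have x1 := ncol h23_x z23_1.
  by case: (s12) => _ hs; move: h12_x; rewrite hs !inE (negPf x1) (negPf x2).
rewrite !inE => /orP[]/eqP ex; [right|left]; rewrite {}ex {x x2 h12_x} in h23_x.
  have h23_d := h23_x.
  have z23_e := row0 i3 (sy _ _ _ d2) h12_2 h23_2 h12_d h23_d h12_e e2 (sy _ _ _ de).
  have z23_f := row0 i7 (sy _ _ _ d3) h13_3 h23_3 h13_d h23_d h13_f f3 (sy _ _ _ df).
  have u23 : uniq [:: c2; c3; d] by rewrite /= !inE !negb_or n23 (sy _ _ _ d2) (sy _ _ _ d3).
  have [gg s23] := supp3 hW u23 h23_2 h23_3 h23_d.
  have h23_g : W r23 gg != 0 by apply: (supp_neq0 s23); rewrite !inE eqxx !orbT.
  have g1 := ncol h23_g z23_1; have g4 := ncol h23_g z23_4.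
  have ge := ncol h23_g z23_e; have gf := ncol h23_g z23_f.
  have [g2 g3 gd] : [/\ gg != c2, gg != c3 & gg != d].
    move: (s23.1); rewrite /= !inE !negb_or !(eq_sym _ gg).
    by move=> /and4P[/and3P[_ _ ->] /andP[_ ->] -> _].
  have z24_d := col0 (sy _ _ _ d2) i3 h12_2 h12_d h23_2 h23_d h24_2 (sy _ _ _ i4) (sy _ _ _ i13).
  have h24_e : W r24 e != 0.
    by have := third i4 s12 h12_2 h24_2; rewrite /= z24_1 z24_d !eqxx !andbF /= orbF => /andP[].
  have z24_f := row0 i11 (sy _ _ _ e4) h14_4 h24_4 h14_e h24_e h14_f f4 (sy _ _ _ ef).
  have h24_g : W r24 gg != 0.
    by have := third i13 s23 h23_2 h24_2; rewrite /= z24_3 z24_d !eqxx !andbF /= orbF => /andP[].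
  have s24 : supp (W r24) [:: c2; c4; e; gg].
    by apply: supp4; rewrite //= !inE !negb_or n24 !(eq_sym c2) !(eq_sym c4) e2 g2 e4 g4 eq_sym ge.
  have z34_d := col0 (sy _ _ _ d3) i7 h13_3 h13_d h23_3 h23_d h34_3 (sy _ _ _ i9) (sy _ _ _ i14).
  have h34_f : W r34 f != 0.
    by have := third i9 s13 h13_3 h34_3; rewrite /= z34_1 z34_d !eqxx !andbF /= orbF => /andP[].
  have h34_g : W r34 gg != 0.
    by have := third i14 s23 h23_3 h34_3; rewrite /= z34_2 z34_d !eqxx !andbF /= orbF => /andP[].
  have s34 : supp (W r34) [:: c3; c4; f; gg].
    by apply: supp4; rewrite //= !inE !negb_or n34 !(eq_sym c3) !(eq_sym c4) f3 g3 f4 g4 eq_sym gf.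
  have ud : uniq [:: r12; r13; r23] by rewrite /= !inE !negb_or i1 i3 i7.
  (* The eighth row is the fourth row of column [d]; comparing [d] with [e], [f] and [gg] forces it
     through these columns too. *)
  have [s sd] := supp3 hWt ud h12_d h13_d h23_d.
  have hs_d : W s d != 0 by apply: (supp_neq0 sd); rewrite !inE eqxx !orbT.
  have hs_e : W s e != 0.
    by have := third_col de sd h12_d h12_e; rewrite /= z13_e z23_e !eqxx !andbF /= orbF => /andP[].
  have hs_f : W s f != 0.
    by have := third_col df sd h13_d h13_f; rewrite /= z12_f z23_f !eqxx !andbF /= orbF => /andP[].
  have z12_g : W r12 gg = 0 by apply: (supp_eq0 s12); rewrite !inE !negb_or g1 g2 gd ge.
  have z13_g : W r13 gg = 0 by apply: (supp_eq0 s13); rewrite !inE !negb_or g1 g3 gd gf.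
  have hs_g : W s gg != 0.
    by have := third_col (sy _ _ _ gd) sd h23_d h23_g; rewrite /= z12_g z13_g !eqxx !andbF /= orbF => /andP[].
  have ss : supp (W s) [:: d; e; f; gg].
    by apply: supp4; rewrite //= !inE !negb_or de df ef !(eq_sym _ gg) gd ge gf.
  have z1_d : W r1 d = 0 by apply: (supp_eq0 s1); rewrite !inE !negb_or d1 d2 d3 d4.
  have [j12 j13 j23] : [/\ r12 != s, r13 != s & r23 != s].
    by move: (sd.1); rewrite /= !inE !negb_or => /and4P[/and3P[_ _ ->] /andP[_ ->] -> _].
  have j1 := nrow hs_d z1_d; have j14 := nrow hs_d z14_d.
  have j24 := nrow hs_d z24_d; have j34 := nrow hs_d z34_d.
  have v12_2 := two_common o12 n12 p1 h12_1 p2 h12_2.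
  have v13_3 := two_common o13 n13 p1 h13_1 p3 h13_3.
  have v14_4 := two_common o14 n14 p1 h14_1 p4 h14_4.
  have v23_3 := two_common o23 n23 p2 h23_2 p3 h23_3.
  have v24_4 := two_common o24 n24 p2 h24_2 p4 h24_4.
  have v34_4 := two_common o34 n34 p3 h34_3 p4 h34_4.
  have v13_d := two_common i1 (sy _ _ _ d1) h12_1 h13_1 h12_d h13_d.
  have v14_e := two_common i2 (sy _ _ _ e1) h12_1 h14_1 h12_e h14_e.
  have v14_f := two_common i6 (sy _ _ _ f1) h13_1 h14_1 h13_f h14_f.
  have v23_d := two_common i3 (sy _ _ _ d2) h12_2 h23_2 h12_d h23_d.
  have v24_e := two_common i4 (sy _ _ _ e2) h12_2 h24_2 h12_e h24_e.
  have v24_g := two_common i13 (sy _ _ _ g2) h23_2 h24_2 h23_g h24_g.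
  have v34_f := two_common i9 (sy _ _ _ f3) h13_3 h34_3 h13_f h34_f.
  have v34_g := two_common i14 (sy _ _ _ g3) h23_3 h34_3 h23_g h34_g.
  have vs_e := two_common j12 de h12_d hs_d h12_e hs_e.
  have vs_f := two_common j13 df h13_d hs_d h13_f hs_f.
  have vs_g := two_common j23 (sy _ _ _ gd) h23_d hs_d h23_g hs_g.
  (* The scalars turn the first nonzero entry of each row and of each column into 1; the two-term
     relations collected above then force the remaining signs. *)
  apply: (@embeds_supp _ _ _ _ r1 c1 [:: r1; r12; r13; r14; r23; r24; r34; s]
    [:: c1; c2; c3; c4; d; e; f; gg]
    [:: 1; W r12 c1 / W r1 c1; W r13 c1 / W r1 c1; W r14 c1 / W r1 c1; W r23 c2 / W r1 c2;
        W r24 c2 / W r1 c2; W r34 c3 / W r1 c3; W s d / (W r12 d * W r1 c1 / W r12 c1)]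
    [:: W r1 c1; W r1 c2; W r1 c3; W r1 c4; W r12 d * W r1 c1 / W r12 c1;
        W r12 e * W r1 c1 / W r12 c1; W r13 f * W r1 c1 / W r13 c1; W r23 gg * W r1 c2 / W r23 c2] _ _
    [:: [::0;1;2;3]; [::0;1;4;5]; [::0;2;4;6]; [::0;3;5;6]; [::1;2;4;7]; [::1;3;5;7];
        [::2;3;6;7]; [::4;5;6;7]]%N) => //.
  - by rewrite /= !inE !negb_or o12 o13 o14 o23 o24 o34 i1 i2 i3 i4 i5 i6 i7 i8 i9 i10 i11 i12 i13
      i14 i15 j12 j13 j23 !(eq_sym _ s) j1 j14 j24 j34.
  - by rewrite /= !inE !negb_or n12 n13 n14 n23 n24 n34 de df ef !(eq_sym _ gg) g1 g2 g3 g4 gd ge gf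
     !(eq_sym _ d) d1 d2 d3 d4 !(eq_sym _ e) e1 e2 e3 e4 !(eq_sym _ f) f1 f2 f3 f4.
  - by rewrite /= !(normrM, normfV) !(weighing_norm hW) // ?(normr1, mulr1, invr1) eqxx.
  - by rewrite /= !(normrM, normfV) !(weighing_norm hW) // ?(normr1, mulr1, invr1) eqxx.
  - case=> [|[|[|[|[|[|[|[|//]]]]]]]] [|[|[|[|[|[|[|[|//]]]]]]]] _ _ //.
  - by case=> [|[|[|[|[|[|[|[|//]]]]]]]].
  case=> [|[|[|[|[|[|[|[|//]]]]]]]] _ j; rewrite !inE => /or4P[]/eqP-> /=; rewrite /entry /=;
    rewrite ?vs_e ?vs_f ?vs_g ?v34_g ?v34_f ?v24_g ?v24_e ?v23_d ?v14_f ?v14_e ?v13_d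
      ?v34_4 ?v24_4 ?v23_3 ?v14_4 ?v13_3 ?v12_2; field;
    by rewrite ?p1 ?p2 ?p3 ?p4 ?h12_1 ?h12_d ?h12_e ?h13_1 ?h13_f ?h14_1 ?h23_2 ?h24_2 ?h34_3 ?h23_g ?hs_d.
have h23_e := h23_x.
have z23_d := row0 i3 (sy _ _ _ e2) h12_2 h23_2 h12_e h23_e h12_d d2 de.
have h23_f : W r23 f != 0.
  by have := third i7 s13 h13_3 h23_3; rewrite /= z23_1 z23_d !eqxx !andbF /= orbF => /andP[].
have s23 : supp (W r23) [:: c2; c3; e; f].
  by apply: supp4; rewrite //= !inE !negb_or n23 !(eq_sym c2) !(eq_sym c3) e2 f2 e3 f3 ef.
have z24_e := col0 (sy _ _ _ e2) i3 h12_2 h12_e h23_2 h23_e h24_2 (sy _ _ _ i4) (sy _ _ _ i13).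
have h24_d : W r24 d != 0.
  by have := third i4 s12 h12_2 h24_2; rewrite /= z24_1 z24_e !eqxx !andbF /= orbF => /andP[].
have h24_f : W r24 f != 0.
  by have := third i11 s14 h14_4 h24_4; rewrite /= z24_1 z24_e !eqxx !andbF /= orbF => /andP[].
have s24 : supp (W r24) [:: c2; c4; d; f].
  by apply: supp4; rewrite //= !inE !negb_or n24 !(eq_sym c2) !(eq_sym c4) d2 f2 d4 f4 df.
have z34_f := col0 (sy _ _ _ f3) i7 h13_3 h13_f h23_3 h23_f h34_3 (sy _ _ _ i9) (sy _ _ _ i14).
have h34_d : W r34 d != 0.
  by have := third i9 s13 h13_3 h34_3; rewrite /= z34_1 z34_f !eqxx !andbF /= orbF => /andP[].
have h34_e : W r34 e != 0.
  by have := third i12 s14 h14_4 h34_4; rewrite /= z34_1 z34_f !eqxx !andbF /= orbF => /andP[].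
have s34 : supp (W r34) [:: c3; c4; d; e].
  by apply: supp4; rewrite //= !inE !negb_or n34 !(eq_sym c3) !(eq_sym c4) d3 e3 d4 e4 de.
have v12_2 := two_common o12 n12 p1 h12_1 p2 h12_2.
have v13_3 := two_common o13 n13 p1 h13_1 p3 h13_3.
have v14_4 := two_common o14 n14 p1 h14_1 p4 h14_4.
have v23_3 := two_common o23 n23 p2 h23_2 p3 h23_3.
have v24_4 := two_common o24 n24 p2 h24_2 p4 h24_4.
have v34_4 := two_common o34 n34 p3 h34_3 p4 h34_4.
have v13_d := two_common i1 (sy _ _ _ d1) h12_1 h13_1 h12_d h13_d.
have v14_e := two_common i2 (sy _ _ _ e1) h12_1 h14_1 h12_e h14_e.
have v14_f := two_common i6 (sy _ _ _ f1) h13_1 h14_1 h13_f h14_f.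
have v23_e := two_common i3 (sy _ _ _ e2) h12_2 h23_2 h12_e h23_e.
have v23_f := two_common i7 (sy _ _ _ f3) h13_3 h23_3 h13_f h23_f.
have v24_d := two_common i4 (sy _ _ _ d2) h12_2 h24_2 h12_d h24_d.
have v24_f := two_common i11 (sy _ _ _ f4) h14_4 h24_4 h14_f h24_f.
have v34_d := two_common i9 (sy _ _ _ d3) h13_3 h34_3 h13_d h34_d.
have v34_e := two_common i12 (sy _ _ _ e4) h14_4 h34_4 h14_e h34_e.
apply: (@embeds_supp _ _ _ _ r1 c1 [:: r1; r12; r13; r14; r23; r24; r34]
    [:: c1; c2; c3; c4; d; e; f]
    [:: 1; W r12 c1 / W r1 c1; W r13 c1 / W r1 c1; W r14 c1 / W r1 c1; W r23 c2 / W r1 c2;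
        W r24 c2 / W r1 c2; W r34 c3 / W r1 c3]
    [:: W r1 c1; W r1 c2; W r1 c3; W r1 c4; W r12 d * W r1 c1 / W r12 c1;
        W r12 e * W r1 c1 / W r12 c1; W r13 f * W r1 c1 / W r13 c1] _ _
    [:: [::0;1;2;3]; [::0;1;4;5]; [::0;2;4;6]; [::0;3;5;6]; [::1;2;5;6]; [::1;3;4;6];
        [::2;3;4;5]]%N) => //.
- by rewrite /= !inE !negb_or o12 o13 o14 o23 o24 o34 i1 i2 i3 i4 i5 i6 i7 i8 i9 i10 i11 i12 i13
    i14 i15.
- by rewrite /= !inE !negb_or n12 n13 n14 n23 n24 n34 de df ef
   !(eq_sym _ d) d1 d2 d3 d4 !(eq_sym _ e) e1 e2 e3 e4 !(eq_sym _ f) f1 f2 f3 f4.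
- by rewrite /= !(normrM, normfV) !(weighing_norm hW) // ?(normr1, mulr1, invr1) eqxx.
- by rewrite /= !(normrM, normfV) !(weighing_norm hW) // ?(normr1, mulr1, invr1) eqxx.
- by case=> [|[|[|[|[|[|[|//]]]]]]] [|[|[|[|[|[|[|//]]]]]]].
- by case=> [|[|[|[|[|[|[|//]]]]]]].
case=> [|[|[|[|[|[|[|//]]]]]]] _ j; rewrite !inE => /or4P[]/eqP-> /=; rewrite /entry /=;
  rewrite ?v34_e ?v34_d ?v24_f ?v24_d ?v23_f ?v23_e ?v14_f ?v14_e ?v13_d
    ?v34_4 ?v24_4 ?v23_3 ?v14_4 ?v13_3 ?v12_2; field;
  by rewrite ?p1 ?p2 ?p3 ?p4 ?h12_1 ?h12_d ?h12_e ?h13_1 ?h13_f ?h14_1 ?h23_2 ?h24_2 ?h34_3.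
Qed.

End NoTwins.
End Even.

(** * Twin columns *)

Section Twins.
Variable C : numClosedFieldType.

(** (x + 1)(y + 1)(z + 1) is the first sum plus xyz times the second. *)
Lemma sum4_opp (x y z : C) : x != 0 -> y != 0 -> z != 0 ->
  1 + x + y + z = 0 -> 1 + x^-1 + y^-1 + z^-1 = 0 -> [\/ x = -1, y = -1 | z = -1].
Proof.
move=> x0 y0 z0 e1 e2.
have : (x + 1) * ((y + 1) * (z + 1)) = 0.
  have -> : (x + 1) * ((y + 1) * (z + 1)) =
    (1 + x + y + z) + x * y * z * (1 + x^-1 + y^-1 + z^-1) by field; rewrite x0 y0 z0.
  by rewrite e1 e2 mulr0 addr0.
move/eqP; rewrite !mulf_eq0 !addr_eq0 => /or3P[]/eqP ->;
  by [constructor 1 | constructor 2 | constructor 3].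
Qed.

(** Divide by [t] and apply [sum4_opp]: 1 is not opposite to 1, so one of [x], [y] is [- t], and
    then so is the other. *)
Lemma sum4_double (t x y : C) : t != 0 -> x != 0 -> y != 0 ->
  t + t + x + y = 0 -> t^-1 + t^-1 + x^-1 + y^-1 = 0 -> x = - t /\ y = - t.
Proof.
move=> t0 x0 y0 e1 e2.
have e : x + y = - (t + t) by apply/eqP; rewrite -subr_eq0 -[X in _ == X]e1; apply/eqP; ring.
have o : 1 + 1 != 0 :> C by rewrite (eqr_nat C 2 0).
have : [\/ 1 = -1 :> C, x / t = -1 | y / t = -1].
  apply: sum4_opp; rewrite ?oner_eq0 ?mulf_neq0 ?invr_eq0 //.
    have -> : 1 + 1 + x / t + y / t = (t + t + x + y) / t by field.
    by rewrite e1 mul0r.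
  have -> : 1 + 1^-1 + (x / t)^-1 + (y / t)^-1 = (t^-1 + t^-1 + x^-1 + y^-1) * t.
    by field; rewrite x0 y0 t0.
  by rewrite e2 mul0r.
case=> h.
- by case/eqP: o; rewrite {2}h subrr.
- have ex : x = - t by rewrite -[LHS](divfK t0) h mulN1r.
  by split=> //; apply: (addrI x); rewrite e ex; ring.
- have ey : y = - t by rewrite -[LHS](divfK t0) h mulN1r.
  by split=> //; apply: (addIr y); rewrite e ey; ring.
Qed.

(* The entries of a normalised complex Hadamard matrix of order 4, first row and column removed. *)
Lemma hadamard4_row (x22 x23 x24 x32 x33 x34 x42 x43 x44 : C) :
  all (fun x => x != 0) [:: x22; x23; x24; x32; x33; x34; x42; x43; x44] ->
  x22 = -1 ->
  1 + x22 + x23 + x24 = 0 -> 1 + x32 + x33 + x34 = 0 -> 1 + x42 + x43 + x44 = 0 ->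
  1 + x22 + x32 + x42 = 0 -> 1 + x23 + x33 + x43 = 0 -> 1 + x24 + x34 + x44 = 0 ->
  1 + x23^-1 + x33^-1 + x43^-1 = 0 -> 1 + x24^-1 + x34^-1 + x44^-1 = 0 ->
  1 + x22 / x32 + x23 / x33 + x24 / x34 = 0 ->
  let good x y z := [\/ [/\ x = 1, y = -1 & z = -1], [/\ x = -1, y = 1 & z = -1]
    | [/\ x = -1, y = -1 & z = 1]] in
  [\/ good x22 x23 x24, good x32 x33 x34 | good x42 x43 x44].
Proof.
move=> /= /and5P[n22 n23 n24 n32 /and5P[n33 n34 n42 n43 /andP[n44 _]]] e22.
rewrite {}e22 in n22 *; set y := x23 in n23 *.
move=> er2 er3 er4 ec2 ec3 ec4 fc3 fc4 eo.
have e24 : x24 = - y by apply/eqP; rewrite -subr_eq0 -[X in _ == X]er2; apply/eqP; ring.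
have e42 : x42 = - x32 by apply/eqP; rewrite -subr_eq0 -[X in _ == X]ec2; apply/eqP; ring.
rewrite {}e24 {}e42 in er2 er4 ec2 ec3 ec4 fc3 fc4 eo n24 n42 *.
have [y1|/eqP y1] := eqVneq y 1; first by constructor 1; constructor 2; rewrite y1.
have [yn|/eqP yn] := eqVneq y (-1); first by constructor 1; constructor 3; rewrite yn opprK.
have E43 : x43 = - (1 + y + x33) by apply/eqP; rewrite -addr_eq0 addrC ec3.
have E44 : x44 = - (1 - y + x34) by apply/eqP; rewrite -addr_eq0 addrC ec4.
have E34 : x34 = - (1 + x32 + x33) by apply/eqP; rewrite -addr_eq0 addrC er3.
(* The last two columns cancel in opposite pairs, which leaves two choices for each since y is
   neither 1 nor -1. Mixed choices contradict orthogonality of rows 2 and 3 by y^2 = 1; the other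
   two make row 3 or row 4 equal to (1, 1, -1, -1). *)
have c3 : x33 = -1 \/ x33 = - y.
  case: (sum4_opp n23 n33 n43 ec3 fc3) => [//|->|e]; [by left|right].
  by apply/eqP; rewrite -subr_eq0 -[X in _ == X]ec3 e; apply/eqP; ring.
have c4 : x34 = -1 \/ x34 = y.
  case: (sum4_opp n24 n34 n44 ec4 fc4) => [e|->|e]; [|by left|right].
    by case: y1; rewrite -[LHS]opprK e opprK.
  by apply/eqP; rewrite -subr_eq0 -[X in _ == X]ec4 e; apply/eqP; ring.
have bad : y ^+ 2 = 1 -> False.
  by move=> /eqP; rewrite sqrf_eq1 => /orP[]/eqP.
case: c3 => e33; case: c4 => e34.
- constructor 2; constructor 1; split=> //.
  by apply/eqP; rewrite -subr_eq0 -[X in _ == X]er3 e33 e34; apply/eqP; ring.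
- have e32 : x32 = - y by apply/eqP; rewrite -subr_eq0 -[X in _ == X]er3 e33 e34; apply/eqP; ring.
  case: bad; move: eo; rewrite e32 e33 e34 => eo.
  have : y * (1 + -1 / - y + y / -1 + - y / y) = 1 - y ^+ 2 by field; rewrite n23.
  by rewrite eo mulr0 => /esym/eqP; rewrite subr_eq0 => /eqP.
- have e32 : x32 = y by apply/eqP; rewrite -subr_eq0 -[X in _ == X]er3 e33 e34; apply/eqP; ring.
  case: bad; move: eo; rewrite e32 e33 e34 => eo.
  have : y * (1 + -1 / y + y / - y + - y / -1) = y ^+ 2 - 1 by field; rewrite n23.
  by rewrite eo mulr0 => /esym/eqP; rewrite subr_eq0 => /eqP.
- have e32 : x32 = -1 by apply/eqP; rewrite -subr_eq0 -[X in _ == X]er3 e33 e34; apply/eqP; ring.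
  constructor 3; constructor 1; rewrite e32 opprK E43 E44 e33 e34; split=> //; ring.
Qed.

(** * Finding the first pair of rows *)

Section Chain.
Variables (S T : finType) (W : S -> T -> C).
Hypotheses (hW : weighing W) (hE : even_meet W) (hEt : even_meet (fun c r => W r c)).
Let hWt := weighing_tr hW.

Definition twin c c' := forall r, (W r c != 0) = (W r c' != 0).

Lemma twin_sub c c' : (forall r, W r c != 0 -> W r c' != 0) -> twin c c'.
Proof.
move=> h r; have [r1 [r2 [r3 [r4 s]]]] := supp0 hWt c.
have g x : x \in [:: r1; r2; r3; r4] -> W x c' != 0 by move/(supp_neq0 s)/h.
have s' : supp (W^~ c') [:: r1; r2; r3; r4].
  by apply: (supp4 hWt s.1); apply: g; rewrite !inE eqxx ?orbT.
by rewrite (s.2 r) (s'.2 r).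
Qed.

(** Any other row meets [r] in an even number of columns, and [c], [c'] contribute 0 or 2 to it, so
    it contains both or neither of [x], [y]. *)
Lemma twin_rest r c c' x y : supp (W r) [:: c; c'; x; y] -> twin c c' -> twin x y.
Proof.
move=> s h r'; have [<-|n] := eqVneq r r'.
  by rewrite !(supp_neq0 s) // !inE eqxx ?orbT.
by have := hE n s; rewrite h addbb /=; case: (W r' x != 0); case: (W r' y != 0).
Qed.

(* The entries of row r' divided by those of row r are l, l, -l, -l. *)
Definition good_start r r' c1 c2 c3 c4 :=
  [/\ r != r', supp (W r) [:: c1; c2; c3; c4], supp (W r') [:: c1; c2; c3; c4],
      twin c1 c2 /\ twin c3 c4
    & [/\ W r' c2 * W r c1 = W r' c1 * W r c2, W r' c3 * W r c1 = - (W r' c1 * W r c3)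
       & W r' c4 * W r c1 = - (W r' c1 * W r c4)]].

(** If all four columns are twins, the block is a complex Hadamard matrix. Its second row may have a
    complex ratio to the first, so the pair that starts the chain has to be searched for with
    [hadamard4_row]. *)
Lemma hadamard_start r1 r2 r3 r4 c1 c2 c3 c4 : uniq [:: r1; r2; r3; r4] ->
  (forall r, r \in [:: r1; r2; r3; r4] -> supp (W r) [:: c1; c2; c3; c4]) ->
  (forall c, c \in [:: c1; c2; c3; c4] -> supp (W^~ c) [:: r1; r2; r3; r4]) ->
  exists r r' d1 d2 d3 d4, good_start r r' d1 d2 d3 d4.
Proof.
move=> ur hr hc.
have nz r c : r \in [:: r1; r2; r3; r4] -> c \in [:: c1; c2; c3; c4] -> W r c != 0.
  by move=> /hr; apply: supp_neq0.
have tw c c' : c \in [:: c1; c2; c3; c4] -> c' \in [:: c1; c2; c3; c4] -> twin c c'.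
  by move=> /hc[_ h] /hc[_ h'] r; rewrite h h'.
have uc : uniq [:: c1; c2; c3; c4] by case: (hr r1 (mem_head _ _)).
(* By [sum4_opp] some normalised entry of row [r2] is -1; the columns are renamed to place it at
   [c2]. *)
wlog e22 : c2 c3 c4 hr hc nz tw uc / W r2 c2 * W r1 c1 = - (W r2 c1 * W r1 c2).
  move=> wl; have n12 : r1 != r2 by move: ur; rewrite /= !inE !negb_or => /andP[/and3P[->]].
  have s1 := hr r1 (mem_head _ _).
  have e := row_eq hW s1 n12; have e' := row_eqV hW s1 n12.
  have y1 c : c \in [:: c1; c2; c3; c4] -> W r1 c != 0 by apply: nz; rewrite !inE eqxx.
  have y2 c : c \in [:: c1; c2; c3; c4] -> W r2 c != 0 by apply: nz; rewrite !inE eqxx ?orbT.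
  have [m1 m2 m3 m4] : [/\ c1 \in [:: c1; c2; c3; c4], c2 \in [:: c1; c2; c3; c4],
     c3 \in [:: c1; c2; c3; c4] & c4 \in [:: c1; c2; c3; c4]] by rewrite !inE !eqxx ?orbT.
  have [a1 a2 a3 a4] := And4 (y1 _ m1) (y1 _ m2) (y1 _ m3) (y1 _ m4).
  have [b1 b2 b3 b4] := And4 (y2 _ m1) (y2 _ m2) (y2 _ m3) (y2 _ m4).
  pose t c := W r2 c * W r1 c1 / (W r2 c1 * W r1 c).
  have t0 c : c \in [:: c1; c2; c3; c4] -> t c != 0.
    by move=> h; rewrite /t !mulf_neq0 ?invr_eq0 ?mulf_neq0 ?y1 ?y2.
  have [h|h|h] : [\/ t c2 = -1, t c3 = -1 | t c4 = -1].
    apply: sum4_opp; rewrite ?t0 //.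
      have -> : 1 + t c2 + t c3 + t c4 = (W r2 c1 / W r1 c1 + W r2 c2 / W r1 c2 + W r2 c3 / W r1 c3
        + W r2 c4 / W r1 c4) * W r1 c1 / W r2 c1 by rewrite /t; field; rewrite a1 a2 a3 a4 b1.
      by rewrite e !mul0r.
    have -> : 1 + (t c2)^-1 + (t c3)^-1 + (t c4)^-1 = (W r1 c1 / W r2 c1 + W r1 c2 / W r2 c2
        + W r1 c3 / W r2 c3 + W r1 c4 / W r2 c4) * W r2 c1 / W r1 c1.
      by rewrite /t; field; rewrite a1 a2 a3 a4 b1 b2 b3 b4.
    by rewrite e' !mul0r.
  - apply: (wl c2 c3 c4) => //; rewrite -[LHS](mulfVK (mulf_neq0 b1 a2)) -/(t c2) h; ring.
  - have mp c : (c \in [:: c1; c3; c2; c4]) = (c \in [:: c1; c2; c3; c4]).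
      by rewrite !inE; congr (_ || _); rewrite orbCA.
    apply: (wl c3 c2 c4).
    + move=> r /hr; apply: supp_perm; by rewrite perm_cons (perm_catCA [:: c2] [:: c3] [:: c4]).
    + by move=> c; rewrite mp; apply: hc.
    + by move=> r c hr'; rewrite mp; apply: nz.
    + by move=> c c'; rewrite !mp; apply: tw.
    + have p : perm_eq [:: c1; c3; c2; c4] [:: c1; c2; c3; c4].
        by rewrite perm_cons (perm_catCA [:: c3] [:: c2] [:: c4]).
      by rewrite (perm_uniq p).
    + rewrite -[LHS](mulfVK (mulf_neq0 b1 a3)) -/(t c3) h; ring.
  - have p : perm_eq [:: c1; c4; c2; c3] [:: c1; c2; c3; c4].
      by rewrite perm_cons (perm_catC [:: c4] [:: c2; c3]).
    have mp c := perm_mem p c.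
    apply: (wl c4 c2 c3).
    + by move=> r /hr; apply: supp_perm; rewrite perm_sym.
    + by move=> c; rewrite mp; apply: hc.
    + by move=> r c hr'; rewrite mp; apply: nz.
    + by move=> c c'; rewrite !mp; apply: tw.
    + by rewrite (perm_uniq p).
    + rewrite -[LHS](mulfVK (mulf_neq0 b1 a4)) -/(t c4) h; ring.
have [i1 i2 i3 i4] : [/\ r1 \in [:: r1; r2; r3; r4], r2 \in [:: r1; r2; r3; r4],
   r3 \in [:: r1; r2; r3; r4] & r4 \in [:: r1; r2; r3; r4]] by rewrite !inE !eqxx ?orbT.
have [m1 m2 m3 m4] : [/\ c1 \in [:: c1; c2; c3; c4], c2 \in [:: c1; c2; c3; c4],
   c3 \in [:: c1; c2; c3; c4] & c4 \in [:: c1; c2; c3; c4]] by rewrite !inE !eqxx ?orbT.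
have [a11 a12 a13 a14] := And4 (nz _ _ i1 m1) (nz _ _ i1 m2) (nz _ _ i1 m3) (nz _ _ i1 m4).
have [a21 a22 a23 a24] := And4 (nz _ _ i2 m1) (nz _ _ i2 m2) (nz _ _ i2 m3) (nz _ _ i2 m4).
have [a31 a32 a33 a34] := And4 (nz _ _ i3 m1) (nz _ _ i3 m2) (nz _ _ i3 m3) (nz _ _ i3 m4).
have [a41 a42 a43 a44] := And4 (nz _ _ i4 m1) (nz _ _ i4 m2) (nz _ _ i4 m3) (nz _ _ i4 m4).
have anz := (a11, a12, a13, a14, (a21, a22, a23, a24), (a31, a32, a33, a34), (a41, a42, a43, a44)).
move: (ur); rewrite /= !inE !negb_or => /and4P[/and3P[n12 n13 n14] /andP[n23 _] _ _].
move: (uc); rewrite /= !inE !negb_or => /and4P[/and3P[k12 k13 k14] _ _ _].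
pose t r c := W r c * W r1 c1 / (W r c1 * W r1 c).
have rw r : r \in [:: r1; r2; r3; r4] -> r1 != r -> 1 + t r c2 + t r c3 + t r c4 = 0.
  move=> hr' n; have := row_eq hW (hr _ i1) n => e.
  have -> : 1 + t r c2 + t r c3 + t r c4 = (W r c1 / W r1 c1 + W r c2 / W r1 c2 + W r c3 / W r1 c3
    + W r c4 / W r1 c4) * W r1 c1 / W r c1 by rewrite /t; field; rewrite !anz nz.
  by rewrite e !mul0r.
have cl c : c \in [:: c1; c2; c3; c4] -> c1 != c -> 1 + t r2 c + t r3 c + t r4 c = 0.
  move=> hc' n; have := row_eq hWt (hc _ m1) n => e.
  have -> : 1 + t r2 c + t r3 c + t r4 c = (W r1 c / W r1 c1 + W r2 c / W r2 c1 + W r3 c / W r3 c1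
    + W r4 c / W r4 c1) * W r1 c1 / W r1 c by rewrite /t; field; rewrite !anz nz.
  by rewrite e !mul0r.
have clV c : c \in [:: c1; c2; c3; c4] -> c1 != c ->
    1 + (t r2 c)^-1 + (t r3 c)^-1 + (t r4 c)^-1 = 0.
  move=> hc' n; have := row_eqV hWt (hc _ m1) n => e.
  have -> : 1 + (t r2 c)^-1 + (t r3 c)^-1 + (t r4 c)^-1 = (W r1 c1 / W r1 c + W r2 c1 / W r2 c
    + W r3 c1 / W r3 c + W r4 c1 / W r4 c) * W r1 c / W r1 c1 by rewrite /t; field; rewrite !anz !nz.
  by rewrite e !mul0r.
have tn r c : r \in [:: r1; r2; r3; r4] -> c \in [:: c1; c2; c3; c4] -> t r c != 0.
  by move=> h h'; rewrite /t !mulf_neq0 ?invr_eq0 ?mulf_neq0 // nz.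
have ok r : r \in [:: r1; r2; r3; r4] -> r1 != r ->
  [\/ [/\ t r c2 = 1, t r c3 = -1 & t r c4 = -1], [/\ t r c2 = -1, t r c3 = 1 & t r c4 = -1]
    | [/\ t r c2 = -1, t r c3 = -1 & t r c4 = 1]] -> exists r r' d1 d2 d3 d4, good_start r r' d1 d2 d3 d4.
  move=> h n; have tp c : c \in [:: c1; c2; c3; c4] -> t r c = 1 -> W r c * W r1 c1 = W r c1 * W r1 c.
    move=> h' e; rewrite -[LHS](mulfVK (_ : W r c1 * W r1 c != 0)) -/(t r c) ?e ?mul1r //.
    by rewrite mulf_neq0 ?nz.
  have tm c : c \in [:: c1; c2; c3; c4] -> t r c = -1 -> W r c * W r1 c1 = - (W r c1 * W r1 c).
    move=> h' e; rewrite -[LHS](mulfVK (_ : W r c1 * W r1 c != 0)) -/(t r c) ?e ?mulN1r //.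
    by rewrite mulf_neq0 ?nz.
  case=> -[/= e2 e3 e4].
  - exists r1, r, c1, c2, c3, c4; split=> //; try (by apply: hr); split;
      by [apply: tw | apply: tp | apply: tm].
  - have p : perm_eq [:: c1; c2; c3; c4] [:: c1; c3; c2; c4].
      by rewrite perm_cons (perm_catCA [:: c2] [:: c3] [:: c4]).
    exists r1, r, c1, c3, c2, c4; split=> //; try (by apply: (supp_perm p); apply: hr); split;
      by [apply: tw | apply: tp | apply: tm].
  - have p : perm_eq [:: c1; c2; c3; c4] [:: c1; c4; c2; c3].
      by rewrite perm_cons (perm_catC [:: c2; c3] [:: c4]).
    exists r1, r, c1, c4, c2, c3; split=> //; try (by apply: (supp_perm p); apply: hr); split;
      by [apply: tw | apply: tp | apply: tm].
have t22 : t r2 c2 = -1 by rewrite /t e22 mulNr divff ?mulf_neq0.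
have e23 := row_eqV hW (hr _ i2) n23.
have eo : 1 + t r2 c2 / t r3 c2 + t r2 c3 / t r3 c3 + t r2 c4 / t r3 c4 = 0.
  have -> : 1 + t r2 c2 / t r3 c2 + t r2 c3 / t r3 c3 + t r2 c4 / t r3 c4 = (W r2 c1 / W r3 c1
    + W r2 c2 / W r3 c2 + W r2 c3 / W r3 c3 + W r2 c4 / W r3 c4) * W r3 c1 / W r2 c1.
    by rewrite /t; field; rewrite !anz.
  by rewrite e23 !mul0r.
have an : all (fun x => x != 0) [:: t r2 c2; t r2 c3; t r2 c4; t r3 c2; t r3 c3; t r3 c4;
    t r4 c2; t r4 c3; t r4 c4] by rewrite /= !tn.
case: (hadamard4_row an t22 (rw _ i2 n12) (rw _ i3 n13) (rw _ i4 n14) (cl _ m2 k12)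
   (cl _ m3 k13) (cl _ m4 k14) (clV _ m3 k13) (clV _ m4 k14) eo).
- exact: (ok r2).
- exact: (ok r3).
- exact: (ok r4).
Qed.

(** A row [r1] through [c] has two further columns [x], [y], again twins. The columns [c] and [x]
    share either two rows, which become the starting pair, or all four, the Hadamard case. *)
Lemma twin_start c c' : c != c' -> twin c c' ->
  exists r r' d1 d2 d3 d4, good_start r r' d1 d2 d3 d4.
Proof.
move=> n tw; have [r1 [r2 [r3 [r4 sc]]]] := supp0 hWt c.
have p1 : W r1 c != 0 by apply: (supp_neq0 sc); rewrite mem_head.
have p1' : W r1 c' != 0 by rewrite -tw.
have [x [y s1]] := supp2 hW n p1 p1'.
have txy := twin_rest s1 tw.
have px : W r1 x != 0 by apply: (supp_neq0 s1); rewrite !inE eqxx !orbT.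
have py : W r1 y != 0 by apply: (supp_neq0 s1); rewrite !inE eqxx !orbT.
move: (s1.1); rewrite /= !inE !negb_or => /and4P[/and3P[_ ncx ncy] /andP[ncx' ncy'] nxy _].
have [[r [nr h1 h2 hx]]|al] := even_meet_dec hWt hEt ncx p1 px; last first.
  have tcx := twin_sub al.
  have hc d : d \in [:: c; c'; x; y] -> supp (W^~ d) [:: r1; r2; r3; r4].
    rewrite !inE => /or4P[]/eqP-> //; split; try exact: sc.1; move=> q; rewrite -(sc.2 q).
    - exact/esym/tw.
    - exact/esym/tcx.
    - by rewrite -(txy q); apply/esym/tcx.
  apply: (hadamard_start sc.1 _ hc) => q hq.
  have g d : d \in [:: c; c'; x; y] -> W q d != 0 by move/hc/supp_neq0; apply.
  by apply: (supp4 hW s1.1); apply: g; rewrite !inE eqxx ?orbT.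
(* By twinness each of [c], [c'] shares exactly the rows [r1], [r] with each of [x], [y], so every
   such pair of columns gives a two-term relation. *)
exists r1, r, c, c', x, y; rewrite eq_sym in nr.
have h1' : W r c' != 0 by rewrite -tw.
have h2' : W r y != 0 by rewrite -txy.
have sr : supp (W r) [:: c; c'; x; y] by apply: (supp4 hW s1.1).
split=> //.
have hx' z : W z c != 0 -> W z x != 0 -> z = r1 \/ z = r := hx z.
have tcx := two_term hWt ncx nr p1 px h1 h2 hx'.
have tcy : W r y = - (W r1 y * W r c / W r1 c).
  by apply: (two_term hWt ncy nr p1 py h1 h2') => z; rewrite -(txy z); apply: hx'.
have tc'x : W r x = - (W r1 x * W r c' / W r1 c').
  by apply: (two_term hWt ncx' nr p1' px h1' h2) => z; rewrite -(tw z); apply: hx'.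
split.
- have : W r1 x * W r c' / W r1 c' = W r1 x * W r c / W r1 c by apply: oppr_inj; rewrite -tc'x.
  rewrite -!mulrA => /(mulfI px) e.
  by rewrite -[W r c'](divfK p1') e; field.
- by rewrite tcx; field.
- by rewrite tcy; field.
Qed.

End Chain.
End Twins.

(** * Chains of row and column pairs *)

Section ChainGrowth.
Variable C : numClosedFieldType.

(** [d] and [e] are the parities of row and column inside a 2 x 2 block. For [m = 0] the test for
    the last block always fails, so [pair_entry 0 0] is the unbounded pattern that a growing chain
    follows. *)
Definition pair_entry (m : nat) (x : C) (I J : nat) (d e : bool) : C :=
  if (I == 0%N) && (J == 0%N) then 1
  else if (I.+1 == m) && (J.+1 == m) then (if d == e then x else - x)
  else if J == I.+1 then (if d then -1 else 1)
  else if I == J.+1 then (if e then -1 else 1)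
  else 0.

Definition E_entry (m : nat) (x : C) (i j : nat) : C :=
  pair_entry m x i./2 j./2 (odd i) (odd j).

Lemma sgb_neq0 (b : bool) : (if b then -1 else 1) != 0 :> C.
Proof. by case: b; rewrite ?oppr_eq0 oner_eq0. Qed.

Variables (S T : finType) (W : S -> T -> C).
Hypotheses (hW : weighing W) (hE : even_meet W) (hEt : even_meet (fun c r => W r c)).
Let hWt := weighing_tr hW.

(* Row pairs 0 .. k-1 and column pairs 0 .. k follow the pattern of E_2m without its last block;
   only the column pairs k-1 and k may still meet other rows. *)
Record chain k (rho : nat -> bool -> S) (gam : nat -> bool -> T) (al be : nat -> bool -> C) : Prop :=
 Chain {
  chain_rho : forall I I' d d', (I < k)%N -> (I' < k)%N -> rho I d = rho I' d' -> I = I' /\ d = d';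
  chain_gam : forall J J' e e', (J <= k)%N -> (J' <= k)%N -> gam J e = gam J' e' -> J = J' /\ e = e';
  chain_al : forall I d, (I < k)%N -> `|al I d| = 1;
  chain_be : forall J e, (J <= k)%N -> `|be J e| = 1;
  chain_val : forall I J d e, (I < k)%N -> (J <= k)%N ->
    W (rho I d) (gam J e) = al I d * be J e * pair_entry 0 0 I J d e;
  chain_row : forall I d c, (I < k)%N -> W (rho I d) c != 0 ->
    exists J e, (J <= k)%N /\ c = gam J e;
  chain_col : forall J e r, (J.+1 < k)%N -> W r (gam J e) != 0 ->
    exists I d, (I < k)%N /\ r = rho I d;
  chain_tw : forall J, (J <= k)%N -> twin W (gam J false) (gam J true) }.

Definition snoc_pair (X : Type) (f : nat -> bool -> X) k (a b : X) : nat -> bool -> X :=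
  fun I d => if I == k then (if d then b else a) else f I d.

Lemma good_start_chain r r' c1 c2 c3 c4 : good_start W r r' c1 c2 c3 c4 ->
  exists rho gam al be, chain 1 rho gam al be.
Proof.
case=> n s s' [t12 t34] [e2 e3 e4].
have [p1 p2 p3 p4] : [/\ W r c1 != 0, W r c2 != 0, W r c3 != 0 & W r c4 != 0].
  by split; apply: (supp_neq0 s); rewrite !inE eqxx ?orbT.
have p1' : W r' c1 != 0 by apply: (supp_neq0 s'); rewrite !inE eqxx ?orbT.
move: (s.1); rewrite /= !inE !negb_or => /and4P[/and3P[n12 n13 n14] /andP[n23 n24] n34 _].
have aux z c : z * W r c1 = W r' c1 * W r c -> z = W r' c1 / W r c1 * W r c.
  by move=> e; rewrite -[LHS](mulfK p1) e; ring.
have {}e2 := aux _ _ e2.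
have {}e3 : W r' c3 = - (W r' c1 / W r c1 * W r c3).
  by apply: oppr_inj; rewrite opprK; apply: aux; rewrite mulNr e3 opprK.
have {}e4 : W r' c4 = - (W r' c1 / W r c1 * W r c4).
  by apply: oppr_inj; rewrite opprK; apply: aux; rewrite mulNr e4 opprK.
exists (fun _ d => if d then r' else r),
  (fun J e => if J == 0%N then (if e then c2 else c1) else (if e then c4 else c3)),
  (fun _ d => if d then W r' c1 / W r c1 else 1),
  (fun J e => if J == 0%N then (if e then W r c2 else W r c1) else (if e then W r c4 else W r c3)).
split.
- case=> [|//] [|//] [] [] _ _ //= e; by rewrite e eqxx in n.
- case=> [|[|//]] [|[|//]] [] [] _ _ //= e; exfalso; move: n12 n13 n14 n23 n24 n34; rewrite e eqxx //.
- by case=> [|//] [] _; rewrite ?normr1 // normrM normfV !(weighing_norm hW) ?divr1.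
- by case=> [|[|//]] [] _ /=; apply: (weighing_norm hW).
- case=> [|//] [|[|//]] [] [] _ _ /=; rewrite /pair_entry /= ?e2 ?e3 ?e4 ?mul1r ?mulr1 ?mulrN1 //;
    by rewrite divfK.
- case=> [|//] d c _ hc; have : c \in [:: c1; c2; c3; c4].
    by case: d hc => /=; rewrite ?(s.2 c) ?(s'.2 c).
  rewrite !inE => /or4P[]/eqP->; by [exists 0%N, false|exists 0%N, true|exists 1%N, false|exists 1%N, true].
- by [].
- by case=> [|[|//]] _ /=.
Qed.

Lemma chain_bound k rho gam al be : chain k rho gam al be -> (k <= #|S|)%N.
Proof.
case=> h _ _ _ _ _ _ _.
have u : uniq [seq rho i false | i <- iota 0 k].
  rewrite map_inj_in_uniq ?iota_uniq // => i i'; rewrite !mem_iota !add0n /= => l l'.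
  by case/(h _ _ _ _ l l').
by rewrite -(size_iota 0 k) -(size_map (rho^~ false)) -(card_uniqP u) max_card.
Qed.

(** * Extending a chain by one pair *)

Section Step.
Variables (K : nat) (rho : nat -> bool -> S) (gam : nat -> bool -> T) (al be : nat -> bool -> C).
Hypothesis (hc : chain K.+1 rho gam al be).

Lemma pair_entry_col I d e : (I < K.+1)%N -> pair_entry 0 0 I K d e != 0 -> I = K.-1.
Proof.
rewrite /pair_entry andbF ltnS => h; case: ifP => [/andP[/eqP-> /eqP->] //|_].
case: (K =P I.+1) => [-> //|_]; case: (I =P K.+1) => [e1|]; last by rewrite eqxx.
by rewrite e1 ltnn in h.
Qed.

Lemma pair_entry_prev d e : pair_entry 0 0 K.-1 K d e = if K == 0%N then 1 else if d then -1 else 1.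
Proof.
rewrite /pair_entry andbF; case: K => [//|k] /=; by rewrite andbF eqxx.
Qed.

Let c := gam K false.
Let c' := gam K true.
(** For [K = 0] the predecessor is again 0, which is the right value: column pair 0 meets row pair 0
    in the diagonal block. *)
Let p0 := rho K.-1 false.
Let p1 := rho K.-1 true.
Let lK : (K.-1 < K.+1)%N. Proof. by rewrite ltnS leq_pred. Qed.
Let ncc' : c != c'.
Proof. by apply/eqP => /(chain_gam hc (leqnSn K) (leqnSn K))[]. Qed.
Let npp : p0 != p1.
Proof. by apply/eqP => /(chain_rho hc lK lK)[]. Qed.
Let al0 I d : (I < K.+1)%N -> al I d != 0.
Proof. by move=> h; rewrite -normr_eq0 (chain_al hc) ?oner_eq0. Qed.
Let be0 J e : (J <= K.+1)%N -> be J e != 0.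
Proof. by move=> h; rewrite -normr_eq0 (chain_be hc) ?oner_eq0. Qed.

(** The entries of [c'] and [c] have the same ratio in [p0] and [p1], so by [sum4_double] they have
    the opposite ratio in the two remaining rows [q], [q']. Then [q'] and [q] have the same ratio at
    [c] and [c'], hence the opposite one at [x] and [y]. *)
Lemma next_rows : exists q q' x y,
  [/\ supp (W^~ c) [:: p0; p1; q; q'], supp (W q) [:: c; c'; x; y],
      supp (W q') [:: c; c'; x; y],
      [/\ W q c' = - (W q c * be K true / be K false), W q' c' = - (W q' c * be K true / be K false),
          W q' x = - (W q' c / W q c * W q x) & W q' y = - (W q' c / W q c * W q y)]
   & forall I d, (I < K.+1)%N -> q <> rho I d /\ q' <> rho I d].
Proof.
have v d e : W (rho K.-1 d) (gam K e) = al K.-1 d * be K e * (if K == 0%N then 1 else if d then -1 else 1).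
  by rewrite (chain_val hc) // pair_entry_prev.
have sgn d : (if K == 0%N then 1 else if d then -1 else 1) != 0 :> C.
  by case: ifP; rewrite ?oner_eq0 ?sgb_neq0.
have v0 d e : W (rho K.-1 d) (gam K e) != 0 by rewrite v !mulf_neq0 ?al0 ?be0.
have [q [q' sc]] := supp2 hWt npp (v0 false false) (v0 true false).
have hq : W q c != 0 by apply: (supp_neq0 sc); rewrite !inE eqxx ?orbT.
have hq' : W q' c != 0 by apply: (supp_neq0 sc); rewrite !inE eqxx ?orbT.
have tw : twin W c c' by apply: (chain_tw hc).
have hq1 : W q c' != 0 by rewrite -tw.
have hq1' : W q' c' != 0 by rewrite -tw.
have [nq nq' nqq] : [/\ (q != p0) && (q != p1), (q' != p0) && (q' != p1) & q != q'].
  move: (sc.1); rewrite /= !inE !negb_or !(eq_sym p0) !(eq_sym p1).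
  by move=> /and4P[/and3P[_ -> ->] /andP[-> ->] -> _].
have notin z : W z c != 0 -> (z != p0) && (z != p1) -> forall I d, (I < K.+1)%N -> z <> rho I d.
  move=> hz nz I d hI e; move: hz nz; rewrite e (chain_val hc) // mulf_eq0 negb_or => /andP[_ h].
  by rewrite (pair_entry_col hI h); case: d {e h} => /andP[]; rewrite ?eqxx.
have e := row_eq hWt sc ncc'; have e' := row_eqV hWt sc ncc'.
have rt d : W (rho K.-1 d) c' / W (rho K.-1 d) c = be K true / be K false.
  by rewrite !v; field; rewrite ?al0 ?be0 ?sgn.
have rt' d : W (rho K.-1 d) c / W (rho K.-1 d) c' = (be K true / be K false)^-1.
  by rewrite !v; field; rewrite ?al0 ?be0 ?sgn.
rewrite !rt in e; rewrite !rt' in e'.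
have t0 : be K true / be K false != 0 by rewrite mulf_neq0 ?invr_eq0 ?be0.
have [|||f f'] := sum4_double t0 _ _ e _.
- by rewrite mulf_neq0 ?invr_eq0.
- by rewrite mulf_neq0 ?invr_eq0.
- by rewrite !invf_div in e' *; exact: e'.
have g : W q c' = - (W q c * be K true / be K false).
  by rewrite -[LHS](divfK hq) f; ring.
have g' : W q' c' = - (W q' c * be K true / be K false).
  by rewrite -[LHS](divfK hq') f'; ring.
have [x [y sq]] := supp2 hW ncc' hq hq1.
have hx : W q x != 0 by apply: (supp_neq0 sq); rewrite !inE eqxx ?orbT.
have hy : W q y != 0 by apply: (supp_neq0 sq); rewrite !inE eqxx ?orbT.
have txy : twin W x y := twin_rest hE sq tw.
have d := row_eq hW sq nqq; have d' := row_eqV hW sq nqq.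
have lam : W q' c' / W q c' = W q' c / W q c.
  by rewrite g g'; field; rewrite hq !be0.
rewrite lam in d.
have lam' : W q c' / W q' c' = (W q' c / W q c)^-1.
  by rewrite -[LHS]invrK invf_div lam.
have lam0 : W q' c / W q c != 0 by rewrite mulf_neq0 ?invr_eq0.
rewrite lam' -[W q c / _]invf_div in d'.
(* Otherwise [q'] would vanish at the twin [y] as well, leaving twice a nonzero ratio equal to 0. *)
have hx' : W q' x != 0.
  apply/eqP => zx; have zy : W q' y = 0 by apply/eqP; rewrite -[_ == 0]negbK -txy zx eqxx.
  move: d; rewrite zx zy !mul0r !addr0 -mulr2n => /eqP; rewrite mulrn_eq0 /=.
  by rewrite (negPf lam0).
have hy' : W q' y != 0 by rewrite -txy.
have [|||h h'] := sum4_double lam0 _ _ d _.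
- by rewrite mulf_neq0 ?invr_eq0.
- by rewrite mulf_neq0 ?invr_eq0.
- by rewrite !invf_div in d' *; exact: d'.
exists q, q', x, y; split=> //.
- by apply: (supp4 hW sq.1).
- by split=> //; [rewrite -[LHS](divfK hx) h; ring | rewrite -[LHS](divfK hy) h'; ring].
- by move=> I d0 hI; split; [apply: notin hq nq _ _ _ | apply: notin hq' nq' _ _ _].
Qed.

(** The columns of [q] lead back to the last column pair of the chain. Comparing [x] and [y] in the
    row pair [K] and in [q], [q'] gives the signs of the corner block. *)
Lemma chain_close q q' x y : W q c != 0 -> W q' c != 0 ->
  supp (W^~ c) [:: p0; p1; q; q'] -> supp (W q) [:: c; c'; x; y] -> supp (W q') [:: c; c'; x; y] ->
  W q c' = - (W q c * be K true / be K false) -> W q' c' = - (W q' c * be K true / be K false) ->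
  W q' x = - (W q' c / W q c * W q x) -> W q' y = - (W q' c / W q c * W q y) ->
  (forall I d, (I < K.+1)%N -> q <> rho I d /\ q' <> rho I d) ->
  x = gam K.+1 false -> y = gam K.+1 true ->
  exists m z, [/\ (1 < m)%N, `|z| = 1 & embeds W (2 * m) (E_entry m z)].
Proof.
move=> hq hq' sc sq sq' f f' h h' nin ex ey.
have hx : W q x != 0 by apply: (supp_neq0 sq); rewrite !inE eqxx ?orbT.
have hy : W q y != 0 by apply: (supp_neq0 sq); rewrite !inE eqxx ?orbT.
have hx' : W q' x != 0 by apply: (supp_neq0 sq'); rewrite !inE eqxx ?orbT.
have lK1 : (K < K.+1)%N := leqnn _.
have v d e : W (rho K d) (gam K.+1 e) = al K d * be K.+1 e * (if d then -1 else 1).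
  rewrite (chain_val hc) // /pair_entry !andbF eqxx //.
have v0 d e : W (rho K d) (gam K.+1 e) != 0 by rewrite v !mulf_neq0 ?al0 ?be0 ?sgb_neq0.
have nqq : q != q' by move: (sc.1); rewrite /= !inE !negb_or => /and4P[_ _ ->].
have nKK : rho K false != rho K true by apply/eqP => /(chain_rho hc lK1 lK1)[].
have sx : supp (W^~ x) [:: rho K false; rho K true; q; q'].
  apply: (supp4 hWt _ _ _ hx hx'); rewrite ?ex ?v0 //= !inE !negb_or nKK nqq /=.
  have [n1 n2] := nin K false lK1; have [n3 n4] := nin K true lK1.
  by rewrite andbT; apply/and3P; split; first apply/andP; try split; apply/eqP => e;
    [apply: n1|apply: n2|apply: n3|apply: n4].
have nxy : x != y by rewrite ex ey; apply/eqP => /(chain_gam hc (leqnn _) (leqnn _))[].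
have e := row_eq hWt sx nxy; have e' := row_eqV hWt sx nxy.
have rt d : W (rho K d) y / W (rho K d) x = be K.+1 true / be K.+1 false.
  by rewrite ex ey !v; field; rewrite ?al0 ?be0 ?sgb_neq0.
have rt' d : W (rho K d) x / W (rho K d) y = (be K.+1 true / be K.+1 false)^-1.
  by rewrite ex ey !v; field; rewrite ?al0 ?be0 ?sgb_neq0.
rewrite !rt in e; rewrite !rt' in e'.
have t0 : be K.+1 true / be K.+1 false != 0 by rewrite mulf_neq0 ?invr_eq0 ?be0.
have hy' : W q' y != 0 by apply: (supp_neq0 sq'); rewrite !inE eqxx ?orbT.
have [|||g _] := sum4_double t0 _ _ e _.
- by rewrite mulf_neq0 ?invr_eq0.
- by rewrite mulf_neq0 ?invr_eq0.
- by rewrite !invf_div in e' *; exact: e'.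
have gy : W q y = - (W q x * be K.+1 true / be K.+1 false).
  by rewrite -[LHS](divfK hx) g; ring.
pose aq := W q c / be K false; pose aq' := W q' c / be K false.
have lK2 : (K <= K.+1)%N := leqnSn K.
have b0 := be0 false lK2; have b1 := be0 true lK2.
have d0 := be0 false (leqnn K.+1); have d1 := be0 true (leqnn K.+1).
have aq0 : aq != 0 by rewrite mulf_neq0 ?invr_eq0.
have naq : `|aq| = 1 by rewrite normrM normfV (chain_be hc) // (weighing_norm hW) // divr1.
have naq' : `|aq'| = 1 by rewrite normrM normfV (chain_be hc) // (weighing_norm hW) // divr1.
(* Row [q] is already scaled by its entry at [c] and column [x] by the chain, so this quotient
   cannot be normalised: it is the parameter of the block. *)
pose z := W q x / (aq * be K.+1 false).
have z1 : `|z| = 1.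
  by rewrite normrM normfV normrM naq (chain_be hc) // (weighing_norm hW) // mulr1 divr1.
exists K.+2, z; split=> //.
pose rho' := snoc_pair rho K.+1 q q'; pose al' := snoc_pair al K.+1 aq aq'.
have hh i : (i < 2 * K.+2)%N = (i./2 <= K.+1)%N by rewrite mul2n -ltn_half_double ltnS.
have hi i j : i./2 = j./2 -> odd i = odd j -> i = j.
  by move=> ei ej; rewrite -(odd_double_half i) -(odd_double_half j) ei ej.
exists (fun i => rho' i./2 (odd i)), (fun j => gam j./2 (odd j)),
  (fun i => al' i./2 (odd i)), (fun j => be j./2 (odd j)).
split.
- move=> i j; rewrite !inE !hh /rho' /snoc_pair => li lj.
  case: eqP => ei; case: eqP => ej; [move=> E | move=> E | move=> E | ].
  + apply: hi; first by rewrite ei ej.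
    by move: E nqq; case: (odd i); case: (odd j) => // ->; rewrite eqxx.
  + have lj' : (j./2 < K.+1)%N by rewrite ltn_neqAle lj andbT; apply/eqP.
    by case: (nin j./2 (odd j) lj'); case: (odd i) E => E n1 n2.
  + have li' : (i./2 < K.+1)%N by rewrite ltn_neqAle li andbT; apply/eqP.
    by case: (nin i./2 (odd i) li'); case: (odd j) E => E n1 n2; case: n1 + case: n2.
  + have lj' : (j./2 < K.+1)%N by rewrite ltn_neqAle lj andbT; apply/eqP.
    have li' : (i./2 < K.+1)%N by rewrite ltn_neqAle li andbT; apply/eqP.
    by move/(chain_rho hc li' lj')=> [? ?]; apply: hi.
- by move=> i j; rewrite !inE !hh => li lj /(chain_gam hc li lj)[? ?]; apply: hi.
- move=> i; rewrite hh => li; split; last exact: (chain_be hc).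
  rewrite /al' /snoc_pair; case: eqP => [_|ei]; first by case: (odd i).
  by apply: (chain_al hc); rewrite ltn_neqAle li andbT; apply/eqP.
- move=> i j; rewrite !hh /E_entry; set d := odd i; set e0 := odd j; move: i./2 j./2 d e0 => I J d e0.
  move=> lI lJ; rewrite /rho' /al' /snoc_pair; case: eqP => [eI|eI]; last first.
    have lI' : (I < K.+1)%N by rewrite ltn_neqAle lI andbT; apply/eqP.
    rewrite (chain_val hc) // /pair_entry !andbF; congr (_ * _); case: ifP => // _.
    by rewrite eqSS (ltn_eqF lI').
  rewrite {}eI {I lI}; case: (ltngtP J K) => [lt|gt|eJ].
  + have -> : pair_entry K.+2 z K.+1 J d e0 = 0.
      rewrite /pair_entry /= !eqxx !eqSS /= (ltn_eqF (leq_trans lt _)) //.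
      by rewrite (ltn_eqF (leq_trans lt _)) ?leqnSn ?(gtn_eqF lt) // leqW.
    (* Column pairs below [K] meet only rows of the chain, so the new rows vanish there. *)
    rewrite mulr0; apply/eqP; apply: contraT => hJ.
    have [I [d2 [lI e2]]] := chain_col hc (J := J) (lt : (J.+1 < K.+1)%N) hJ.
    by case: (nin I d2 lI) => n1 n2; case: d {hJ} e2 => e2; [case: n2|case: n1].
  + have -> : J = K.+1 by apply/eqP; rewrite eqn_leq lJ gt.
    rewrite /pair_entry /= !eqxx /=.
    case: d; case: e0; rewrite -?ex -?ey ?h ?h' ?gy /z /aq /aq' /=; field; by rewrite ?hq ?b0 ?d0.
  + rewrite eJ /pair_entry /= !eqxx eqSS (ltn_eqF (ltnSn K)) (ltn_eqF (leqW (ltnSn K))) /=.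
    by case: d; case: e0; rewrite -/c -/c' ?f ?f' /aq /aq' /=; field; rewrite ?b0.
- move=> i t; rewrite hh => li; rewrite /rho' /snoc_pair.
  have fin J e0 : (J <= K.+1)%N -> t = gam J e0 ->
     exists2 j, (j < 2 * K.+2)%N & t = gam j./2 (odd j).
    move=> lJ ->; exists (e0 + J.*2)%N; last by rewrite half_bit_double oddD odd_double addbF oddb.
    by rewrite hh half_bit_double.
  case: (i./2 =P K.+1) => ei; last first.
    have li' : (i./2 < K.+1)%N by rewrite ltn_neqAle li andbT; apply/eqP.
    by move=> /(chain_row hc li')[J [e0 [lJ ej]]]; apply: (fin J e0).
  have mem : t \in [:: c; c'; x; y] -> exists2 j, (j < 2 * K.+2)%N & t = gam j./2 (odd j).
    by rewrite !inE => /or4P[]/eqP e0; [apply: (fin K false)|apply: (fin K true)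
      |apply: (fin K.+1 false)|apply: (fin K.+1 true)] => //; rewrite e0.
  by case: (odd i) => ht; apply: mem; [rewrite -(sq'.2 t) | rewrite -(sq.2 t)].
Qed.

(** Since [x] and [y] are new columns, their scalars are free to absorb the entries of [q]; no
    parameter arises and the chain grows. *)
Lemma chain_open q q' x y : W q c != 0 -> W q' c != 0 ->
  supp (W^~ c) [:: p0; p1; q; q'] -> supp (W q) [:: c; c'; x; y] -> supp (W q') [:: c; c'; x; y] ->
  W q c' = - (W q c * be K true / be K false) -> W q' c' = - (W q' c * be K true / be K false) ->
  W q' x = - (W q' c / W q c * W q x) -> W q' y = - (W q' c / W q c * W q y) ->
  (forall I d, (I < K.+1)%N -> q <> rho I d /\ q' <> rho I d) ->
  (forall J e, (J <= K.+1)%N -> x <> gam J e /\ y <> gam J e) ->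
  exists rho' gam' al' be', chain K.+2 rho' gam' al' be'.
Proof.
move=> hq hq' sc sq sq' f f' h h' nin njn.
have hx : W q x != 0 by apply: (supp_neq0 sq); rewrite !inE eqxx ?orbT.
have hy : W q y != 0 by apply: (supp_neq0 sq); rewrite !inE eqxx ?orbT.
have nqq : q != q' by move: (sc.1); rewrite /= !inE !negb_or => /and4P[_ _ ->].
have nxy : x != y by move: (sq.1); rewrite /= !inE !negb_or => /and4P[_ _ ->].
have tw : twin W c c' by apply: (chain_tw hc).
pose aq := W q c / be K false; pose aq' := W q' c / be K false.
have lK2 : (K <= K.+1)%N := leqnSn K.
have b0 := be0 false lK2; have b1 := be0 true lK2.
have aq0 : aq != 0 by rewrite mulf_neq0 ?invr_eq0.
have naq : `|aq| = 1 by rewrite normrM normfV (chain_be hc) // (weighing_norm hW) // divr1.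
have naq' : `|aq'| = 1 by rewrite normrM normfV (chain_be hc) // (weighing_norm hW) // divr1.
exists (snoc_pair rho K.+1 q q'), (snoc_pair gam K.+2 x y), (snoc_pair al K.+1 aq aq'),
  (snoc_pair be K.+2 (W q x / aq) (W q y / aq)).
have lt1 I : (I < K.+2)%N -> I <> K.+1 -> (I < K.+1)%N.
  by move=> l /eqP n; rewrite ltn_neqAle n -ltnS.
have lt2 J : (J <= K.+2)%N -> J <> K.+2 -> (J <= K.+1)%N.
  by move=> l /eqP n; rewrite -ltnS ltn_neqAle n.
split; rewrite /snoc_pair.
- move=> I I' d d' lI lI'; case: (I =P _) => eI; case: (I' =P _) => eI'.
  + by move=> E; split; [rewrite eI eI'|]; move: E nqq; case: d; case: d' => // ->; rewrite eqxx.
  + by case: (nin I' d' (lt1 _ lI' eI')); case: d => n1 n2 E.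
  + by case: (nin I d (lt1 _ lI eI)); case: d' => n1 n2 E; [case: n2|case: n1].
  + exact: (chain_rho hc (lt1 _ lI eI) (lt1 _ lI' eI')).
- move=> I I' d d' lI lI'; case: (I =P _) => eI; case: (I' =P _) => eI'.
  + by move=> E; split; [rewrite eI eI'|]; move: E nxy; case: d; case: d' => // ->; rewrite eqxx.
  + by case: (njn I' d' (lt2 _ lI' eI')); case: d => n1 n2 E.
  + by case: (njn I d (lt2 _ lI eI)); case: d' => n1 n2 E; [case: n2|case: n1].
  + exact: (chain_gam hc (lt2 _ lI eI) (lt2 _ lI' eI')).
- move=> I d lI; case: (I =P _) => eI; first by case: d.
  exact: (chain_al hc _ (lt1 _ lI eI)).
- move=> J e lJ; case: (J =P _) => eJ; last exact: (chain_be hc _ (lt2 _ lJ eJ)).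
  by case: e; rewrite normrM normfV naq (weighing_norm hW) // divr1.
- move=> I J d e lI lJ; case: (I =P _) => eI; case: (J =P _) => eJ.
  + rewrite eI eJ /pair_entry /= !eqxx.
    by case: d; case: e; rewrite ?h ?h' /aq /aq'; field; rewrite ?hq ?b0.
  + rewrite eI; have lJ' := lt2 _ lJ eJ; case: (ltngtP J K) => [lt|gt|eJ'].
    * have -> : pair_entry 0 0 K.+1 J d e = 0.
        by rewrite /pair_entry /= !eqSS (gtn_eqF lt) (ltn_eqF (leq_trans lt (leqW (leqnSn _)))).
      rewrite mulr0; apply/eqP; apply: contraT => hJ.
      have [I0 [d2 [lI0 e2]]] := chain_col hc (J := J) (lt : (J.+1 < K.+1)%N) hJ.
      by case: (nin I0 d2 lI0) => n1 n2; case: d {hJ} e2 => e2; [case: n2|case: n1].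
    * have -> : J = K.+1 by apply/eqP; rewrite eqn_leq lJ' gt.
      have -> : pair_entry 0 0 K.+1 K.+1 d e = 0.
        by rewrite /pair_entry /= (ltn_eqF (ltnSn _)).
      rewrite mulr0; have ng : gam K.+1 e \notin [:: c; c'; x; y].
        rewrite !inE !negb_or; have [n1 n2] := njn K.+1 e (leqnn _).
        apply/and4P; split; apply/eqP => E; [| |by case: n1|by case: n2].
          by case: (chain_gam hc (leqnn _) lK2 E) => /eqP; rewrite (gtn_eqF (ltnSn _)).
        by case: (chain_gam hc (leqnn _) lK2 E) => /eqP; rewrite (gtn_eqF (ltnSn _)).
      by case: d; [apply: (supp_eq0 sq')|apply: (supp_eq0 sq)].
    * rewrite eJ' /pair_entry /= !eqxx (ltn_eqF (leqW (ltnSn K))) /=.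
      by case: d; case: e; rewrite -/c -/c' ?f ?f' /aq /aq' /=; field; rewrite ?b0.
  + have lI' := lt1 _ lI eI; have -> : pair_entry 0 0 I J d e = 0.
      rewrite eJ /pair_entry /= andbF eqSS (gtn_eqF lI').
      by rewrite (ltn_eqF (leq_trans lI' (leqW (leqnSn _)))).
    rewrite mulr0; apply/eqP; apply: contraT => /(chain_row hc lI')[J' [e' [lJ' E]]].
    by case: (njn J' e' lJ') => n1 n2; case: e E => E; [case: n2|case: n1].
  + exact: (chain_val hc _ _ (lt1 _ lI eI) (lt2 _ lJ eJ)).
- have old J e : (J <= K.+1)%N -> exists J' e', (J' <= K.+2)%N /\
      gam J e = (if J' == K.+2 then if e' then y else x else gam J' e').
    by move=> l; exists J, e; rewrite leqW // (ltn_eqF (l : (J < K.+2)%N)).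
  have mem t : t \in [:: c; c'; x; y] -> exists J' e', (J' <= K.+2)%N /\
      t = (if J' == K.+2 then if e' then y else x else gam J' e').
    rewrite !inE => /or4P[]/eqP->; [exact: old | exact: old | exists K.+2, false | exists K.+2, true];
    by rewrite eqxx.
  move=> I d t lI; case: (I =P _) => eI; last first.
    by move=> /(chain_row hc (lt1 _ lI eI))[J [e [l ->]]]; apply: old.
  by case: d => ht; apply: mem; [rewrite -(sq'.2 t) | rewrite -(sq.2 t)].
(* Column pair [K] is now closed: its four rows are [p0], [p1], [q], [q']. *)
- move=> J e r lJ; have lJ1 : (J < K.+1)%N := lJ.
  rewrite (ltn_eqF (leqW lJ1)).
  have old I d : (I < K.+1)%N -> exists I' d', (I' < K.+2)%N /\
      rho I d = (if I' == K.+1 then if d' then q' else q else rho I' d').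
    by move=> l; exists I, d; rewrite leqW // (ltn_eqF l).
  case: (ltngtP J K) => [lt|gt|eJ].
  + by move=> /(chain_col hc (lt : (J.+1 < K.+1)%N))[I [d [l ->]]]; apply: old.
  + by move: lJ1; rewrite ltnS leqNgt gt.
  + rewrite eJ => hr; have : r \in [:: p0; p1; q; q'].
      by rewrite -(sc.2 r); case: e hr => // hr; rewrite tw.
    rewrite !inE => /or4P[]/eqP->; [exact: old | exact: old | exists K.+1, false | exists K.+1, true];
    by rewrite eqxx.
- move=> J lJ; case: (J =P _) => eJ; last exact: (chain_tw hc (lt2 _ lJ eJ)).
  exact: (twin_rest hE sq tw).
Qed.

(** Twinness makes [x] and [y] either both new or together the column pair [K.+1], in one of the two
    orders. *)
Lemma chain_step :
  (exists m z, [/\ (1 < m)%N, `|z| = 1 & embeds W (2 * m) (E_entry m z)]) \/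
  (exists rho' gam' al' be', chain K.+2 rho' gam' al' be').
Proof.
have [q [q' [x [y [sc sq sq' [f f' h h'] nin]]]]] := next_rows.
have hq : W q c != 0 by apply: (supp_neq0 sc); rewrite !inE eqxx ?orbT.
have hq' : W q' c != 0 by apply: (supp_neq0 sc); rewrite !inE eqxx ?orbT.
have lK2 : (K <= K.+1)%N := leqnSn K.
have uq := sq.1; move: (uq); rewrite /= !inE !negb_or.
move=> /and4P[/and3P[_ ncx ncy] /andP[nc'x nc'y] nxy _].
have tw : twin W (gam K.+1 false) (gam K.+1 true) by apply: (chain_tw hc).
(* Column pairs below [K] are closed to the new rows, and pair [K] consists of [c] and [c'], which
   differ from [x] and [y]. *)
have low J e t : (J < K.+1)%N -> t \in [:: x; y] -> t <> gam J e.
  move=> lJ ht E; have [ht1 ht2] : W q t != 0 /\ (t != c) && (t != c').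
    rewrite (sq.2 t) !inE; move: ht; rewrite !inE.
    by case/orP=> /eqP->; rewrite !eqxx ?orbT !(eq_sym _ c) !(eq_sym _ c') ?ncx ?ncy.
  case: (ltngtP J K) => [lt|gt|eJ].
  - move: ht1; rewrite E => /(chain_col hc (lt : (J.+1 < K.+1)%N))[I [d [lI E']]].
    by case: (nin I d lI).
  - by move: lJ; rewrite ltnS leqNgt gt.
  - by move: ht2; rewrite E eJ -/c -/c'; case: e {E} => /=; rewrite eqxx ?andbF.
have other t t' e : perm_eq [:: t; t'] [:: x; y] -> t = gam K.+1 e -> t' = gam K.+1 (~~ e).
  move=> p E; have mt : t \in [:: x; y] by rewrite -(perm_mem p) mem_head.
  have : W q (gam K.+1 (~~ e)) != 0.
    have : W q t != 0 by rewrite (sq.2 t) (mem_cat t [:: c; c'] [:: x; y]) mt orbT.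
    by rewrite E; case: e {E} => /=; rewrite tw.
  rewrite sq.2 (mem_cat _ [:: c; c'] [:: x; y]) -(perm_mem p) !inE => /orP[/orP[]/eqP e1|/orP[]/eqP e1].
  - by case: (chain_gam hc (leqnn _) lK2 e1) => /eqP; rewrite (gtn_eqF (ltnSn _)).
  - by case: (chain_gam hc (leqnn _) lK2 e1) => /eqP; rewrite (gtn_eqF (ltnSn _)).
  - by move: e1; rewrite E => /(chain_gam hc (leqnn _) (leqnn _))[_]; case: (e).
  - by [].
have pxy : perm_eq [:: x; y] [:: x; y] := perm_refl _.
have pyx : perm_eq [:: y; x] [:: x; y] by rewrite (perm_catC [:: y] [:: x]).
have swap (v : T -> C) : supp v [:: c; c'; x; y] -> supp v [:: c; c'; y; x].
  by apply: supp_perm; rewrite !perm_cons perm_sym.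
case: (x =P gam K.+1 false) => [e1|n1].
  left; exact: (chain_close hq hq' sc sq sq' f f' h h' nin e1 (other _ _ _ pxy e1)).
case: (x =P gam K.+1 true) => [e1|n2].
  have e2 : y = gam K.+1 false := other _ _ _ pxy e1.
  left; exact: (chain_close hq hq' sc (swap _ sq) (swap _ sq') f f' h' h nin e2 e1).
right; apply: (chain_open hq hq' sc sq sq' f f' h h' nin) => J e lJ.
have [eJ|lt] := eqVneq J K.+1; last first.
  have lt' : (J < K.+1)%N by rewrite ltn_neqAle lt.
  by split; apply: low; rewrite ?inE ?eqxx ?orbT.
rewrite eJ; split=> E.
  by case: e E.
by have := other _ _ _ pyx E; case: e E.
Qed.

End Step.

(** Growing a chain uses up new rows each time, so within the bound [#|S|] it has to close. *)
Lemma chain_embeds k rho gam al be : (0 < k)%N -> chain k rho gam al be ->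
  exists m z, [/\ (1 < m)%N, `|z| = 1 & embeds W (2 * m) (E_entry m z)].
Proof.
move=> k0; have [n] := ubnP (#|S| - k)%N; elim: n k k0 rho gam al be => // n IH [//|K] _ rho gam al be hn hc.
have [//|[rho' [gam' [al' [be' hc']]]]] := chain_step hc.
apply: (IH K.+2 _ rho' gam' al' be') => //.
have := chain_bound hc'; rewrite ltnS in hn => l.
by apply: leq_trans hn; rewrite ltn_sub2l.
Qed.

Lemma twin_embeds c c' : c != c' -> (forall r, W r c != 0 -> W r c' != 0) ->
  exists m z, [/\ (1 < m)%N, `|z| = 1 & embeds W (2 * m) (E_entry m z)].
Proof.
move=> n /(twin_sub hW) tw; have [r [r' [d1 [d2 [d3 [d4 g]]]]]] := twin_start hW hE hEt n tw.
by have [rho [gam [al [be hc]]]] := good_start_chain g; apply: chain_embeds hc.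
Qed.

End ChainGrowth.

Theorem weighing_embeds (C : numClosedFieldType) (a b : C) (S T : finType) (W : S -> T -> C) (r : S) :
  a * b = 1 -> 1 + a + b = 0 -> weighing W ->
  [\/ embeds W 5 (entry (W5_of a b)), embeds W 6 (entry (W6_of a b)),
      embeds W 7 (entry (W7_of C)) | embeds W 8 (entry (W8_of C))]
  \/ exists m z, [/\ (1 < m)%N, `|z| = 1 & embeds W (2 * m) (E_entry m z)].
Proof.
move=> ab sab hW; have hWt := weighing_tr hW.
have [[h|h]|hE] := overlap3_or_even ab sab hW; [by left; constructor 1|by left; constructor 2|].
have [h|hEt] := overlap3_or_even ab sab hWt.
  left; case: h => h; [constructor 1|constructor 2]; apply: (embeds_tr hW) h.
    by case=> [|[|[|[|[|//]]]]] [|[|[|[|[|//]]]]].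
  by case=> [|[|[|[|[|[|//]]]]]] [|[|[|[|[|[|//]]]]]].
have [/existsP[c /existsP[c' /andP[n /forallP h]]]|h] := boolP
    [exists c, exists c', (c != c') && [forall r, (W r c != 0) ==> (W r c' != 0)]].
  by right; apply: (twin_embeds hW hE hEt n) => r'; apply/implyP.
have nt c c' : c != c' -> ~ (forall r, W r c != 0 -> W r c' != 0).
  move=> n al; case/negP: h; apply/existsP; exists c; apply/existsP; exists c'.
  by rewrite n; apply/forallP => r'; apply/implyP/al.
have [R2 C2] := no_twins_meet2 hW hE hEt nt.
by left; case: (meet2_embeds hW R2 C2 r) => h'; [constructor 3|constructor 4].
Qed.

(** * Splitting off blocks *)

Section Decompose.
Variables (C : numClosedFieldType) (a b : C).
Hypotheses (ab : a * b = 1) (sab : 1 + a + b = 0).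

(* inl i stands for W_(5+i) and inr m for E_(2m). *)
Definition kind := ('I_4 + nat)%type.
Definition kind_size (t : kind) : nat := match t with inl i => (5 + i)%N | inr m => (2 * m)%N end.
Definition kind_entry (t : kind) (x : C) : nat -> nat -> C :=
  match t with
  | inl i => entry (nth [::] [:: W5_of a b; W6_of a b; W7_of C; W8_of C] i)
  | inr m => E_entry m x
  end.
Definition kind_ok (t : kind) : bool := if t is inr m then (1 < m)%N else true.

Definition kind0 : kind * C := (inr 0%N, 0).

Definition valid_label (L : seq (kind * C)) (p : nat * nat) :=
  (p.1 < size L)%N && (p.2 < kind_size (nth kind0 L p.1).1)%N.

Lemma embeds_kind (S T : finType) (W : S -> T -> C) (r : S) : weighing W ->
  exists t z, [/\ kind_ok t, `|z| = 1 & embeds W (kind_size t) (kind_entry t z)].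
Proof.
move=> hW; case: (weighing_embeds r ab sab hW) => [h|[m [z [hm hz h]]]]; last by exists (inr m), z.
have n1 : `|1| = 1 :> C := normr1 _.
case: h => h; [exists (inl (@Ordinal 4 0 isT)), 1 | exists (inl (@Ordinal 4 1 isT)), 1
  | exists (inl (@Ordinal 4 2 isT)), 1 | exists (inl (@Ordinal 4 3 isT)), 1]; by split.
Qed.

(* The label (i, q) stands for position q of the i-th block of L. *)
Definition decomposed (S T : finType) (W : S -> T -> C) : Prop :=
  exists (L : seq (kind * C)) (bS : S -> nat * nat) (bT : T -> nat * nat)
    (al : S -> C) (be : T -> C),
  [/\ all (fun p => kind_ok p.1 && (`|p.2| == 1)) L,
      (\sum_(p <- L) kind_size p.1 = #|S|)%N,
      [/\ injective bS, injective bT, (forall r, valid_label L (bS r)) & forall c, valid_label L (bT c)],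
      (forall r, `|al r| = 1) /\ (forall c, `|be c| = 1)
    & forall r c, W r c = al r * be c * (if (bS r).1 == (bT c).1 then
        kind_entry (nth kind0 L (bS r).1).1 (nth kind0 L (bS r).1).2 (bS r).2 (bT c).2
        else 0)].

(* The new block, whose rows or columns are listed in xs, becomes block 0. *)
Definition push (X : finType) (A : {pred X}) (xs : seq X) (l : {x | x \in A} -> nat * nat)
  (x : X) : nat * nat :=
  if insub x is Some u then ((l u).1.+1, (l u).2) else (0%N, index x xs).

Lemma push_inj (X : finType) (A : {pred X}) (xs : seq X) l :
  injective l -> (forall x, (x \in A) = (x \notin xs)) -> injective (@push X A xs l).
Proof.
move=> il hA x y; rewrite /push; case: insubP => [u _ <-|hx]; case: insubP => [v _ <-|hy] //.
  by case=> e1 e2; congr val; apply: il; rewrite (surjective_pairing (l u)) e1 e2 -surjective_pairing.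
case=> e; move: hx hy; rewrite !hA !negbK => hx hy.
by rewrite -(nth_index x hx) -(nth_index x hy) e.
Qed.

Lemma push_valid (X : finType) (A : {pred X}) (xs : seq X) l t z L :
  (forall u, valid_label L (l u)) -> (forall x, (x \in A) = (x \notin xs)) ->
  size xs = kind_size t -> forall x, valid_label ((t, z) :: L) (@push X A xs l x).
Proof.
move=> hv hA hs x; rewrite /push; case: insubP => [u _ _|hx]; first exact: hv.
by rewrite /valid_label /= -hs index_mem; move: hx; rewrite hA negbK.
Qed.

Lemma weighing_decomposed (S T : finType) (W : S -> T -> C) : weighing W -> decomposed W.
Proof.
have [n] := ubnP #|S|; elim: n S T W => // n IH S T W hn hW.
have [r _|S0] := pickP S; last first.
  (* Without rows there are no columns either, a column having weight four. *)
  have T0 (c : T) : False.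
    case: hW => _ _ /(_ c c); rewrite eqxx mul1r big1 => [/eqP|r _]; last by have := S0 r.
    by rewrite eq_sym pnatr_eq0.
  exists [::], (fun _ => (0, 0)%N), (fun _ => (0, 0)%N), (fun _ => 1), (fun _ => 1).
  split=> //.
  - by rewrite big_nil; apply/esym/eq_card0.
  - by split=> [r|c|r|c]; [have := S0 r|case: (T0 c)|have := S0 r|case: (T0 c)].
  - by split=> ?; rewrite normr1.
have [t [z [ht hz [f [g [al [be [fI gI hn1 hv hs]]]]]]]] := embeds_kind r hW.
set k := kind_size t in fI gI hn1 hv hs.
have hcol := embeds_cols hW fI gI hs.
pose F := [seq f i | i <- iota 0 k]; pose G := [seq g i | i <- iota 0 k].
have uF : uniq F.
  rewrite map_inj_in_uniq ?iota_uniq // => i j; rewrite !mem_iota !add0n; exact: fI.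
have uG : uniq G.
  rewrite map_inj_in_uniq ?iota_uniq // => i j; rewrite !mem_iota !add0n; exact: gI.
have sF : size F = k by rewrite size_map size_iota.
have sG : size G = k by rewrite size_map size_iota.
have inF x : x \in F -> exists2 i, (i < k)%N & x = f i.
  by case/mapP=> i; rewrite mem_iota => hi ->; exists i.
have inG x : x \in G -> exists2 i, (i < k)%N & x = g i.
  by case/mapP=> i; rewrite mem_iota => hi ->; exists i.
have fF i : (i < k)%N -> f i \in F by move=> hi; apply: map_f; rewrite mem_iota.
have gG i : (i < k)%N -> g i \in G by move=> hi; apply: map_f; rewrite mem_iota.
have z1 x c : x \in F -> c \notin G -> W x c = 0.
  move=> /inF[i hi ->] hc; apply/eqP; apply: contraNT hc => /(hs i c hi)[j hj ->]; exact: gG.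
have z2 x c : x \notin F -> c \in G -> W x c = 0.
  move=> hx /inG[j hj ->]; apply/eqP; apply: contraNT hx => /(hcol j x hj)[i hi ->]; exact: fF.
pose A : {pred S} := [pred x | x \notin F]; pose B : {pred T} := [pred x | x \notin G].
have hA x : (x \in A) = (x \notin F) by [].
have hB x : (x \in B) = (x \notin G) by [].
(* Entries joining the block to the rest are 0 by [z1] and [z2], so restricting the inner products
   to the remaining rows and columns does not change them. *)
pose W0 (x : {x | x \in A}) (c : {c | c \in B}) := W (val x) (val c).
have hW0 : weighing W0.
  case: hW => h1 h2 h3; split=> [x c|x x'|c c']; first exact: h1.
  - rewrite /W0 -(big_sub B (fun c => W (val x) c / W (val x') c)) -val_eqE -h2.
    rewrite [RHS](bigID (fun c => c \in B)) /= [X in _ + X]big1 ?addr0 // => c.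
    by rewrite negbK => hc; rewrite z2 ?mul0r //; apply: (valP x).
  - rewrite /W0 -(big_sub A (fun x => W x (val c) / W x (val c'))) -val_eqE -h3.
    rewrite [RHS](bigID (fun x => x \in A)) /= [X in _ + X]big1 ?addr0 // => x.
    by rewrite negbK => hx; rewrite z1 ?mul0r //; apply: (valP c).
have cS : (k + #|{: {x | x \in A}}| = #|S|)%N.
  by rewrite card_sig -sF -(card_uniqP uF) -(cardC (mem F)).
have k0 : (0 < k)%N by rewrite /k; case: (t) ht => [i|m] //= hm; rewrite muln_gt0 /= (ltnW hm).
have [|L [bS [bT [al0 [be0 [hL hsum [i1 i2 i3 i4] [na nb] hW0v]]]]]] := IH _ _ W0 _ hW0.
  by rewrite -ltnS; apply: leq_trans hn; rewrite ltnS -cS -[X in (X < _)%N]add0n ltn_add2r.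
exists ((t, z) :: L), (push F bS), (push G bT),
  (fun x => if insub x is Some u then al0 u else al (index x F)),
  (fun c => if insub c is Some u then be0 u else be (index c G)).
split.
- by rewrite /= ht hz eqxx.
- by rewrite big_cons hsum.
- by split; [apply: push_inj|apply: push_inj|apply: push_valid|apply: push_valid].
- split=> x; case: insubP => [u _ _|]; rewrite ?na ?nb ?hA ?hB // negbK.
    by rewrite -index_mem sF => /hn1[].
  by rewrite -index_mem sG => /hn1[].
- move=> x c; rewrite /push; case: insubP => [u _ eu|hx]; case: insubP => [v _ ev|hc'] /=.
  + by rewrite eqSS -eu -ev; apply: hW0v.
  + by rewrite mulr0 -eu; apply: z2; [apply: (valP u)|rewrite hB negbK in hc'].
  + by rewrite mulr0 -ev; apply: z1; [rewrite hA negbK in hx|apply: (valP v)].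
  + rewrite hA negbK in hx; rewrite hB negbK in hc'.
    rewrite -hv -?sF ?index_mem //; last by rewrite sF -sG index_mem.
    have e1 : f (index x F) = x.
      have l : (index x F < size (iota 0 k))%N by rewrite size_iota -sF index_mem.
      by rewrite -[RHS](nth_index x hx) (nth_map 0%N) // nth_iota //; rewrite size_iota in l.
    have e2 : g (index c G) = c.
      have l : (index c G < size (iota 0 k))%N by rewrite size_iota -sG index_mem.
      by rewrite -[RHS](nth_index c hc') (nth_map 0%N) // nth_iota //; rewrite size_iota in l.
    by rewrite e1 e2.
Qed.

End Decompose.

(** * Matrices over the complex numbers *)

Require Import Defs.
Import Order.TTheory GRing.Theory Num.Theory.
Local Open Scope ring_scope.
Local Open Scope sesquilinear_scope.

Section Omega.
Variable R : realType.

(** With c the cosine of t = 2 pi / 3, the equation cos 3t = 1 becomes (c - 1)(2c + 1)^2 = 0, and c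
    < 1. *)
Lemma cos_2pi3 : cos (2 * pi / 3) = - (1 / 2) :> R.
Proof.
set t : R := 2 * pi / 3; set c := cos t.
have pi0 := pi_gt0 R.
have e : t + t *+ 2 = pi *+ 2 by rewrite /t; field.
have := cos2pi R; rewrite -e cosD cos_mulr2n sin_mulr2n => h.
have c1 : c < 1.
  rewrite /c -(cos0 R) ltr_cos // ?in_itv /= ?lexx ?pi_ge0 //; rewrite /t; first by lra.
  by apply/andP; split; lra.
have s2 := cos2Dsin2 t; rewrite -/c in h s2.
have : (c - 1) * (2 * c + 1) ^+ 2 = 0.
  move: h s2; set s := sin t => h s2.
  have -> : (c - 1) * (2 * c + 1) ^+ 2 =
    (c * (c ^+ 2 *+ 2 - 1) - s * ((c * s) *+ 2) - 1) + 2 * c * (c ^+ 2 + s ^+ 2 - 1) by ring.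
  by rewrite h s2; ring.
move/eqP; rewrite mulf_eq0 subr_eq0 (lt_eqF c1) /= sqrf_eq0 => /eqP h2; lra.
Qed.

Lemma omega_conj : omega R * (omega R)^* = 1.
Proof.
rewrite /omega; apply/eqP; rewrite eq_complex /=; apply/andP; split; apply/eqP.
  by rewrite -[RHS](cos2Dsin2 (2 * pi / 3 : R)); ring.
by ring.
Qed.

Lemma omega_sum : 1 + omega R + (omega R)^* = 0.
Proof.
rewrite /omega; apply/eqP; rewrite eq_complex /=; apply/andP; split; apply/eqP.
  by rewrite cos_2pi3; field.
by ring.
Qed.
End Omega.

Section Bridge.
Variable R : realType.
Local Notation C := R[i].

Lemma invC_unimodular (z : C) : z = 0 \/ `|z| = 1 -> z^* = z^-1.
Proof.
case=> [->|h]; first by rewrite conjC0 invr0.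
by rewrite invC_norm h expr1n invr1 mul1r.
Qed.

(** Orthogonality of columns is not part of [is_UW]; it holds because a one-sided inverse of a
    square matrix is two-sided. *)
Lemma is_UW_weighing n (W : 'M[C]_n) : is_UW 4 W -> weighing (fun i j => W i j).
Proof.
case=> h1 h2; have h0 r c : W r c = 0 \/ `|W r c| = 1 by case: (h1 r c); [right|left].
have h3 : W^t* *m W = 4%:M.
  have n4 : 4 != 0 :> C by rewrite pnatr_eq0.
  have e : W *m (4^-1 *: W^t*) = 1%:M.
    by rewrite -scalemxAr h2 scale_scalar_mx mulVf.
  have := mulmx1C e; rewrite -scalemxAl => /(congr1 (fun M => 4 *: M)).
  by rewrite scalerA divff // scale1r => ->; rewrite scale_scalar_mx mulr1.
split=> // [r r'|c c'].
  have /matrixP/(_ r r') := h2; rewrite !mxE => e.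
  transitivity (\sum_j W r j * (W^t*) j r').
    by apply: eq_bigr => j _; rewrite !mxE invC_unimodular.
  by rewrite e; case: (r == r'); rewrite ?mul1r ?mul0r.
have /matrixP/(_ c' c) := h3; rewrite !mxE => e.
transitivity (\sum_j (W^t*) c' j * W j c).
  by apply: eq_bigr => j _; rewrite !mxE invC_unimodular // mulrC.
by rewrite e eq_sym; case: (c == c'); rewrite ?mul1r ?mul0r.
Qed.

Lemma scale_rows_equiv n (A : 'M[C]_n) (al : 'I_n -> C) : (forall i, `|al i| = 1) ->
  uw_equiv A (\matrix_(i, j) (al i * A i j)).
Proof.
move=> ha; suff H : forall s : seq 'I_n, uniq s ->
    uw_equiv A (\matrix_(i, j) ((if i \in s then al i else 1) * A i j)).
  have := H _ (enum_uniq 'I_n); congr (uw_equiv _ _).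
  by apply/matrixP => i j; rewrite !mxE mem_enum.
elim=> [|k s IH] /=.
  move=> _; rewrite (_ : (\matrix_(i, j) _) = A); first exact: rt_refl.
  by apply/matrixP => i j; rewrite mxE mul1r.
case/andP=> hk us; apply: (rt_trans _ _ _ _ _ (IH us)); apply: rt_step.
have := RowScale (\matrix_(i, j) ((if i \in s then al i else 1) * A i j)) k (ha k).
congr (uw_step _ _); apply/matrixP => i j; rewrite !mxE inE.
by case: eqP => [->|//]; rewrite (negPf hk) mul1r.
Qed.

Lemma scale_cols_equiv n (A : 'M[C]_n) (be : 'I_n -> C) : (forall i, `|be i| = 1) ->
  uw_equiv A (\matrix_(i, j) (be j * A i j)).
Proof.
move=> hb; suff H : forall s : seq 'I_n, uniq s ->
    uw_equiv A (\matrix_(i, j) ((if j \in s then be j else 1) * A i j)).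
  have := H _ (enum_uniq 'I_n); congr (uw_equiv _ _).
  by apply/matrixP => i j; rewrite !mxE mem_enum.
elim=> [|k s IH] /=.
  move=> _; rewrite (_ : (\matrix_(i, j) _) = A); first exact: rt_refl.
  by apply/matrixP => i j; rewrite mxE mul1r.
case/andP=> hk us; apply: (rt_trans _ _ _ _ _ (IH us)); apply: rt_step.
have := ColScale (\matrix_(i, j) ((if j \in s then be j else 1) * A i j)) k (hb k).
congr (uw_step _ _); apply/matrixP => i j; rewrite !mxE inE.
by case: eqP => [->|//]; rewrite (negPf hk) mul1r.
Qed.

(** First scale away [al] and [be], then permute. On ['I_n] injectivity already makes [f] and [g]
    permutations. *)
Lemma relabel_equiv n (W V : 'M[C]_n) (f g : 'I_n -> 'I_n) (al be : 'I_n -> C) :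
  injective f -> injective g -> (forall i, `|al i| = 1) -> (forall j, `|be j| = 1) ->
  (forall i j, W i j = al i * be j * V (f i) (g j)) -> uw_equiv W V.
Proof.
move=> fI gI ha hb hV.
pose s := perm fI; pose t := perm gI.
have na i : al i != 0 by rewrite -normr_eq0 ha oner_eq0.
have nb i : be i != 0 by rewrite -normr_eq0 hb oner_eq0.
have ha' i : `|(al i)^-1| = 1 by rewrite normfV ha invr1.
have hb' i : `|(be i)^-1| = 1 by rewrite normfV hb invr1.
have h1 := scale_rows_equiv W ha'; have h2 := scale_cols_equiv (\matrix_(i, j) ((al i)^-1 * W i j)) hb'.
apply: (rt_trans _ _ _ _ _ h1); apply: (rt_trans _ _ _ _ _ h2).
set A := (\matrix_(i, j) _).
apply: (rt_trans _ _ _ (row_perm s^-1 A)); first by apply: rt_step; constructor.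
apply: rt_step; have := ColPerm (row_perm s^-1 A) t^-1%g.
congr (uw_step _ _); apply/matrixP => i j; rewrite !mxE hV.
have -> : f (s^-1%g i) = i by rewrite -[f _](permE fI) permKV.
have -> : g (t^-1%g j) = j by rewrite -[g _](permE gI) permKV.
by rewrite -mulrA !mulKf.
Qed.

(** Reading the blocks through [ent], on plain natural numbers, avoids comparing matrices of
    dependent sizes. *)
Lemma mxdiag_Rank k (p : 'I_k -> nat) (B : forall i, 'M[C]_(p i)) (ent : 'I_k -> nat -> nat -> C) :
  (forall i x y, B i x y = ent i x y) ->
  forall i (x : 'I_(p i)) j (y : 'I_(p j)),
  (\mxdiag_(i < k) B i) (tagnat.Rank i x) (tagnat.Rank j y) = if i == j then ent i x y else 0.
Proof.
move=> hB i x j y; transitivity (submxblock (\mxdiag_(i < k) B i) i j x y); first by rewrite !mxE.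
rewrite /mxdiag mxblockK; case: eqVneq y => [<- y|_ y]; last by rewrite mxE.
by rewrite conform_mx_id hB.
Qed.

Local Notation a := (omega R).
Local Notation b := ((omega R)^*).

Lemma E_mxE m (x : C) i j : E_mx m x i j = E_entry m x i j.
Proof.
rewrite mxE /E_entry /pair_entry /E_block !divn2 !modn2.
by case: (odd i); case: (odd j); do ![case: ifP => _ //=].
Qed.

Lemma block_kind n (t : kind) : (4 <= n)%N -> kind_ok t -> (kind_size t <= n)%N ->
  exists s : summand n, summand_size s = kind_size t /\
    forall x i j, block s x i j = kind_entry a b t x i j.
Proof.
move=> hn; case: t => [i _ _|m hm /= hs].
  by exists (inl i); split=> // x p q; rewrite mxE.
have l : (m < (n./2).+1)%N by rewrite ltnS -(doubleK m) half_leq // -mul2n.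
by exists (inr (exist _ (Ordinal l) hm)); split=> // x p q; rewrite /= E_mxE.
Qed.

Lemma summand_size_gt0 n (s : summand n) : (0 < summand_size s)%N.
Proof. by case: s => [i|[m hm]] //=; rewrite muln_gt0 /= (ltnW hm). Qed.

Lemma sum_summands n k (s : 'I_k -> summand n) :
  (\sum_(t : summand n) #|[set i | s i == t]| * summand_size t = \sum_(i < k) summand_size (s i))%N.
Proof.
rewrite [RHS](partition_big s xpredT) //=; apply: eq_bigr => t _.
rewrite (eq_bigr (fun _ => summand_size t)) => [|i /eqP-> //].
by rewrite sum_nat_const; congr (_ * _)%N; apply: eq_card => i; rewrite inE.
Qed.

Lemma UW_block_sum n (W : 'M[C]_n) : (4 <= n)%N -> is_UW 4 W ->
  exists (d : {ffun summand n -> 'I_n.+1}) (V : 'M[C]_n),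
    [/\ is_decomposition d, is_block_sum d V & uw_equiv W V].
Proof.
move=> hn /is_UW_weighing hW.
have [L [bS [bT [al [be [hL hsum [i1 i2 v1 v2] [na nb] hv]]]]]] :=
  weighing_decomposed (omega_conj R) (omega_sum R) hW.
pose k := size L; pose p (i : 'I_k) := nth (kind0 C) L i.
have hp (i : 'I_k) : kind_ok (p i).1 && (`|(p i).2| == 1) by apply: (allP hL); apply: mem_nth.
have sumk : (\sum_(i < k) kind_size (p i).1 = n)%N.
  by rewrite -[RHS]card_ord -hsum (big_nth (kind0 C)) big_mkord.
have le_n (i : 'I_k) : (kind_size (p i).1 <= n)%N by rewrite -sumk (bigD1 i) //= leq_addr.
have ex_s (i : 'I_k) : exists t : summand n, summand_size t = kind_size (p i).1 /\
    forall x q r, block t x q r = kind_entry a b (p i).1 x q r.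
  by apply: block_kind => //; case/andP: (hp i).
have [s hs] := fin_all_exists ex_s.
have e : (\sum_(i < k) summand_size (s i))%N = n.
  by rewrite -[RHS]sumk; apply: eq_bigr => i _; rewrite (hs i).1.
(* Summands have positive size and the weighted multiplicities add up to [n], so every multiplicity
   fits in ['I_n.+1]. *)
have hc (t : summand n) : (#|[set i | s i == t]| < n.+1)%N.
  rewrite ltnS -[X in (_ <= X)%N]e -sum_summands (bigD1 t) //=; apply: leq_trans (leq_addr _ _).
  exact: leq_pmulr (summand_size_gt0 t).
pose x (i : 'I_k) := (p i).2.
pose d := [ffun t : summand n => Ordinal (hc t)].
pose V : 'M[C]_n := castmx (e, e) (\mxdiag_(i < k) block (s i) (x i)).
have b1 (l : nat * nat) : valid_label L l -> (l.1 < k)%N by case/andP.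
have b2 (l : nat * nat) (h : valid_label L l) : (l.2 < summand_size (s (Ordinal (b1 _ h))))%N.
  by rewrite (hs (Ordinal (b1 _ h))).1; case/andP: (h).
(* The global index of a label in the direct sum; it is injective because [tagnat.Rank] can be
   inverted into block and position. *)
pose pos (l : nat * nat) (h : valid_label L l) : 'I_n := cast_ord e (tagnat.Rank _ (Ordinal (b2 _ h))).
have posI l l' h h' : @pos l h = @pos l' h' -> l = l'.
  have r1 (m : nat * nat) (hm : valid_label L m) :
    nat_of_ord (tagnat.sig1 (@tagnat.Rank k (fun i => summand_size (s i)) _ (Ordinal (b2 m hm)))) = m.1 by rewrite tagnat.Rank1K.
  have r2 (m : nat * nat) (hm : valid_label L m) :
    nat_of_ord (tagnat.sig2 (@tagnat.Rank k (fun i => summand_size (s i)) _ (Ordinal (b2 m hm)))) = m.2 by rewrite tagnat.Rank2K.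
  move=> /cast_ord_inj E; have E1 : l.1 = l'.1 by rewrite -[LHS](r1 l h) -[RHS](r1 l' h') E.
  have E2 : l.2 = l'.2 by rewrite -[LHS](r2 l h) -[RHS](r2 l' h') E.
  by rewrite (surjective_pairing l) E1 E2 -surjective_pairing.
exists d, V; split.
- rewrite /is_decomposition; apply/eqP; rewrite -[RHS]e -sum_summands.
  by apply: eq_bigr => t _; rewrite ffunE.
- exists k, s, x, e; split=> // [i|t]; first by case/andP: (hp i) => _ /eqP.
  by rewrite ffunE.
- apply: (@relabel_equiv _ _ _ (fun r => pos _ (v1 r)) (fun c => pos _ (v2 c)) al be) => //.
  + by move=> r r' /posI /i1.
  + by move=> r r' /posI /i2.
  move=> r c; rewrite hv; congr (_ * _); rewrite /V castmxE /pos !cast_ordK.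
  rewrite (@mxdiag_Rank k _ _ (fun i => kind_entry a b (p i).1 (x i))) //=.
  by move=> i q q'; rewrite (hs i).2.
Qed.

Lemma uw_equiv_param n (A B : 'M[C]_n) : uw_equiv A B -> uw_equiv_mod_param A B.
Proof.
elim=> [x y h|x|x y z _ h1 _ h2]; [by apply: rst_step; left|exact: rst_refl|exact: rst_trans h1 h2].
Qed.

(** Two block sums with the same multiplicities differ by a single generator of the relation, so a
    class equals [g k] for the index [k] of any decomposition found for one of its members. *)
Lemma UW_classes_bound n : (4 <= n)%N ->
  (UW_classes_mod_param R n 4 #<= `I_(num_decompositions n))%card.
Proof.
move=> hn; pose D := [set d : {ffun summand n -> 'I_n.+1} | is_decomposition d].
pose g (k : nat) : set 'M[C]_n := [set V | is_UW 4 V /\ exists d A,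
  [/\ onth (enum D) k = Some d, is_block_sum d A & uw_equiv_mod_param A V]]%classic.
have sub : (UW_classes_mod_param R n 4 `<=` g @` `I_(num_decompositions n))%classic.
  move=> K [W hW ->]; have [d [A [hd hA hWA]]] := UW_block_sum hn hW.
  have hin : d \in enum D by rewrite mem_enum inE.
  exists (index d (enum D)); first by rewrite /= /num_decompositions cardE index_mem.
  have hWA' := uw_equiv_param hWA.
  have od : onth (enum D) (index d (enum D)) = Some d by rewrite onthE (nth_map d) ?nth_index ?index_mem.
  apply/seteqP; split=> V [hV].
    move=> [d' [A' [ed hA' hV']]]; split=> //; have ed' : d' = d by move: ed; rewrite od => -[].
    rewrite ed' in hA'; apply: (rst_trans _ _ _ A) => //; apply: (rst_trans _ _ _ A') => //.
    by apply: rst_step; right; exists d.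
  move=> hV'; split=> //; exists d, A; split=> //.
  by apply: rst_trans hV'; apply: rst_sym.
exact: card_le_trans (subset_card_le sub) (card_image_le _ _).
Qed.

End Bridge.

(** * Existence *)

Section Existence.
Variable R : realType.
Local Notation C := R[i].
Local Notation a := (omega R).
Local Notation b := ((omega R)^*).

Lemma rows_UW n (rows : seq (seq C)) :
  (forall i j, (i < n)%N -> (j < n)%N -> entry rows i j \in [:: 0; 1; -1; a; b; - a; - b]) ->
  (forall i i', (i < n)%N -> (i' < n)%N ->
    \sum_(j < n) entry rows i j * (entry rows i' j)^* = (i == i')%:R * 4) ->
  is_UW 4 (mx_of_rows n rows).
Proof.
move=> h1 h2; split=> [i j|].
  rewrite mxE; have := h1 i j (ltn_ord i) (ltn_ord j); rewrite -/(entry rows i j) !inE.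
  have na : `|a| = 1.
    apply/eqP; rewrite -sqrp_eq1 ?normr_ge0 // sqr_normc -[X in _ == X](omega_conj R); exact: eqxx.
  by case/or4P=> [/eqP->|/eqP->|/eqP->|/or4P[]/eqP->]; [right|left|left|left|left|left|left];
    rewrite ?normrN ?norm_conjC ?normr1.
apply/matrixP => i i'; rewrite !mxE; transitivity (\sum_(j < n) entry rows i j * (entry rows i' j)^*).
  by apply: eq_bigr => l _; rewrite !mxE.
by rewrite h2 // -val_eqE; case: eqP; rewrite ?mul1r ?mul0r.
Qed.

(** This is E_4(1) written out. *)
Definition H4_rows : seq (seq C) :=
  [:: [:: 1; 1; 1; 1]; [:: 1; 1; -1; -1]; [:: 1; -1; 1; -1]; [:: 1; -1; -1; 1]].

Lemma H4_UW : is_UW 4 (mx_of_rows 4 H4_rows).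
Proof.
apply: rows_UW => [[|[|[|[|//]]]] [|[|[|[|//]]]] _ _|[|[|[|[|//]]]] [|[|[|[|//]]]] _ _].
1-16: by rewrite /entry !inE eqxx ?orbT.
all: rewrite !big_ord_recl big_ord0 /entry /= ?rmorphN ?rmorph1 ?rmorph0; ring.
Qed.

Lemma W7_UW : is_UW 4 (mx_of_rows 7 (W7_rows R)).
Proof.
apply: rows_UW => [[|[|[|[|[|[|[|//]]]]]]] [|[|[|[|[|[|[|//]]]]]]] _ _
  |[|[|[|[|[|[|[|//]]]]]]] [|[|[|[|[|[|[|//]]]]]]] _ _].
1-49: by rewrite /entry !inE eqxx ?orbT.
all: rewrite !big_ord_recl big_ord0 /entry /= ?rmorphN ?rmorph1 ?rmorph0; ring.
Qed.

Lemma omega_simp : (a * b = 1) * (b * a = 1) * (a * a = b) * (b * b = a) * (b^* = a).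
Proof.
have ab := omega_conj R; have sab := omega_sum R; have e := aa ab sab.
have ba : b * a = 1 by rewrite mulrC.
have bb : b * b = a by rewrite -{1}e -mulrA ab mulr1.
by do !split => //; exact: conjCK.
Qed.

Lemma W5_UW : is_UW 4 (mx_of_rows 5 (W5_rows R)).
Proof.
apply: rows_UW => [[|[|[|[|[|//]]]]] [|[|[|[|[|//]]]]] _ _|[|[|[|[|[|//]]]]] [|[|[|[|[|//]]]]] _ _].
1-25: by rewrite /entry !inE eqxx ?orbT.
all: rewrite !big_ord_recl big_ord0 /entry /= ?rmorphN ?rmorph1 ?rmorph0 !(omega_simp, mulr1, mul1r, mul0r, mulr0).
all: rewrite ?(bE (omega_sum R)); ring.
Qed.

Lemma W6_UW : is_UW 4 (mx_of_rows 6 (W6_rows R)).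
Proof.
apply: rows_UW => [[|[|[|[|[|[|//]]]]]] [|[|[|[|[|[|//]]]]]] _ _
  |[|[|[|[|[|[|//]]]]]] [|[|[|[|[|[|//]]]]]] _ _].
1-36: by rewrite /entry !inE eqxx ?orbT.
all: rewrite !big_ord_recl big_ord0 /entry /= !(rmorphN, rmorph1, rmorph0) /=
  !(omega_simp, opprK, mulr1, mul1r, mul0r, mulr0, mulrN, mulNr).
all: rewrite ?(bE (omega_sum R)); ring.
Qed.

Lemma UW_block_mx m n (A : 'M[C]_m) (B : 'M[C]_n) :
  is_UW 4 A -> is_UW 4 B -> is_UW 4 (block_mx A 0 0 B).
Proof.
move=> [a1 a2] [b1 b2]; split.
  move=> i j; case: (split_ordP i) => i' ->; case: (split_ordP j) => j' ->;
    by rewrite ?block_mxEul ?block_mxEur ?block_mxEdl ?block_mxEdr ?mxE; auto.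
have e : (block_mx A 0 0 B)^t* = block_mx (A^t*) 0 0 (B^t*).
  by rewrite tr_block_mx map_block_mx !trmx0 !map_mx0.
rewrite e mulmx_block a2 b2 !mulmx0 !mul0mx !addr0 !add0r.
by rewrite -scalar_mx_block.
Qed.

Lemma UW_exists n : (4 <= n)%N -> exists W : 'M[C]_n, is_UW 4 W.
Proof.
have [k] := ubnP n; elim: k n => // k IH n hk hn.
(* From order 8 on, a block of order 4 is split off and [n - 4] is still at least 4; orders 4 to 7
   have explicit matrices. *)
have [l|l] := ltnP n 8; last first.
  have [||W hW] := IH (n - 4)%N; rewrite ?leq_subRL //; first by lia.
  have [W0 h0] : exists W0 : 'M[C]_(4 + (n - 4)), is_UW 4 W0.
    by eexists; apply: UW_block_mx H4_UW hW.
  by move: W0 h0; rewrite subnKC // => W0 h0; exists W0.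
move: n hk hn l => [|[|[|[|[|[|[|[|//]]]]]]]] // _ _ _; eexists.
- exact: H4_UW.
- exact: W5_UW.
- exact: W6_UW.
- exact: W7_UW.
Qed.
End Existence.

Local Open Scope card_scope.
Theorem mainTheorem2 (R : realType) (n : nat) (hn : (4 <= n)%N) :
  (exists W : 'M[R[i]]_n, is_UW 4 W) /\
  (forall W : 'M[R[i]]_n, is_UW 4 W ->
     exists (d : {ffun summand n -> 'I_n.+1}) (V : 'M[R[i]]_n),
       [/\ is_decomposition d, is_block_sum d V & uw_equiv W V]) /\
  UW_classes_mod_param R n 4 #<= `I_(num_decompositions n).
Proof.
split; first exact: UW_exists.
by split; [move=> W; exact: UW_block_sum | exact: UW_classes_bound].
Qed.
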